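(* Let $M$ be a $5$-dimensional smooth manifold with an $\mathrm{SU}(2)$-structure $(\alpha,\omega_1,\omega_2,\omega_3)$ having torsion forms $(f_{ij},\phi_i,\nu_i,\sigma_i)$, and let $g$ be the induced Riemannian metric. Then the scalar curvature $s$ of $g$ is $$ \begin{aligned} s=&-5f_{11}^2-\sum_{i=1}^3\phi_{i}^2-4\phi_{1}f_{23}+4\phi_{2}f_{13}-4\phi_{3}f_{12}+\sum_{i=1}^3d^*\nu_i-2d^*\nu_4-\frac{1}{2}\sum_{i=1}^3|\nu_i|^2\\ &+\langle\nu_1,\nu_2\rangle+\langle\nu_1,\nu_3\rangle-\langle\nu_1,\nu_4\rangle+\langle\nu_2,\nu_3\rangle-\langle\nu_2,\nu_4\rangle-\langle\nu_3,\nu_4\rangle\\ &-2*(df_{11}\wedge\omega_1^2)-\frac{1}{2}\sum_{i=1}^4|\sigma_i|^2 . \end{aligned} $$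
   Context: An $\mathrm{SU}(2)$-structure on a smooth $5$-manifold $M$ is a reduction of the frame bundle to $\mathrm{SU}(2)$; equivalently, a quadruple $(\alpha,\omega_1,\omega_2,\omega_3)$ with $\alpha$ a nowhere vanishing $1$-form and $\omega_1,\omega_2,\omega_3$ $2$-forms with $\omega_i\wedge\omega_j=\delta_{ij}v$ for a $4$-form $v$ with $v\wedge\alpha\ne0$ everywhere, and such that $\iota_X\omega_1=\iota_Y\omega_2$ implies $\omega_3(X,Y)\ge 0$. Near each point there are adapted coframes $e^1,\dots,e^5$ with $\alpha=e^5$, $\omega_1=e^{12}+e^{34}$, $\omega_2=e^{13}-e^{24}$, $\omega_3=e^{14}+e^{23}$ (where $e^{ij}=e^i\wedge e^j$). The induced Riemannian metric is $g=\sum_{i=1}^5 e^i\otimes e^i$; orientation is given by $\alpha\wedge\omega_1^2$; $*$ is the Hodge star of $g$, $d^*$ is the codifferential (formal adjoint of $d$), and $\langle\cdot,\cdot\rangle$, $|\cdot|$ are the scalar product and norm induced on forms (so $|e^{12}|=1$). The Reeb field $R_\alpha$ is defined by $\alpha(R_\alpha)=1$, $\iota_{R_\alpha}\omega_1=0$ (then $\iota_{R_\alpha}\omega_2=\iota_{R_\alpha}\omega_3=0$). $\Lambda^p_0M$ is the space of $p$-forms annihilated by $\iota_{R_\alpha}$, and $\Lambda^2_3M=\{\sigma\in\Lambda^2_0M:\sigma\wedge\omega_r=0,\ r=1,2,3\}$. Torsion forms: there are unique $\nu_i\in\Lambda^1_0M$, $\sigma_i\in\Lambda^2_3M$ ($i=1,\dots,4$)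 and smooth functions $\phi_i$, $f_{ij}$ ($i,j=1,2,3$) such that $$d\omega_r=\nu_r\wedge\omega_r+\sum_{j=1}^3f_{rj}\,\alpha\wedge\omega_j+\alpha\wedge\sigma_r\quad(r=1,2,3),\qquad d\alpha=\alpha\wedge\nu_4+\sum_{i=1}^3\phi_i\,\omega_i+\sigma_4 .$$ They satisfy $f_{11}=f_{22}=f_{33}$ and $f_{ij}=-f_{ji}$ for $i\ne j$. The sign of $s$ is the usual one (positive on round spheres). *)

(* Defs.v *)
From HB Require Import structures.
From mathcomp Require Import all_boot all_order all_algebra all_fingroup.
From mathcomp Require Import all_classical all_reals all_analysis.

Set Implicit Arguments.
Unset Strict Implicit.
Unset Printing Implicit Defensive.

Import Order.TTheory GRing.Theory Num.Theory.
Import numFieldNormedType.Exports.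

Local Open Scope classical_set_scope.
Local Open Scope ring_scope.

(* Indices are written as in the usual 1-based notation: o3 1, o3 2, o3 3. *)
Notation o3 k := (@Ordinal 3 k.-1 isT) (only parsing).
Notation o4 k := (@Ordinal 4 k.-1 isT) (only parsing).
Notation o5 k := (@Ordinal 5 k.-1 isT) (only parsing).

(* The inclusion of the index set {1, 2, 3} into {1, 2, 3, 4}. *)
Definition w34 (i : 'I_3) : 'I_4 := widen_ord (leqnSn 3) i.

Section ExteriorAlgebra.
Variables (R : realType) (n : nat).

(* A p-form on R^n eats p vectors, given as the rows of a p x n matrix. *)
Definition pform (p : nat) : Type := 'M[R]_(p, n) -> R.

Record is_form (p : nat) (a : pform p) : Prop := IsForm {
  form_multilinear : forall (A B C : 'M[R]_(p, n)) i0 b c,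
    row i0 A = b *: row i0 B + c *: row i0 C ->
    row' i0 B = row' i0 A -> row' i0 C = row' i0 A ->
    a A = b * a B + c * a C;
  form_alternating : forall (A : 'M[R]_(p, n)) i1 i2,
    i1 != i2 -> A i1 =1 A i2 -> a A = 0 }.

(* Normalised so that (a /\ b)(x, y) = a x * b y - a y * b x on 1-forms. *)
Definition wedge (p q : nat) (a : pform p) (b : pform q) : pform (p + q) :=
  fun v => (p`! * q`!)%:R^-1 *
    \sum_(s : 'S_(p + q)) (-1) ^+ s *
      a (usubmx (row_perm s v)) * b (dsubmx (row_perm s v)).

Definition interior (p : nat) (X : 'rV[R]_n) (a : pform p.+1) : pform p :=
  fun v => a (col_mx X v).

Definition basis_vectors (p : nat) (I : {ffun 'I_p -> 'I_n}) : 'M[R]_(p, n) :=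
  rowsub I 1%:M.

(* In the next three definitions G is the Gram matrix of the metric in the
   standard basis.  The sums over all multi-indices are divided by p!, so that
   the wedge products of an orthonormal coframe have norm 1. *)
Definition form_dot (p : nat) (G : 'M[R]_n) (a b : pform p) : R :=
  p`!%:R^-1 *
  \sum_(I : {ffun 'I_p -> 'I_n}) \sum_(J : {ffun 'I_p -> 'I_n})
    (\prod_(k < p) invmx G (I k) (J k)) *
    a (basis_vectors I) * b (basis_vectors J).

(* The unit volume form of G in the orientation of the nonzero n-form o. *)
Definition volume_form (G : 'M[R]_n) (o : pform n) : pform n :=
  fun v => Num.sg (o 1%:M) * Num.sqrt (\det G) * \det v.

(* For p + q = n: a /\ star b = <a, b> vol. *)
Definition star (p q : nat) (G : 'M[R]_n) (vol : pform (p + q)) (a : pform p) :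
    pform q :=
  fun w => p`!%:R^-1 *
  \sum_(I : {ffun 'I_p -> 'I_n}) \sum_(J : {ffun 'I_p -> 'I_n})
    (\prod_(k < p) invmx G (I k) (J k)) *
    a (basis_vectors I) * vol (col_mx (basis_vectors J) w).

End ExteriorAlgebra.

Section LocalCalculus.
Variables (R : realType) (n : nat).
Implicit Types (y : 'rV[R]_n) (i j k l m : 'I_n).

Definition partial i (h : 'rV[R]_n -> R) : 'rV[R]_n -> R :=
  fun y => 'D_(delta_mx 0 i) h y.

(* C^oo on the open set U: all iterated partial derivatives exist on U and are
   continuous there. *)
Definition smooth_on (U : set 'rV[R]_n) (h : 'rV[R]_n -> R) : Prop :=
  forall (s : seq 'I_n) y, U y ->
    {for y, continuous (foldr partial h s)} /\
    (forall i, derivable (foldr partial h s) y (delta_mx 0 i)).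

(* (d a)(v_0, .., v_p) = \sum_k (-1)^k D_(v_k) (a (v_0, .., v_k omitted, .., v_p))
   for constant vector fields v_i. *)
Definition ext_d (p : nat) (a : 'rV[R]_n -> pform R n p) :
    'rV[R]_n -> pform R n p.+1 :=
  fun y v => \sum_(k < p.+1)
    (-1) ^+ k * 'D_(row k v) (fun z => a z (row' k v)) y.

Definition form_of_fun (h : 'rV[R]_n -> R) : 'rV[R]_n -> pform R n 0 :=
  fun y _ => h y.

Variable G : 'rV[R]_n -> 'M[R]_n.

Definition christoffel k i j y : R :=
  2^-1 * \sum_l invmx (G y) k l *
    (partial i (fun z => G z j l) y + partial j (fun z => G z i l) y
     - partial l (fun z => G z i j) y).

(* The l-th component of R(X_i, X_j) X_k for the coordinate fields X, where
   R(X, Y) = [nabla_X, nabla_Y] - nabla_[X, Y]. *)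
Definition riemann l i j k y : R :=
  partial i (christoffel l j k) y - partial j (christoffel l i k) y
  + \sum_m (christoffel l i m y * christoffel m j k y
            - christoffel l j m y * christoffel m i k y).

Definition ricci j k y : R := \sum_i riemann i i j k y.

Definition scalar_curvature y : R :=
  \sum_j \sum_k invmx (G y) j k * ricci j k y.

End LocalCalculus.

(* The codifferential of a 1-form in dimension 5: on p-forms in dimension n it
   is (-1)^(n(p+1)+1) * d *, and the sign is -1 here. *)
Definition codiff1 (R : realType) (G : 'rV[R]_5 -> 'M[R]_5)
    (vol : 'rV[R]_5 -> pform R 5 5) (a : 'rV[R]_5 -> pform R 5 1) :
    'rV[R]_5 -> R :=
  fun y => - @star R 5 5 0 (G y) (vol y)
    (ext_d (fun z => @star R 5 1 4 (G z) (vol z) (a z)) y) 0.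

(* A smooth n-manifold: a Hausdorff second countable space with a smooth
   atlas.  Only the values of cinv c on the image of the chart c matter. *)
Record manifold (R : realType) (n : nat) := Manifold {
  mpoint :> topologicalType;
  chart : Type;
  cdom : chart -> set mpoint;
  cmap : chart -> mpoint -> 'rV[R]_n;
  cinv : chart -> 'rV[R]_n -> mpoint;
  manifold_hausdorff : hausdorff_space mpoint;
  manifold_countable : @second_countable mpoint;
  cdom_open : forall c, open (cdom c);
  cim_open : forall c, open (cmap c @` cdom c);
  cmapK : forall c x, cdom c x -> cinv c (cmap c x) = x;
  cmap_continuous : forall c x, cdom c x -> {for x, continuous (cmap c)};
  cinv_continuous : forall c y,
    (cmap c @` cdom c) y -> {for y, continuous (cinv c)};
  charts_cover : forall x, exists c, cdom c x;
  transition_smooth : forall c c' (j : 'I_n),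
    smooth_on (cmap c @` (cdom c `&` cdom c'))
      (fun y => cmap c' (cinv c y) 0 j) }.

Section Tensors.
Variables (R : realType) (n : nat) (M : manifold R n).

Definition cim (c : chart M) : set 'rV[R]_n := cmap c @` cdom c.

Definition coverlap (c c' : chart M) : set 'rV[R]_n :=
  cmap c @` (cdom c `&` cdom c').

Definition transition (c c' : chart M) (y : 'rV[R]_n) : 'rV[R]_n :=
  cmap c' (cinv c y).

Definition smooth_function (h : M -> R) : Prop :=
  forall c, smooth_on (cim c) (h \o cinv c).

(* A differential form or a metric is given by its coordinate expressions in
   all charts; only the values on the images of the charts matter.  The
   Jacobian 'J acts on row vectors from the right. *)
Definition field_of_forms (p : nat) : Type :=
  chart M -> 'rV[R]_n -> pform R n p.

Record is_dform (p : nat) (a : field_of_forms p) : Prop := IsDForm {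
  dform_form : forall c y, cim c y -> is_form (a c y);
  dform_smooth : forall c v, smooth_on (cim c) (fun y => a c y v);
  dform_compat : forall c c' y, coverlap c c' y -> forall v,
    a c y v = a c' (transition c c' y) (v *m 'J (transition c c') y) }.

Record is_metric (g : chart M -> 'rV[R]_n -> 'M[R]_n) : Prop := IsMetric {
  metric_sym : forall c y, cim c y -> (g c y)^T = g c y;
  metric_pos : forall c y, cim c y ->
    forall X : 'rV[R]_n, X != 0 -> 0 < (X *m g c y *m X^T) 0 0;
  metric_smooth : forall c i j, smooth_on (cim c) (fun y => g c y i j);
  metric_compat : forall c c' y, coverlap c c' y ->
    g c y = 'J (transition c c') y *m g c' (transition c c' y) *m
            ('J (transition c c') y)^T }.

End Tensors.

Section SU2.
Variable R : realType.

Section Pointwise.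
Variables (alpha : pform R 5 1) (omega : 'I_3 -> pform R 5 2).

Definition adapted_coframe (e : 'I_5 -> pform R 5 1) : Prop :=
  let e_ i j := wedge (e i) (e j) in
  [/\ forall i, is_form (e i),
      \matrix_(i < 5, j < 5) e i (delta_mx 0 j) \in unitmx,
      forall v, alpha v = e (o5 5) v &
      forall v,
        [/\ omega (o3 1) v = e_ (o5 1) (o5 2) v + e_ (o5 3) (o5 4) v,
            omega (o3 2) v = e_ (o5 1) (o5 3) v - e_ (o5 2) (o5 4) v &
            omega (o3 3) v = e_ (o5 1) (o5 4) v + e_ (o5 2) (o5 3) v]].

Definition is_reeb (X : 'rV[R]_5) : Prop :=
  alpha X = 1 /\ forall Y, interior X (omega (o3 1)) Y = 0.

Definition in_Lambda0 (p : nat) (a : pform R 5 p.+1) : Prop :=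
  forall X, is_reeb X -> forall v, interior X a v = 0.

Definition in_Lambda23 (s : pform R 5 2) : Prop :=
  in_Lambda0 s /\ forall r v, wedge s (omega r) v = 0.

End Pointwise.

Variable M : manifold R 5.

Record su2_structure (alpha : field_of_forms M 1)
    (omega : 'I_3 -> field_of_forms M 2) : Prop := SU2Structure {
  su2_alpha : is_dform alpha;
  su2_omega : forall i, is_dform (omega i);
  su2_alpha_neq0 : forall c y, cim c y -> exists X, alpha c y X != 0;
  su2_wedge : exists v : field_of_forms M 4,
    [/\ is_dform v,
        forall i j c y, cim c y -> forall w,
          wedge (omega i c y) (omega j c y) w = (i == j)%:R * v c y w &
        forall c y, cim c y -> exists w, wedge (v c y) (alpha c y) w != 0];
  su2_sign : forall c y, cim c y -> forall X Y : 'rV[R]_5,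
    (forall v, interior X (omega (o3 1) c y) v
               = interior Y (omega (o3 2) c y) v) ->
    0 <= omega (o3 3) c y (col_mx X Y) }.

(* g = \sum_i e^i (x) e^i in every adapted coframe. *)
Definition induced_metric (alpha : field_of_forms M 1)
    (omega : 'I_3 -> field_of_forms M 2)
    (g : chart M -> 'rV[R]_5 -> 'M[R]_5) : Prop :=
  is_metric g /\
  forall c y, cim c y -> forall e,
    adapted_coframe (alpha c y) (omega^~ c ^~ y) e ->
    forall X Y : 'rV[R]_5,
      (X *m g c y *m Y^T) 0 0 = \sum_(i < 5) e i X * e i Y.

(* The volume form of g in the orientation of alpha /\ omega_1 ^ 2. *)
Definition su2_volume (alpha : field_of_forms M 1)
    (omega : 'I_3 -> field_of_forms M 2)
    (g : chart M -> 'rV[R]_5 -> 'M[R]_5) : field_of_forms M 5 :=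
  fun c y => volume_form (g c y)
    (wedge (alpha c y) (wedge (omega (o3 1) c y) (omega (o3 1) c y))).

Record torsion_forms (alpha : field_of_forms M 1)
    (omega : 'I_3 -> field_of_forms M 2)
    (f : 'I_3 -> 'I_3 -> M -> R) (phi : 'I_3 -> M -> R)
    (nu : 'I_4 -> field_of_forms M 1)
    (sigma : 'I_4 -> field_of_forms M 2) : Prop := TorsionForms {
  torsion_f : forall i j, smooth_function (f i j);
  torsion_phi : forall i, smooth_function (phi i);
  torsion_nu : forall i, is_dform (nu i);
  torsion_sigma : forall i, is_dform (sigma i);
  torsion_nu0 : forall i c y, cim c y ->
    in_Lambda0 (alpha c y) (omega^~ c ^~ y) (nu i c y);
  torsion_sigma3 : forall i c y, cim c y ->
    in_Lambda23 (alpha c y) (omega^~ c ^~ y) (sigma i c y);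
  torsion_domega : forall r c y, cim c y -> forall v,
    ext_d (omega r c) y v =
      wedge (nu (w34 r) c y) (omega r c y) v
      + \sum_(j < 3) f r j (cinv c y) * wedge (alpha c y) (omega j c y) v
      + wedge (alpha c y) (sigma (w34 r) c y) v;
  torsion_dalpha : forall c y, cim c y -> forall v,
    ext_d (alpha c) y v =
      wedge (alpha c y) (nu (o4 4) c y) v
      + \sum_(i < 3) phi i (cinv c y) * omega i c y v
      + sigma (o4 4) c y v }.

End SU2.

(* Main.v *)
Require Import Defs.
From mathcomp Require Import all_boot all_order all_algebra all_fingroup.
From mathcomp Require Import all_classical all_reals all_analysis.
From mathcomp Require Import ring lra.

Set Implicit Arguments.
Unset Strict Implicit.
Unset Printing Implicit Defensive.

Import Order.TTheory GRing.Theory Num.Theory.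
Import numFieldNormedType.Exports.

Local Open Scope ring_scope.

(** The proof is the method of moving frames.  Around a point one chooses an adapted
    coframe [e^1, .., e^5] that is twice differentiable; its matrix in the coordinates
    is [E], and the dual frame is the inverse transpose of [E].  In such a coframe the
    metric is [E^T *m E] and the structure forms [alpha], [omega_r] have constant
    coefficients, so that all first order data of the SU(2)-structure are the structure
    functions [t a b c = d e^a (e_b, e_c)].

    - Existence of the coframe.  At one point it is linear algebra
      ([adapted_frame_exists]): the Reeb vector spans the common kernel of the
      [omega_r], and the relations [omega_i /\ omega_j = delta_ij v] together with the
      sign condition allow any basis of a complement to be normalised.  To let it depend
      smoothly on the point ([smooth_adapted_coframe]), one uses that SU(2), seen as
      the unit quaternions, acts simply transitively on unit horizontal vectors: the
      coframe adapted to a chosen horizontal direction is unique, hence given by explicit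
      formulas in [alpha], [omega_r], [g] and one inverse square root.

    - Curvature.  The Christoffel symbols of [E^T *m E] are gauge equivalent to the
      connection form of the Koszul formula, so the scalar curvature is a quadratic
      polynomial in [t] plus frame derivatives of [t], linearly
      ([scalar_curvature_connection]).

    - Torsion.  The structure equations for [d alpha] and [d omega_r] identify the
      values of [nu_i], [f_ij], [phi_i] and [|sigma_i|^2] in the frame with linear and
      quadratic expressions in [t] ([nu_components], [f_components], [phi_components],
      [sigma_components]).  The codifferential is minus a divergence
      ([codiff1_frame]), and [df /\ omega_1^2] is twice the Reeb derivative of [f] times
      the volume form ([star_differential_volume]).

    Both sides of the formula are now polynomials in the 50 functions [t a b c], [b < c],
    and their frame derivatives.  They are not identical: their difference is a signed
    sum of four Jacobi identities, that is, of components of [d (d e^a) = 0].  With these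
    subtracted the formula is a polynomial identity ([torsion_curvature]). *)

(** * Alternating forms on families of vectors *)

Section Multilinear.
Variables (R : realType) (n : nat).

Lemma row'_eqP (p : nat) (i0 : 'I_p) (A B : 'M[R]_(p, n)) :
  row' i0 A = row' i0 B <-> (forall i j, i != i0 -> A i j = B i j).
Proof.
split=> [eAB i j ii0|eAB].
  have [k ->] : exists k, i = lift i0 k.
    by case: (unliftP i0 i) ii0 => [k ->|->]; [exists k | rewrite eqxx].
  by move/matrixP: eAB => /(_ k j); rewrite !mxE.
by apply/matrixP => i j; rewrite !mxE eAB// eq_sym neq_lift.
Qed.

Definition set_row (p : nat) (v : 'M[R]_(p, n)) i0 (x : 'rV[R]_n) :
    'M[R]_(p, n) :=
  \matrix_(i, j) if i == i0 then x 0 j else v i j.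

Lemma row_set_row p (v : 'M[R]_(p, n)) i0 x : row i0 (set_row v i0 x) = x.
Proof. by apply/rowP => j; rewrite !mxE eqxx. Qed.

Lemma row'_set_row p (v : 'M[R]_(p, n)) i0 x :
  row' i0 (set_row v i0 x) = row' i0 v.
Proof. by apply/row'_eqP => i j /negPf ii0; rewrite mxE ii0. Qed.

Lemma row_neq_set_row p (v : 'M[R]_(p, n)) i0 i x :
  i != i0 -> row i (set_row v i0 x) = row i v.
Proof. by move=> /negPf ii0; apply/rowP => j; rewrite !mxE ii0. Qed.

Section OneForm.
Variables (p : nat) (a : pform R n p).
Hypothesis fa : is_form a.

Lemma form_row0 v i0 : row i0 v = 0 -> a v = 0.
Proof.
move=> v0; have -> : a v = 0 * a v + 0 * a v.
  by apply: (form_multilinear fa (i0 := i0)) => //; rewrite v0 !scaler0 addr0.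
by rewrite !mul0r addr0.
Qed.

Lemma form_row_sum m (v : 'M[R]_(p, n)) i0 (c : 'I_m -> R)
    (V : 'I_m -> 'M[R]_(p, n)) :
  row i0 v = \sum_j c j *: row i0 (V j) ->
  (forall j, row' i0 (V j) = row' i0 v) -> a v = \sum_j c j * a (V j).
Proof.
elim: m v c V => [|m IH] v c V.
  by rewrite !big_ord0 => /form_row0.
rewrite big_ord_recl => rv eV.
rewrite big_ord_recl.
pose u := set_row v i0 (\sum_(j < m) c (lift ord0 j) *: row i0 (V (lift ord0 j))).
rewrite (form_multilinear fa (i0 := i0) (A := v) (B := V ord0) (C := u)
  (b := c ord0) (c := 1)) //; last 2 first.
- by rewrite row_set_row scale1r.
- by rewrite row'_set_row.
rewrite mul1r; congr (_ + _); apply: IH; first by rewrite row_set_row.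
by move=> j; rewrite eV row'_set_row.
Qed.

Lemma form_set_rowD (v : 'M[R]_(p, n)) i0 (x y : 'rV[R]_n) :
  a (set_row v i0 (x + y)) = a (set_row v i0 x) + a (set_row v i0 y).
Proof.
rewrite (form_multilinear fa (i0 := i0) (B := set_row v i0 x)
  (C := set_row v i0 y) (b := 1) (c := 1)) ?mul1r//.
- by rewrite !row_set_row !scale1r.
- by rewrite !row'_set_row.
- by rewrite !row'_set_row.
Qed.

Lemma form_eq_rows v i1 i2 : i1 != i2 -> row i1 v = row i2 v -> a v = 0.
Proof.
move=> i12 /rowP e; apply: (form_alternating fa i12) => j.
by have := e j; rewrite !mxE.
Qed.

(** Expanding [a] on a matrix whose rows [i1] and [i2] are both the sum of
    these two rows leaves the two mixed terms. *)
Lemma form_swap v i1 i2 : i1 != i2 -> a (xrow i1 i2 v) = - a v.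
Proof.
move=> i12; have i21 : i2 != i1 by rewrite eq_sym.
set x := row i1 v; set y := row i2 v.
pose V z w := set_row (set_row v i1 z) i2 w.
have V0 z : a (V z z) = 0.
  apply: (form_eq_rows i12).
  by rewrite /V row_neq_set_row// !row_set_row.
have VD z w u : a (V (z + w) u) = a (V z u) + a (V w u).
  have VE t : V t u = set_row (set_row v i2 u) i1 t.
    apply/matrixP => i j; rewrite !mxE.
    by case: (eqVneq i i2) => [->|//]; rewrite (negPf i21).
  by rewrite !VE form_set_rowD.
have VDr z w u : a (V z (w + u)) = a (V z w) + a (V z u).
  exact: form_set_rowD.
have : a (V (x + y) (x + y)) = 0 by [].
rewrite VD !VDr !V0 add0r addr0 => /eqP.
rewrite addrC addr_eq0 => /eqP.
have -> : V x y = v.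
  apply/matrixP => i j; rewrite !mxE.
  by case: (eqVneq i i2) => [->//|_]; case: (eqVneq i i1) => [->|].
have -> // : V y x = xrow i1 i2 v.
apply/matrixP => i j; rewrite !mxE.
case: (eqVneq i i2) => [->|i_2]; first by rewrite tpermR.
case: (eqVneq i i1) => [->|i_1]; first by rewrite tpermL.
by rewrite tpermD// eq_sym.
Qed.

Lemma form_perm (s : 'S_p) v : a (row_perm s v) = (-1) ^+ s * a v.
Proof.
have [ts -> dts] := prod_tpermP s.
elim: ts dts v => [_|[i j] ts IH /andP[/= ij dts]] v.
  by rewrite big_nil row_perm1 odd_perm1 expr0 mul1r.
rewrite big_cons /= row_permM form_swap// IH//.
by rewrite odd_mul_tperm ij signr_addb expr1 mulN1r mulNr.
Qed.

End OneForm.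

(** The first row is singled out because the interior product prepends a vector. *)
Lemma col_mx1E q (x : 'rV[R]_n) (v : 'M[R]_(q, n)) (i : 'I_q.+1) j :
  (col_mx x v : 'M[R]_(q.+1, n)) i j =
  if unlift ord0 i is Some k then v k j else x 0 j.
Proof.
case: unliftP => [k|] -> /=.
  by have -> : lift ord0 k = rshift 1 k; [apply: val_inj | rewrite (@col_mxEd _ 1)].
have -> : ord0 = lshift q (@ord0 0) by apply: val_inj.
exact: (@col_mxEu _ 1).
Qed.

Lemma is_form_interior p (a : pform R n p.+1) x :
  is_form a -> is_form (Defs.interior x a).
Proof.
move=> fa; have row'E (i0 : 'I_p) (A B : 'M[R]_(p, n)) :
    row' i0 A = row' i0 B -> row' (lift ord0 i0) (col_mx x A : 'M[R]_(p.+1, n)) =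
    row' (lift ord0 i0) (col_mx x B : 'M[R]_(p.+1, n)).
  move=> /row'_eqP e; apply/row'_eqP => i j; rewrite !col_mx1E.
  by case: unliftP => [k ->|//]; rewrite (inj_eq (@lift_inj _ _)); apply: e.
split=> [A B C i0 b c eA eB eC|A i1 i2 i12 e12].
  apply: (form_multilinear fa (i0 := lift ord0 i0)); try exact: row'E.
  apply/rowP => j; rewrite mxE col_mx1E [RHS]mxE ![(_ *: row _ _) 0 j]mxE.
  rewrite ![row _ _ 0 j]mxE !col_mx1E !liftK.
  by move/rowP: eA => /(_ j); rewrite !mxE.
apply: (form_alternating fa (i1 := lift ord0 i1) (i2 := lift ord0 i2)).
  by rewrite (inj_eq (@lift_inj _ _)).
by move=> j; rewrite !col_mx1E !liftK e12.
Qed.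

(** Expanding each row on the rows of [W].  This is how a change of frame acts on the
    components of a form, and for square matrices it produces the determinant. *)
Lemma form_mulmx p m (a : pform R n p) (C : 'M[R]_(p, m)) (W : 'M[R]_(m, n)) :
  is_form a -> a (C *m W) =
  \sum_(I : {ffun 'I_p -> 'I_m}) (\prod_k C k (I k)) * a (rowsub I W).
Proof.
elim: p => [|p IH] in a C *.
  move=> _; rewrite (big_pred1 [ffun i : 'I_0 => match i with Ordinal _ h =>
    False_rect _ (notF h) end]) => [|I]; last first.
    by apply/esym/eqP/ffunP => -[].
  by rewrite big_ord0 mul1r; congr a; apply/matrixP => -[].
move=> fa.
pose V j : 'M[R]_(p.+1, n) := col_mx (row j W) (row' ord0 (C *m W)).
rewrite (form_row_sum fa (i0 := ord0) (c := C ord0) (V := V)); first last.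
- move=> j; apply/row'_eqP => i k i0; rewrite col_mx1E.
  by case: unliftP i0 => [i' ->|->]; rewrite ?eqxx// [LHS]mxE.
- apply/rowP => k; rewrite !mxE summxE; apply: eq_bigr => j _.
  by rewrite mxE [row ord0 _ 0 k]mxE col_mx1E unlift_none mxE.
pose h (jI : 'I_m * {ffun 'I_p -> 'I_m}) : {ffun 'I_p.+1 -> 'I_m} :=
  [ffun k => if unlift ord0 k is Some k' then jI.2 k' else jI.1].
rewrite (reindex h) /=; last first.
  exists (fun I : {ffun 'I_p.+1 -> 'I_m} => (I ord0, [ffun k => I (lift ord0 k)])).
    move=> [j I] _; rewrite /h /= ffunE unlift_none; congr pair.
    by apply/ffunP => k; rewrite !ffunE liftK.
  move=> I _; apply/ffunP => k; rewrite ffunE.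
  by case: unliftP => [k'|] -> //=; rewrite ffunE.
rewrite -(pair_bigA _ (fun j I => (\prod_k C k (h (j, I) k)) *
  a (rowsub (h (j, I)) W))) /=.
apply: eq_bigr => j _; rewrite /V.
have -> : row' ord0 (C *m W) = row' ord0 C *m W.
  by apply/matrixP => i k; rewrite !mxE; apply: eq_bigr => l _; rewrite !mxE.
rewrite -[a _]/(Defs.interior (row j W) a _) IH; last exact: is_form_interior.
rewrite mulr_sumr; apply: eq_bigr => I _.
rewrite big_ord_recl mulrA ffunE unlift_none; congr (_ * _ * _).
  by apply: eq_bigr => k _; rewrite !mxE ffunE liftK.
rewrite /Defs.interior; congr a; apply/matrixP => i k.
by rewrite col_mx1E !mxE ffunE; case: unliftP => [i'|] _; rewrite ?mxE.
Qed.

End Multilinear.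

(** * Top degree forms and wedge products *)

Section TopForms.
Variables (R : realType).

(** An alternating summand only sees injective multi-indices, which for [p = n] are the
    permutations. *)
Lemma sum_ffun_perm n (F : {ffun 'I_n -> 'I_n} -> R) :
  (forall (I : {ffun 'I_n -> 'I_n}) i j, i != j -> I i = I j -> F I = 0) ->
  \sum_I F I = \sum_(s : 'S_n) F (pval s).
Proof.
move=> F0.
rewrite (bigID (fun I : {ffun 'I_n -> 'I_n} => injectiveb I)) /= addrC.
rewrite big1 ?add0r => [|I /injectivePn[i [j ij eij]]]; last exact: F0 eij.
rewrite (reindex (@pval _)) /=; last first.
  pose in_Sn := insubd (1%g : 'S_n).
  by exists in_Sn => /= f Uf; first apply: val_inj; apply: insubdK.
by apply: eq_bigl => s /=; rewrite (valP s).
Qed.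

Lemma rowsub_perm m n (s : 'S_m) (W : 'M[R]_(m, n)) :
  rowsub (pval s) W = row_perm s W.
Proof. by apply/matrixP => i j; rewrite !mxE -pvalE. Qed.

Lemma form_top n (a : pform R n n) v :
  is_form a -> a v = \det v * a 1%:M.
Proof.
move=> fa; rewrite -{1}[v]mulmx1 form_mulmx// sum_ffun_perm; last first.
  move=> I i j ij eij; rewrite (form_alternating fa ij) ?mulr0// => k.
  by rewrite !mxE eij.
rewrite mulr_suml; apply: eq_bigr => s _.
rewrite rowsub_perm form_perm// mulrCA mulrA; congr (_ * _ * _).
by apply: eq_bigr => k _; rewrite -pvalE.
Qed.

Lemma is_form_det n (c : R) : is_form (fun v : 'M[R]_n => c * \det v).
Proof.
split=> [A B C i0 b d eA eB eC|A i1 i2 i12 e12].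
  by rewrite (determinant_multilinear eA eB eC); ring.
by rewrite (determinant_alternate i12 e12) mulr0.
Qed.

(** A permutation of [n.+1] is the image of the first index together with a permutation
    of the rest. *)
Lemma sum_perm_lift n (F : 'S_n.+1 -> R) :
  \sum_s F s = \sum_k \sum_(s : 'S_n) F (lift_perm ord0 k s).
Proof.
pose h (ks : 'I_n.+1 * 'S_n) := lift_perm ord0 ks.1 ks.2.
rewrite pair_bigA /= (reindex h) //=; apply: onW_bij; apply: inj_card_bij.
  move=> [k s] [k' s'] /permP /= e.
  have ek : k = k' by have := e ord0; rewrite /h !lift_perm_id.
  congr pair => //; apply/permP => i; have := e (lift ord0 i).
  by rewrite /h !lift_perm_lift /= ek => /lift_inj.
by rewrite card_prod !card_Sn card_ord factS.
Qed.

(** Multilinearity holds term by term, since each row goes to exactly one of the two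
    factors; for the alternating property, composing with the transposition of two equal
    rows pairs each term with its opposite. *)
Lemma wedge_is_form n p q (a : pform R n p) (b : pform R n q) :
  is_form a -> is_form b -> is_form (wedge a b).
Proof.
move=> fa fb; split=> [A B C i0 x y eA eB eC|A i1 i2 i12 e12].
  have dist1 (e u w z : R) :
    e * (x * u + y * w) * z = x * (e * u * z) + y * (e * w * z) by ring.
  have dist2 (e u w z : R) :
    e * z * (x * u + y * w) = x * (e * z * u) + y * (e * z * w) by ring.
  rewrite /wedge [x * _]mulrCA [y * _]mulrCA -mulrDr; congr (_ * _).
  rewrite !mulr_sumr -big_split; apply: eq_bigr => s _ /=.
  have si0 : s ((s^-1)%g i0) = i0 by rewrite permKV.
  move: eB eC => /row'_eqP eB /row'_eqP eC.
  have rs (k : 'I_(p + q)) (D : 'M[R]_(p + q, n)) :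
    row k (row_perm s D) = row (s k) D by apply/rowP => j; rewrite !mxE.
  have rs' (k : 'I_(p + q)) (D : 'M[R]_(p + q, n)) j :
    (row_perm s D) k j = D (s k) j by rewrite !mxE.
  have ne (k : 'I_(p + q)) : k != (s^-1)%g i0 -> s k != i0.
    by apply: contra => /eqP <-; rewrite permK.
  have [k ek|k ek] := split_ordP ((s^-1)%g i0).
    have eb (D : 'M[R]_(p + q, n)) : (forall i j, i != i0 -> D i j = A i j) ->
        dsubmx (row_perm s D) = dsubmx (row_perm s A).
      move=> eD; apply/matrixP => i j; rewrite !mxE; apply: eD.
      by apply: ne; rewrite ek -val_eqE /= gtn_eqF// ltn_addr.
    rewrite (eb B) // (eb C) //.
    suff -> : a (usubmx (row_perm s A)) = x * a (usubmx (row_perm s B)) +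
        y * a (usubmx (row_perm s C)).
      exact: dist1.
    apply: (form_multilinear fa (i0 := k)).
    - by rewrite !row_usubmx !rs -ek si0 eA.
    - by apply/row'_eqP => i j ik; rewrite !mxE; apply: eB;
        apply: ne; rewrite ek (inj_eq (@lshift_inj _ _)).
    - by apply/row'_eqP => i j ik; rewrite !mxE; apply: eC;
        apply: ne; rewrite ek (inj_eq (@lshift_inj _ _)).
  have ea (D : 'M[R]_(p + q, n)) : (forall i j, i != i0 -> D i j = A i j) ->
      usubmx (row_perm s D) = usubmx (row_perm s A).
    move=> eD; apply/matrixP => i j; rewrite !mxE; apply: eD.
    by apply: ne; rewrite ek -val_eqE /= ltn_eqF// ltn_addr.
  rewrite (ea B) // (ea C) //.
  suff -> : b (dsubmx (row_perm s A)) = x * b (dsubmx (row_perm s B)) +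
      y * b (dsubmx (row_perm s C)).
    exact: dist2.
  apply: (form_multilinear fb (i0 := k)).
  - by rewrite !row_dsubmx !rs -ek si0 eA.
  - by apply/row'_eqP => i j ik; rewrite !mxE; apply: eB;
      apply: ne; rewrite ek (inj_eq (@rshift_inj _ _)).
  - by apply/row'_eqP => i j ik; rewrite !mxE; apply: eC;
      apply: ne; rewrite ek (inj_eq (@rshift_inj _ _)).
rewrite /wedge; set S := \sum_s _; suff -> : S = 0 by rewrite mulr0.
have SN : S = - S.
  rewrite {1}/S (reindex_inj (mulIg (tperm i1 i2))) -sumrN.
  apply: eq_bigr => s _; rewrite -!mulNr; congr (_ * a _ * b _).
  - by rewrite odd_permM odd_tperm i12 signr_addb expr1 mulrN1.
  - congr usubmx; apply/matrixP => i j; rewrite !mxE permM.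
    by case: tpermP => // ->; rewrite e12.
  - congr dsubmx; apply/matrixP => i j; rewrite !mxE permM.
    by case: tpermP => // ->; rewrite e12.
have : S *+ 2 == 0 by rewrite mulr2n {1}SN addNr.
by rewrite mulrn_eq0 => /eqP.
Qed.

(** Among the [q.+1]! terms of the wedge product, the [q]! permutations sending the first
    index to [k] contribute equally, because [b] is alternating; this cancels the
    normalisation. *)
Lemma wedge1l n q (a : pform R n 1) (b : pform R n q) v : is_form b ->
  wedge a b v = \sum_(k < q.+1) (-1) ^+ k * a (row k v) * b (row' k v).
Proof.
move=> fb; rewrite /wedge (sum_perm_lift (n := q)) mulr_sumr.
apply: eq_bigr => k _.
rewrite (eq_bigr (fun=> (-1) ^+ k * a (row k v) * b (row' k v))) => [|s _].
  rewrite sumr_const card_Sn -[X in _ * X]mulr_natl (mul1n q`! : (1`! * q`!)%N = _).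
  rewrite !mulrA mulVf ?mul1r//.
rewrite odd_lift_perm /= signr_addb.
have -> : usubmx (row_perm (lift_perm ord0 k s) v : 'M[R]_(1 + q, n)) = row k v.
  apply/matrixP => i j; rewrite !mxE (_ : lshift q i = ord0) ?lift_perm_id//.
  by apply: val_inj; rewrite /= ord1.
have -> : dsubmx (row_perm (lift_perm ord0 k s) v : 'M[R]_(1 + q, n))
    = row_perm s (row' k v).
  apply/matrixP => i j; rewrite !mxE (_ : rshift 1 i = lift ord0 i).
    by rewrite lift_perm_lift.
  exact: val_inj.
rewrite form_perm// signr_odd.
have simp (x e u w : R) : e * e = 1 -> x * e * u * (e * w) = x * u * w.
  by move=> ee; rewrite -[in RHS](mul1r x) -ee; ring.
by rewrite simp// -expr2 sqrr_sign.
Qed.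

End TopForms.

(** * Wedge products on explicit vectors *)

Section Vectors.
Variables (R : realType) (n : nat).
Implicit Types (X Y Z U V W : 'rV[R]_n).

(** The number of rows is the length of the list, so that it computes to a numeral on
    explicit lists and no cast is needed to evaluate a form. *)
Definition vecs (s : seq 'rV[R]_n) : 'M[R]_(size s, n) :=
  \matrix_(i, j) s`_i 0 j.

Lemma col_mx_vecs X Y : col_mx X Y = vecs [:: X; Y].
Proof.
apply/matrixP => i j; rewrite (@col_mx1E _ _ 1) mxE.
by case: unliftP => [k|] -> //=; rewrite ord1.
Qed.

End Vectors.

Ltac vecs_eq :=
  apply/matrixP; case=> [[|[|[|[|[|?]]]]] ?] ?; rewrite !mxE //=;
  by rewrite ord1.

Section WedgeVectors.
Variables (R : realType) (n : nat).
Implicit Types (X Y Z U V W : 'rV[R]_n).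

Lemma form2_anti (a : pform R n 2) X Y : is_form a ->
  a (vecs [:: X; Y]) = - a (vecs [:: Y; X]).
Proof.
move=> fa; rewrite -(form_swap fa _ (i1 := ord0) (i2 := ord_max))//; congr a.
apply/matrixP => i j; rewrite !mxE.
case: tpermP => [->|->|] //; case: i => [[|[|//]] h] i0 i1.
- by case: i0; apply: val_inj.
- by case: i1; apply: val_inj.
Qed.

Lemma form2_diag (a : pform R n 2) X : is_form a -> a (vecs [:: X; X]) = 0.
Proof.
move=> fa; apply: (form_alternating fa (i1 := ord0) (i2 := ord_max)) => // j.
by rewrite !mxE.
Qed.

Lemma wedge11 (a b : pform R n 1) X Y : is_form b ->
  wedge a b (vecs [:: X; Y]) = a X * b Y - a Y * b X.
Proof.
move=> fb; rewrite wedge1l// !big_ord_recl big_ord0 addr0/=.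
rewrite expr0 expr1 mul1r mulN1r mulNr; congr (a _ * b _ - a _ * b _); vecs_eq.
Qed.

Lemma wedge12 (a : pform R n 1) (b : pform R n 2) X Y Z : is_form b ->
  wedge a b (vecs [:: X; Y; Z]) =
  a X * b (vecs [:: Y; Z]) - a Y * b (vecs [:: X; Z]) + a Z * b (vecs [:: X; Y]).
Proof.
move=> fb; rewrite wedge1l// !big_ord_recl big_ord0 addr0/=.
rewrite expr0 expr1 mul1r mulN1r mulNr addrA -signr_odd expr0 mul1r.
by congr (a _ * b _ - a _ * b _ + a _ * b _); vecs_eq.
Qed.

Lemma wedge14 (a : pform R n 1) (b : pform R n 4) X Y Z U V : is_form b ->
  wedge a b (vecs [:: X; Y; Z; U; V]) =
  a X * b (vecs [:: Y; Z; U; V]) - a Y * b (vecs [:: X; Z; U; V])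
  + a Z * b (vecs [:: X; Y; U; V]) - a U * b (vecs [:: X; Y; Z; V])
  + a V * b (vecs [:: X; Y; Z; U]).
Proof.
move=> fb; rewrite wedge1l// !big_ord_recl big_ord0 addr0/=.
rewrite expr0 expr1 mul1r mulN1r mulNr !addrA -signr_odd expr0 mul1r.
rewrite -[(-1) ^+ _]signr_odd expr1 mulN1r mulNr.
rewrite -[(-1) ^+ _]signr_odd expr0 mul1r.
by congr (a _ * b _ - a _ * b _ + a _ * b _ - a _ * b _ + a _ * b _); vecs_eq.
Qed.

Lemma wedge22 (a b : pform R n 2) X Y Z U : is_form a -> is_form b ->
  wedge a b (vecs [:: X; Y; Z; U]) =
    a (vecs [:: X; Y]) * b (vecs [:: Z; U])
  - a (vecs [:: X; Z]) * b (vecs [:: Y; U])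
  + a (vecs [:: X; U]) * b (vecs [:: Y; Z])
  + a (vecs [:: Y; Z]) * b (vecs [:: X; U])
  - a (vecs [:: Y; U]) * b (vecs [:: X; Z])
  + a (vecs [:: Z; U]) * b (vecs [:: X; Y]).
Proof.
move=> fa fb.
pose A i j := a (vecs [:: [:: X; Y; Z; U]`_i; [:: X; Y; Z; U]`_j]).
pose B i j := b (vecs [:: [:: X; Y; Z; U]`_i; [:: X; Y; Z; U]`_j]).
pose i1 : 'I_4 := lift ord0 ord0.
pose i2 : 'I_4 := lift ord0 (lift ord0 ord0).
pose i3 : 'I_4 := lift ord0 (lift ord0 (lift ord0 ord0)).
have -> : wedge a b (vecs [:: X; Y; Z; U]) = 4^-1 *
    \sum_(s : 'S_4) (-1) ^+ s * (A (s ord0) (s i1) * B (s i2) (s i3)).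
  congr (_ * _); apply: eq_bigr => s _; rewrite -mulrA.
  have sE (k k' : 'I_4) : val k = val k' -> s k = s k' by move=> /val_inj ->.
  congr (_ * (a _ * b _)).
    apply/matrixP => -[[|[|//]] h] j; rewrite !mxE /=;
    by congr (([:: X; Y; Z; U]`_(s _)) 0 j); apply: val_inj.
  apply/matrixP => -[[|[|//]] h] j; rewrite !mxE /=;
  by congr (([:: X; Y; Z; U]`_(s _)) 0 j); apply: val_inj.
(* Iterating the splitting lists the 24 permutations with their signs. *)
have sum1 (F : 'S_0 -> R) : \sum_s F s = F 1%g.
  rewrite (big_pred1 1%g)// => s; apply/esym/eqP/permP => -[//].
rewrite !(sum_perm_lift, big_ord_recl, big_ord0, sum1) /i1 /i2 /i3.
rewrite !(lift_perm_lift, lift_perm_id, odd_lift_perm, odd_perm1) /=.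
have antiA i j : A j i = - A i j by rewrite /A form2_anti.
have antiB i j : B j i = - B i j by rewrite /B form2_anti.
rewrite !(antiA 0 1)%N !(antiA 0 2)%N !(antiA 0 3)%N.
rewrite !(antiA 1 2)%N !(antiA 1 3)%N !(antiA 2 3)%N.
rewrite !(antiB 0 1)%N !(antiB 0 2)%N !(antiB 0 3)%N.
rewrite !(antiB 1 2)%N !(antiB 1 3)%N !(antiB 2 3)%N.
rewrite -/(A 0 1)%N -/(A 0 2)%N -/(A 0 3)%N -/(A 1 2)%N -/(A 1 3)%N -/(A 2 3)%N.
rewrite -/(B 0 1)%N -/(B 0 2)%N -/(B 0 3)%N -/(B 1 2)%N -/(B 1 3)%N -/(B 2 3)%N.
move: (A 0 1)%N (A 0 2)%N (A 0 3)%N (A 1 2)%N (A 1 3)%N (A 2 3)%N.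
move: (B 0 1)%N (B 0 2)%N (B 0 3)%N (B 1 2)%N (B 1 3)%N (B 2 3)%N.
clear => b1 b2 b3 b4 b5 b6 a1 a2 a3 a4 a5 a6.
by field.
Qed.

(** The cyclic permutation exchanging the factors moves one index past four, so it is
    even. *)
Lemma wedge41C (a : pform R n 4) (b : pform R n 1) (v : 'M[R]_(5, n)) :
  wedge a b (v : 'M[R]_(4 + 1, n)) = wedge b a (v : 'M[R]_(1 + 4, n)).
Proof.
rewrite /wedge (mulnC 1`!); congr (_ * _).
pose c : 'S_5 := lift_perm ord_max ord0 1%g.
rewrite (reindex_inj (mulgI c)); apply: eq_bigr => s _.
rewrite odd_permM odd_lift_perm odd_perm1 /= mulrAC.
congr (_ * b _ * a _).
  apply/matrixP => i j; rewrite !mxE permM (_ : rshift 4 i = ord_max).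
    by rewrite lift_perm_id; congr (v (s _) _); apply: val_inj; rewrite /= ord1.
  by apply: val_inj; rewrite /= ord1.
apply/matrixP => i j; rewrite !mxE permM (_ : lshift 1 i = lift ord_max i).
  rewrite lift_perm_lift perm1; congr (v (s _) _); exact: val_inj.
by apply: val_inj; rewrite [RHS]lift_max.
Qed.

End WedgeVectors.

(** * Metrics and duality in an orthonormal coframe *)

Section MetricFrame.
Variables (R : realType) (n : nat).
Implicit Types (E : 'M[R]_n).

(** The rows of [dual_frame E] are the vectors dual to the coframe whose
    covectors are the rows of [E]. *)
Definition dual_frame E : 'M[R]_n := (invmx E)^T.

Lemma mul_frame E : E \in unitmx -> dual_frame E *m E^T = 1%:M.
Proof. by move=> uE; rewrite -trmx_mul mulmxV// trmx1. Qed.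

Lemma mulT_frame E : E \in unitmx -> (dual_frame E)^T *m E = 1%:M.
Proof. by move=> uE; rewrite trmxK mulVmx. Qed.

(** The inverse metric is the sum of the squares of the frame vectors. *)
Lemma invmx_gram E : E \in unitmx ->
  invmx (E^T *m E) = (dual_frame E)^T *m dual_frame E.
Proof.
move=> uE; have uG : E^T *m E \in unitmx by rewrite unitmx_mul unitmx_tr uE.
rewrite -[RHS](mulKmx uG) -[X in invmx _ *m X]mulmxA [E *m _]mulmxA.
rewrite [E *m _](_ : _ = 1%:M); last by rewrite trmxK mulmxV.
by rewrite mul1mx -trmx_mul mulVmx// trmx1 mulmx1.
Qed.

Lemma det_dual_frame E : \det (dual_frame E) = (\det E)^-1.
Proof. by rewrite det_tr det_inv. Qed.

(** In terms of the frame the coframe [E] is orthonormal: the inverse metric is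
    [B^T *m B] with [B] the dual frame, so its products absorb the coefficients that
    express [a] and [b] on frame vectors. *)
Lemma form_dot_frame p E (a b : pform R n p) :
  E \in unitmx -> is_form a -> is_form b ->
  form_dot (E^T *m E) a b = p`!%:R^-1 * \sum_(K : {ffun 'I_p -> 'I_n})
    a (rowsub K (dual_frame E)) * b (rowsub K (dual_frame E)).
Proof.
move=> uE fa fb; rewrite /form_dot; congr (_ * _).
set B := dual_frame E.
have expand c K : is_form c -> c (rowsub K B) =
    \sum_(I : {ffun 'I_p -> 'I_n}) (\prod_k B (K k) (I k)) * c (basis_vectors R I).
  move=> fc; rewrite -[rowsub K B]mulmx1 form_mulmx//; apply: eq_bigr => I _.
  by congr (_ * _); apply: eq_bigr => k _; rewrite mxE.
under [RHS]eq_bigr => K _ do rewrite (expand a)// (expand b)// big_distrl /=.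
rewrite [RHS]exchange_big; apply: eq_bigr => I _ /=.
under [RHS]eq_bigr => K _ do rewrite big_distrr /=.
rewrite [RHS]exchange_big; apply: eq_bigr => J _ /=.
rewrite invmx_gram// -/B.
transitivity ((\sum_(K : {ffun 'I_p -> 'I_n}) \prod_k (B (K k) (I k) * B (K k) (J k)))
    * a (basis_vectors R I) * b (basis_vectors R J)).
  rewrite -(bigA_distr_bigA (fun k c => B c (I k) * B c (J k))).
  congr (_ * _ * _); apply: eq_bigr => k _; rewrite mxE.
  by apply: eq_bigr => c _; rewrite mxE.
rewrite !mulr_suml; apply: eq_bigr => K _; rewrite big_split /=.
by rewrite -!mulrA; congr (_ * _); rewrite mulrCA.
Qed.

Lemma big_ffun1 (I : finType) (F : {ffun 'I_1 -> I} -> R) :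
  \sum_K F K = \sum_c F [ffun=> c].
Proof.
rewrite (reindex (fun c => [ffun=> c])) //; exists (fun K : {ffun 'I_1 -> I} => K ord0) => [c _|K _].
  by rewrite ffunE.
by apply/ffunP => i; rewrite ffunE (ord1 i).
Qed.

Lemma big_ffun2 (I : finType) (F : {ffun 'I_2 -> I} -> R) :
  \sum_K F K = \sum_c \sum_d F [ffun i => if i == ord0 then c else d].
Proof.
rewrite pair_bigA (reindex (fun cd : I * I => [ffun i => if i == ord0 then cd.1 else cd.2])) //=.
exists (fun K : {ffun 'I_2 -> I} => (K ord0, K ord_max)) => [[c d] _|K _]; first by rewrite !ffunE.
apply/ffunP => i; rewrite ffunE; case: eqVneq => [->//|].
by case: i => [[|[|//]] h] //= _; congr (K _); apply: val_inj.
Qed.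

Lemma form_dot1 E (a b : pform R n 1) : E \in unitmx -> is_form a -> is_form b ->
  form_dot (E^T *m E) a b =
  \sum_c a (row c (dual_frame E)) * b (row c (dual_frame E)).
Proof.
move=> uE fa fb; rewrite form_dot_frame// invr1 mul1r big_ffun1.
by apply: eq_bigr => c _; congr (a _ * b _); apply/rowP => j; rewrite !mxE ffunE.
Qed.

Lemma form_dot2 E (a b : pform R n 2) : E \in unitmx -> is_form a -> is_form b ->
  form_dot (E^T *m E) a b = 2^-1 * \sum_c \sum_d
    a (vecs [:: row c (dual_frame E); row d (dual_frame E)]) *
    b (vecs [:: row c (dual_frame E); row d (dual_frame E)]).
Proof.
move=> uE fa fb; rewrite form_dot_frame// big_ffun2; congr (_ * _).
apply: eq_bigr => c _; apply: eq_bigr => d _.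
by congr (a _ * b _); apply/matrixP => -[[|[|//]] h] j; rewrite !mxE ffunE.
Qed.

(** A top degree form has the same value on the [n]! orderings of the frame up to the
    sign, and so does the volume form, which is 1 on the frame. *)
Lemma form_dot_top E (b : pform R n n) : E \in unitmx -> is_form b ->
  form_dot (E^T *m E) b (fun v => \det E * \det v) = b (dual_frame E).
Proof.
move=> uE fb; rewrite form_dot_frame//; last exact: is_form_det.
rewrite sum_ffun_perm; last first.
  move=> I i j ij eij; rewrite (form_alternating fb ij) ?mul0r// => k.
  by rewrite !mxE eij.
rewrite (eq_bigr (fun=> b (dual_frame E))) => [|s _].
  rewrite sumr_const card_Sn -[X in _ * X]mulr_natl mulrA mulVf ?mul1r//.
have fd := is_form_det n (\det E).
rewrite rowsub_perm form_perm// (form_perm fd) det_dual_frame.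
rewrite mulfV -?unitfE -?unitmxE// mulr1 mulrAC -expr2 sqrr_sign mul1r//.
Qed.

End MetricFrame.

Section Star.
Variables (R : realType).
Implicit Types (E : 'M[R]_5).

Lemma form1_sum n m (a : pform R n 1) (c : 'I_m -> R) (x : 'I_m -> 'rV[R]_n) :
  is_form a -> a (\sum_j c j *: x j) = \sum_j c j * a (x j).
Proof.
move=> fa; apply: (form_row_sum fa (i0 := ord0)).
  by apply/rowP => k; rewrite mxE !summxE; apply: eq_bigr => j _; rewrite !mxE.
by move=> j; apply/matrixP => -[].
Qed.

Lemma star_top E (b : pform R 5 5) w : E \in unitmx -> is_form b ->
  @star R 5 5 0 (E^T *m E) (fun v => \det E * \det v) b w = b (dual_frame E).
Proof.
move=> uE fb; rewrite -form_dot_top//; congr (_ * _).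
apply: eq_bigr => I _; apply: eq_bigr => J _; congr (_ * (_ * \det _)).
apply/matrixP => i j; have ei : i = lshift 0 i by exact: ord_inj.
by rewrite [in LHS]ei (@col_mxEu _ 5).
Qed.

(** The contraction of the volume form with the metric dual vector of [a].  It is the
    scalar product of [a] with the one-form [x |-> vol (x, w)]. *)
Lemma star_one E (a : pform R 5 1) w : E \in unitmx -> is_form a ->
  @star R 5 1 4 (E^T *m E) (fun v => \det E * \det v) a w =
  \det E * \det (col_mx (\sum_c a (row c (dual_frame E)) *: row c (dual_frame E)) w
                 : 'M[R]_(1 + 4)).
Proof.
move=> uE fa.
pose b : pform R 5 1 := fun x => \det E * \det (col_mx x w : 'M[R]_(1 + 4)).
have fb : is_form b.
  split=> [A B C i0 x y eA _ _|A i1 i2]; last by rewrite !ord1 eqxx.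
  rewrite /b (@determinant_multilinear _ 5 (col_mx A w) (col_mx B w) (col_mx C w)
    ord0 x y); first by ring.
  - move/rowP: eA => eA; apply/rowP => j.
    rewrite mxE [RHS]mxE ![(_ *: row _ _) 0 j]mxE ![row _ _ 0 j]mxE.
    rewrite !(@col_mx1E _ _ 4) unlift_none; have := eA j; rewrite !mxE ord1.
    exact.
  - apply/row'_eqP => i j i_neq0; rewrite !(@col_mx1E _ _ 4).
    by case: unliftP i_neq0 => [//|->]; rewrite eqxx.
  - apply/row'_eqP => i j i_neq0; rewrite !(@col_mx1E _ _ 4).
    by case: unliftP i_neq0 => [//|->]; rewrite eqxx.
rewrite -[RHS]/(b _) form1_sum// -form_dot1//.
Qed.

End Star.

(** * Derivatives of polynomial, determinant and inverse expressions *)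

Section Calculus.
Local Open Scope classical_set_scope.
Variables (R : realType).

Section Line.
Variables (V : normedModType R).
Implicit Types (f g : V -> R) (z v w : V).

(** Directional derivatives are derivatives along a line, which gives access to the
    one-variable theory. *)
Lemma is_derive_line f z v d :
  is_derive z v f d <-> is_derive (0 : R) (1 : R) (fun h => f (h *: v + z)) d.
Proof.
have e : (fun h : R => h^-1 *: (f (h *: v + z) - f z)) =
    (fun h : R => h^-1 *: (f ((h * 1 + 0) *: v + z) - f (0 *: v + z))).
  by apply/funext => h; rewrite addr0 scale0r add0r mulr1.
split=> -[df <-]; split.
- exact: (derivable1P f z v).1.
- by rewrite /derive /= e.
- exact: (derivable1P f z v).2.
- by rewrite /derive /= e.
Qed.

Lemma is_derive_comp_line (h : R -> R) f z v a d :
  is_derive (f z) 1 h a -> is_derive z v f d -> is_derive z v (h \o f) (a * d).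
Proof.
move=> dh /is_derive_line df; apply/is_derive_line.
apply: (@is_derive1_comp _ h (fun s => f (s *: v + z))) => //.
by rewrite scale0r add0r.
Qed.

Lemma is_derive_translate f z v w d :
  is_derive (z + w) v f d -> is_derive z v (fun x => f (x + w)) d.
Proof.
move=> /is_derive_line df; apply/is_derive_line.
by apply: is_derive_eq; first by under eq_fun => h do rewrite -addrA; exact: df.
Qed.

Lemma is_derive_mul f g z v df dg :
  is_derive z v f df -> is_derive z v g dg ->
  is_derive z v (fun x => f x * g x) (df * g z + f z * dg).
Proof.
move=> Hf Hg; refine (is_derive_eq (is_deriveM Hf Hg) _).
by rewrite /GRing.scale /=; ring.
Qed.

Lemma is_derive_add f g z v df dg :
  is_derive z v f df -> is_derive z v g dg ->
  is_derive z v (fun x => f x + g x) (df + dg).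
Proof. by move=> Hf Hg; exact: is_deriveD. Qed.

Lemma is_derive_opp f z v df :
  is_derive z v f df -> is_derive z v (fun x => - f x) (- df).
Proof. by move=> Hf; exact: is_deriveN. Qed.

Lemma is_derive_bigsum (I : Type) (r : seq I) (P : pred I) (F : I -> V -> R)
    (dF : I -> R) z v :
  (forall i, P i -> is_derive z v (F i) (dF i)) ->
  is_derive z v (fun x => \sum_(i <- r | P i) F i x) (\sum_(i <- r | P i) dF i).
Proof.
move=> H; elim: r => [|i r IH].
  by rewrite big_nil; under eq_fun do rewrite big_nil; exact: is_derive_cst.
rewrite big_cons; under eq_fun do rewrite big_cons.
by case: ifP => // /H Hi; exact: is_derive_add.
Qed.

Lemma is_derive_bigprod (I : eqType) (r : seq I) (F : I -> V -> R)
    (dF : I -> R) z v : uniq r ->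
  (forall i, is_derive z v (F i) (dF i)) ->
  is_derive z v (fun x => \prod_(i <- r) F i x)
    (\sum_(i <- r) dF i * \prod_(j <- r | i != j) F j z).
Proof.
move=> + H; elim: r => [|i r IH] /=.
  by rewrite big_nil; under eq_fun do rewrite big_nil; move=> _; exact: is_derive_cst.
case/andP=> ir /IH {}IH; under eq_fun do rewrite big_cons.
refine (is_derive_eq (is_derive_mul (H i) IH) _).
rewrite big_cons; congr (_ + _).
  rewrite big_cons eqxx /=; congr (_ * _); rewrite big_seq_cond [RHS]big_seq_cond.
  apply: eq_bigl => j; case: (boolP (j \in r)) => //= jr.
  by apply/esym; apply: contraNneq ir => ->.
rewrite mulr_sumr; apply: eq_big_seq => j jr.
rewrite big_cons (_ : j != i); first by rewrite mulrCA.
by apply: contraNneq ir => <-.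
Qed.

(** Jacobi's formula: the Leibniz terms of the derivative are grouped by the image of
    the differentiated row. *)
Lemma is_derive_det n (M : V -> 'M[R]_n) (dM : 'M[R]_n) z v :
  (forall i j, is_derive z v (fun x => M x i j) (dM i j)) ->
  is_derive z v (fun x => \det (M x)) (\sum_i \sum_j dM i j * cofactor (M z) i j).
Proof.
move=> H; apply: is_derive_eq.
  apply: is_derive_bigsum => s _.
  refine (is_derive_mul (is_derive_cst ((-1) ^+ s : R) z v) _).
  refine (is_derive_bigprod _ (fun i => H i (s i))).
  exact: index_enum_uniq.
rewrite /=; under eq_bigr do rewrite mul0r add0r mulr_sumr.
rewrite exchange_big /=; apply: eq_bigr => i _.
under [RHS]eq_bigr do rewrite expand_cofactor mulr_sumr.
rewrite (partition_big (fun s : 'S_n => s i) predT) //=.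
apply: eq_bigr => j _; apply: eq_bigr => s /eqP <-.
by rewrite mulrCA.
Qed.

Lemma is_derive_locally (f g : V -> R) (U : set V) z v d : open U -> U z ->
  (forall x, U x -> f x = g x) -> is_derive z v f d -> is_derive z v g d.
Proof.
move=> oU Uz fg; apply: near_eq_is_derive.
by apply: filterS (open_nbhs_nbhs (conj oU Uz)).
Qed.

(** By Cramer's rule.  Invertibility is needed on a neighbourhood because the inverse is
    given by the adjugate only there. *)
Lemma derivable_invmx n (M : V -> 'M[R]_n) (U : set V) z v :
  open U -> U z -> (forall x, U x -> M x \in unitmx) ->
  (forall i j, derivable (fun x => M x i j) z v) ->
  forall k l, derivable (fun x => invmx (M x) k l) z v.
Proof.
move=> oU Uz uM dM k l.
have ex_der f : derivable f z v -> is_derive z v f ('D_v f z).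
  by move=> ?; apply: DeriveDef.
pose N x := (\det (M x))^-1 * ((-1) ^+ (l + k) * \det (row' l (col' k (M x)))).
have detM : is_derive z v (fun x => \det (M x))
    (\sum_i \sum_j (\matrix_(i, j) 'D_v (fun x => M x i j) z) i j *
      cofactor (M z) i j).
  by apply: is_derive_det => i j; rewrite mxE; apply: ex_der.
have : is_derive z v (fun x => invmx (M x) k l) ('D_v N z).
  apply: (@is_derive_locally N _ U) => //.
    by move=> x Ux; rewrite /invmx uM// /adjugate !mxE.
  apply (ex_der); have z0 : \det (M z) != 0 by rewrite -unitfE -unitmxE uM.
  have dV : derivable (fun x => (\det (M x))^-1) z v.
    by apply: (@derivableV _ _ (fun x => \det (M x))) => //; case: detM.
  have dC : is_derive z v (fun x => \det (row' l (col' k (M x))))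
      (\sum_i \sum_j (\matrix_(i, j)
        'D_v (fun x => M x (lift l i) (lift k j)) z) i j *
        cofactor (row' l (col' k (M z))) i j).
    apply: is_derive_det => i j; rewrite mxE.
    by under eq_fun => x do rewrite !mxE; apply: ex_der.
  have := is_derive_mul (ex_der _ dV)
    (is_derive_mul (is_derive_cst ((-1) ^+ (l + k) : R) z v) dC).
  by case.
by case.
Qed.

(** Differentiating [M *m invmx M = 1]. *)
Lemma is_derive_invmx n (M : V -> 'M[R]_n) (dM : 'M[R]_n) (U : set V) z v :
  open U -> U z -> (forall x, U x -> M x \in unitmx) ->
  (forall i j, is_derive z v (fun x => M x i j) (dM i j)) ->
  forall k l, is_derive z v (fun x => invmx (M x) k l)
    (- (invmx (M z) *m dM *m invmx (M z)) k l).
Proof.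
move=> oU Uz uM HM k l.
have dI := derivable_invmx oU Uz uM (fun i j => @ex_derive _ _ _ _ _ _ _ (HM i j)).
pose dN := \matrix_(i, j) 'D_v (fun x => invmx (M x) i j) z.
have HN i j : is_derive z v (fun x => invmx (M x) i j) (dN i j).
  by rewrite mxE; apply: DeriveDef.
suff -> : - (invmx (M z) *m dM *m invmx (M z)) k l = dN k l by [].
have : dM *m invmx (M z) + M z *m dN = 0.
  apply/matrixP => i j; rewrite !mxE -big_split /=.
  have H : is_derive z v (fun x => \sum_h M x i h * invmx (M x) h j)
      (\sum_h (dM i h * invmx (M z) h j + M z i h * dN h j)).
    by apply: is_derive_bigsum => h _; apply: is_derive_mul.
  have H0 : is_derive z v (fun x => \sum_h M x i h * invmx (M x) h j) 0.
    apply: (@is_derive_locally (cst ((1%:M : 'M[R]_n) i j)) _ U) => //.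
      by move=> x Ux; rewrite -[1%:M](mulmxV (uM x Ux)) mxE.
  by have [_ <-] := H; have [_ ->] := H0.
move=> /eqP; rewrite addrC addr_eq0 => /eqP /(congr1 (mulmx (invmx (M z)))).
by rewrite mulKmx ?uM// => ->; rewrite mulmxN [in RHS]mxE mulmxA.
Qed.

End Line.

End Calculus.

(** * Functions of class C2 *)

Section C2.
Local Open Scope classical_set_scope.
Variables (R : realType) (n : nat).
Implicit Types (U : set 'rV[R]_n) (f g h : 'rV[R]_n -> R) (y z : 'rV[R]_n).

Local Notation e_ i := (delta_mx (0 : 'I_1) (i : 'I_n) : 'rV[R]_n).

Definition C1_on U f := forall z, U z -> forall i, derivable f z (e_ i).

(** What the frame calculus uses of regularity: two partial derivatives, and symmetry of
    the mixed ones, which is what makes the Christoffel symbols symmetric and [d] square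
    to zero.  Unlike continuity of all derivatives, it passes to products and inverse
    square roots by checking two formulas. *)
Record C2_on U f : Prop := C2On {
  C2_C1 : C1_on U f;
  C2_partial : forall i, C1_on U (partial i f);
  C2_sym : forall z, U z -> forall i j,
    partial j (partial i f) z = partial i (partial j f) z }.

Lemma is_partial U f z i : C1_on U f -> U z -> is_derive z (e_ i) f (partial i f z).
Proof. by move=> Df Uz; apply: DeriveDef => //; apply: Df. Qed.

Lemma partialE f z i d : is_derive z (e_ i) f d -> partial i f z = d.
Proof. by case. Qed.

Lemma partial_locally U f g z i : open U -> U z -> (forall x, U x -> f x = g x) ->
  partial i f z = partial i g z.
Proof.
move=> oU Uz fg; apply: near_eq_derive.
by apply: filterS (open_nbhs_nbhs (conj oU Uz)).
Qed.

#[local] Opaque partial.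

(** It suffices to name the derivatives: on an open set the partial derivatives are then
    locally equal to the proposed ones. *)
Lemma C2_intro U f (df : 'I_n -> 'rV[R]_n -> R) (ddf : 'I_n -> 'I_n -> 'rV[R]_n -> R) :
  open U ->
  (forall z i, U z -> is_derive z (e_ i) f (df i z)) ->
  (forall z i j, U z -> is_derive z (e_ j) (df i) (ddf i j z)) ->
  (forall z i j, U z -> ddf i j z = ddf j i z) -> C2_on U f.
Proof.
move=> oU Df Ddf sym.
have pf i z : U z -> df i z = partial i f z by move=> /(Df z i) /partialE.
have Dpf i j z : U z -> is_derive z (e_ j) (partial i f) (ddf i j z).
  by move=> Uz; apply: (is_derive_locally oU Uz (pf i)); apply: Ddf.
split=> [z Uz i|i z Uz j|z Uz i j].
- by case: (Df z i Uz).
- by case: (Dpf i j z Uz).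
- by rewrite (partialE (Dpf i j z Uz)) (partialE (Dpf j i z Uz)) sym.
Qed.

Lemma C2_cst U (c : R) : open U -> C2_on U (fun=> c).
Proof.
move=> oU; refine (C2_intro (df := fun _ _ => 0) (ddf := fun _ _ _ => 0) oU _ _ _) => // *.
all: by first [exact: is_derive_cst | exact: (is_derive_cst (0 : R))].
Qed.

Lemma C2_add U f g : open U -> C2_on U f -> C2_on U g -> C2_on U (fun z => f z + g z).
Proof.
move=> oU [f1 f2 fs] [g1 g2 gs].
refine (C2_intro (df := fun i z => partial i f z + partial i g z)
  (ddf := fun i j z => partial j (partial i f) z + partial j (partial i g) z)
  oU _ _ _).
- move=> z i Uz; exact: (is_derive_add (is_partial i f1 Uz) (is_partial i g1 Uz)).
- move=> z i j Uz.
  exact: (is_derive_add (is_partial j (f2 i) Uz) (is_partial j (g2 i) Uz)).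
- move=> z i j Uz.
  exact: (congr2 +%R (fs z Uz i j) (gs z Uz i j)).
Qed.

Lemma C2_mul U f g : open U -> C2_on U f -> C2_on U g -> C2_on U (fun z => f z * g z).
Proof.
move=> oU [f1 f2 fs] [g1 g2 gs].
refine (C2_intro (df := fun i z => partial i f z * g z + f z * partial i g z)
  (ddf := fun i j z =>
     (partial j (partial i f) z * g z + partial i f z * partial j g z) +
     (partial j f z * partial i g z + f z * partial j (partial i g) z)) oU _ _ _).
- move=> z i Uz; exact: (is_derive_mul (is_partial i f1 Uz) (is_partial i g1 Uz)).
- move=> z i j Uz; exact: (is_derive_add
    (is_derive_mul (is_partial j (f2 i) Uz) (is_partial j g1 Uz))
    (is_derive_mul (is_partial j f1 Uz) (is_partial j (g2 i) Uz))).
- move=> z i j Uz; cbv beta; move: (fs z Uz i j) (gs z Uz i j).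
  move: (partial j (partial i f) z) (partial i (partial j f) z).
  move: (partial j (partial i g) z) (partial i (partial j g) z).
  by move=> x x' y y' -> ->; ring.
Qed.

Lemma C2_sum U (I : Type) (r : seq I) (P : pred I) (F : I -> 'rV[R]_n -> R) :
  open U -> (forall i, C2_on U (F i)) ->
  C2_on U (fun z => \sum_(i <- r | P i) F i z).
Proof.
move=> oU CF; elim: r => [|i r IH].
  by under eq_fun do rewrite big_nil; exact: C2_cst.
by under eq_fun do rewrite big_cons; case: (P i); [exact: C2_add | exact: IH].
Qed.

(** For [r = f^(-1/2)] one has [dr = - 1/2 r^3 df], which is polynomial in [r] and can be
    differentiated again. *)
Lemma C2_rsqrt U f : open U -> (forall z, U z -> 0 < f z) -> C2_on U f ->
  C2_on U (fun z => (Num.sqrt (f z))^-1).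
Proof.
move=> oU f0 [f1 f2 fs]; set r := fun z => _.
pose dr i z := - 2^-1 * (r z * r z * r z * partial i f z).
have Hr z i : U z -> is_derive z (e_ i) r (dr i z).
  move=> Uz; have fz := f0 z Uz; have s0 : Num.sqrt (f z) != 0.
    by rewrite gt_eqF// sqrtr_gt0.
  have H1 := is_deriveV s0 (is_derive1_sqrt fz).
  have H2 := is_derive_comp_line H1 (is_partial i f1 Uz).
  refine (is_derive_eq H2 _).
  rewrite /dr /r /GRing.scale /=; field.
  by rewrite s0.
refine (C2_intro (df := dr) (ddf := fun i j z =>
  0 * (r z * r z * r z * partial i f z) + - 2^-1 *
  (((dr j z * r z + r z * dr j z) * r z + r z * r z * dr j z) * partial i f z +
   r z * r z * r z * partial j (partial i f) z)) oU Hr _ _).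
  move=> z i j Uz; have dj := Hr z j Uz.
  refine (is_derive_mul (is_derive_cst (- 2^-1 : R) z _) _).
  exact: (is_derive_mul (is_derive_mul (is_derive_mul dj dj) dj) (is_partial j (f2 i) Uz)).
move=> z i j Uz; cbv beta; move: (fs z Uz i j); rewrite /dr.
move: (partial j (partial i f) z) (partial i (partial j f) z).
by move=> x x' ->; ring.
Qed.

(** * Symmetry of mixed partial derivatives *)

Lemma mean_value_line U f z i (s : R) : 0 < s ->
  (forall a, 0 <= a <= s -> derivable f (a *: e_ i + z) (e_ i)) ->
  exists2 c, 0 < c < s & f (s *: e_ i + z) - f z = partial i f (c *: e_ i + z) * s.
Proof.
move=> s0 Df; pose F (a : R) := f (a *: e_ i + z).
have DF a : 0 <= a <= s -> is_derive a 1 F (partial i f (a *: e_ i + z)).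
  move=> /Df /derivableP D; apply/is_derive_line.
  move/is_derive_line: D; congr is_derive; apply/funext => h.
  by rewrite /F scalerDl -addrA [h *: 1]mulr1.
have [||c cs e] := @MVT R F (fun a => partial i f (a *: e_ i + z)) 0 s s0.
- by move=> x /[!in_itv] /= /andP[/ltW ? /ltW ?]; apply: DF; apply/andP.
- apply: continuous_in_subspaceT => x; rewrite inE /= in_itv /= => xs.
  apply: differentiable_continuous; apply/derivable1_diffP.
  by case: (DF x xs).
exists c; first by move: cs; rewrite in_itv.
by move: e; rewrite /F scale0r add0r subr0.
Qed.

(** The second difference on a square is a value of the mixed derivative: the mean value
    theorem is applied to the first difference in direction [j], then to its derivative. *)
Lemma mixed_mean_value f z i j (s : R) : 0 < s ->
  (forall a b, 0 <= a <= s -> 0 <= b <= s ->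
    derivable f (a *: e_ i + (b *: e_ j + z)) (e_ i) /\
    derivable (partial i f) (b *: e_ j + (a *: e_ i + z)) (e_ j)) ->
  exists c d, [/\ 0 < c < s, 0 < d < s &
    f (s *: e_ i + (s *: e_ j + z)) - f (s *: e_ j + z) - (f (s *: e_ i + z) - f z)
    = partial j (partial i f) (d *: e_ j + (c *: e_ i + z)) * s * s].
Proof.
move=> s0 Df; pose g x := f (x + s *: e_ j) - f x.
have inn0 : 0 <= (0 : R) <= s by rewrite lexx ltW.
have inns : 0 <= s <= s by rewrite lexx ltW.
have Dg a : 0 <= a <= s -> is_derive (a *: e_ i + z) (e_ i) g
    (partial i f (a *: e_ i + z + s *: e_ j) - partial i f (a *: e_ i + z)).
  move=> ha; apply: is_derive_add.
    apply: is_derive_translate; apply: DeriveDef => //.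
    by rewrite -addrA [z + _]addrC; case: (Df a s ha inns).
  apply: is_derive_opp; apply: DeriveDef => //.
  by have [] := Df a 0 ha inn0; rewrite scale0r add0r.
have [|c /andP[c0 cs] ec] := @mean_value_line setT g z i s s0.
  by move=> a /Dg [].
have hc : 0 <= c <= s by rewrite !ltW.
have [|d hd ed] := @mean_value_line setT (partial i f) (c *: e_ i + z) j s s0.
  by move=> b hb; case: (Df c b hc hb).
exists c, d; split=> //; first exact/andP.
rewrite -ed [s *: e_ j + (c *: e_ i + z)]addrC -(partialE (Dg c hc)) -ec /g.
rewrite -[s *: e_ i + z + _]addrA [z + _]addrC; ring.
Qed.

(** The second difference is symmetric in the two directions, so both mixed derivatives
    take the same value, each at some point of any small square; continuity at [z] concludes. *)
Lemma schwarz U f : open U -> smooth_on U f -> forall z, U z -> forall i j,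
  partial j (partial i f) z = partial i (partial j f) z.
Proof.
move=> oU Sf z Uz i j; apply/eqP; rewrite -subr_eq0 -normr_le0.
set A := partial j _ z; set B := partial i _ z.
apply/ler_addgt0Pl => eps eps0; rewrite addr0.
have Cij k l : \forall x \near z, `|partial l (partial k f) z - partial l (partial k f) x| < eps / 2.
  have [Cf _] := Sf [:: l; k] z Uz.
  by move/cvgrPdist_lt: Cf; apply; rewrite divr_gt0.
have nU : \forall x \near z, U x by exact: open_nbhs_nbhs.
have : \forall x \near z, [/\ U x, `|A - partial j (partial i f) x| < eps / 2 &
    `|B - partial i (partial j f) x| < eps / 2].
  refine (@filterS _ (nbhs z) _ _ _ _ (filterI nU (filterI (Cij i j) (Cij j i)))).
  move=> x [Ux [Ax Bx]]; exact: (And3 Ux Ax Bx).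
case/nbhs_ballP => del /= del0 Hdel.
pose K := `|e_ i| + `|e_ j| + 1; have K0 : 0 < K.
  by rewrite ltr_wpDl// addr_ge0.
pose s := del / K; have s0 : 0 < s by rewrite divr_gt0.
have near_z a b : 0 <= a <= s -> 0 <= b <= s -> ball z del (a *: e_ i + (b *: e_ j + z)).
  move=> /andP[a0 as_] /andP[b0 bs]; rewrite -ball_normE /= addrA opprD addrCA subrr addr0.
  rewrite normrN (le_lt_trans (ler_normD _ _))// !normrZ !ger0_norm//.
  apply: (@le_lt_trans _ _ (s * (`|e_ i| + `|e_ j|))).
    by rewrite mulrDr lerD// ler_wpM2r.
  rewrite -[ltRHS](@divfK _ K) ?gt_eqF// -/s ltr_pM2l//.
  by rewrite ltrDl.
have swap a b : b *: e_ j + (a *: e_ i + z) = a *: e_ i + (b *: e_ j + z).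
  by rewrite addrCA.
have [|c [d [/andP[/ltW c0 /ltW cs] /andP[/ltW d0 /ltW ds] e1]]] :=
  @mixed_mean_value f z i j s s0.
  move=> a b ha hb; rewrite swap.
  have [Ux _ _] := Hdel _ (near_z _ _ ha hb).
  by split; [case: (Sf [::] _ Ux) | case: (Sf [:: i] _ Ux)].
have [|c' [d' [/andP[/ltW c'0 /ltW c's] /andP[/ltW d'0 /ltW d's] e2]]] :=
  @mixed_mean_value f z j i s s0.
  move=> a b ha hb; rewrite -!swap.
  have [Ux _ _] := Hdel _ (near_z _ _ hb ha); rewrite -swap in Ux.
  by split; [case: (Sf [::] _ Ux) | case: (Sf [:: j] _ Ux)].
have key (p q u v w y : R) :
    u - v - (w - y) = p * s * s -> u - w - (v - y) = q * s * s -> p = q.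
  have ss : s * s != 0 by rewrite mulf_neq0// gt_eqF.
  move=> hp hq; have : (p - q) * (s * s) == 0.
    have -> : (p - q) * (s * s) = p * s * s - q * s * s by ring.
    by rewrite -hp -hq subr_eq0; apply/eqP; ring.
  by rewrite mulf_eq0 (negPf ss) orbF subr_eq0 => /eqP.
rewrite [s *: e_ j + (s *: _ + z)]swap in e2.
have eAB := key _ _ _ _ _ _ e1 e2.
have c_ : 0 <= c <= s by rewrite c0 cs.
have d_ : 0 <= d <= s by rewrite d0 ds.
have c'_ : 0 <= c' <= s by rewrite c'0 c's.
have d'_ : 0 <= d' <= s by rewrite d'0 d's.
have [_ hA _] := Hdel _ (near_z _ _ c_ d_).
have [_ _ hB] := Hdel _ (near_z _ _ d'_ c'_).
rewrite -swap eAB in hA.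
move: A B (partial i _ _) hA hB {Cij Hdel e1 e2 eAB} => A B X hA hB.
have -> : A - B = (A - X) - (B - X) by ring.
by rewrite (le_trans (ler_normB _ _))// [leRHS]splitr lerD// ltW.
Qed.

Lemma smooth_C2 U f : open U -> smooth_on U f -> C2_on U f.
Proof.
move=> oU Sf; split=> [z Uz i|i z Uz j|z Uz i j].
- by case: (Sf [::] z Uz).
- by case: (Sf [:: i] z Uz).
- exact: schwarz Sf _ Uz _ _.
Qed.

End C2.

(** * Algebra of a coframe and its dual frame *)

Section FrameAlgebra.
Variables (R : realType) (n : nat).
Variables (B E : 'I_n -> 'I_n -> R) (P : 'I_n -> 'I_n -> 'I_n -> R).
Hypothesis BE_row : forall a b, \sum_k B a k * E b k = (a == b)%:R.
Hypothesis BE_col : forall k l, \sum_a B a k * E a l = (k == l)%:R.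
Implicit Types (a b c d i j k l m : 'I_n).

(** Here [P a i j] plays the role of the derivative in direction [i] of the coframe entry
    [E a j], and [B] is the dual frame. *)
Definition frame_components a b c : R :=
  \sum_i \sum_j B b i * B c j * P a i j.

Definition structure_constant a b c : R :=
  frame_components a b c - frame_components a c b.

(** The Koszul formula for an orthonormal coframe: the entry [(b, d)] of the Levi-Civita
    connection form on the frame vector [c]. *)
Definition koszul c b d : R :=
  2^-1 * (structure_constant d c b - structure_constant b c d
          + structure_constant c d b).

Definition connection_matrix i b d : R := \sum_c E c i * koszul c b d.

(** The Christoffel symbols are [\sum_b B b k * cov_coframe b i j]: the coordinate
    connection is the gauge transform by [E] of the connection in the frame. *)
Definition cov_coframe b i j : R :=
  P b i j + \sum_d connection_matrix i b d * E d j.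

Let t := structure_constant.

Lemma structure_constantC a b c :
  structure_constant a c b = - structure_constant a b c.
Proof. by rewrite /structure_constant opprB. Qed.

Lemma sum_delta (x : 'I_n -> R) a : \sum_b (a == b)%:R * x b = x a.
Proof.
rewrite (bigD1 a)//= eqxx mul1r big1 ?addr0// => b /negPf.
by rewrite eq_sym => ->; rewrite mul0r.
Qed.

Lemma frame_contract a (x : 'I_n -> R) :
  \sum_k B a k * (\sum_b E b k * x b) = x a.
Proof.
under eq_bigr do rewrite mulr_sumr.
rewrite exchange_big -[RHS]sum_delta; apply: eq_bigr => b _ /=.
by rewrite -BE_row mulr_suml; apply: eq_bigr => k _; rewrite mulrA.
Qed.

Lemma coframe_contract k (x : 'I_n -> R) :
  \sum_a E a k * (\sum_l B a l * x l) = x k.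
Proof.
under eq_bigr do rewrite mulr_sumr.
rewrite exchange_big -[RHS]sum_delta; apply: eq_bigr => l _ /=.
rewrite eq_sym -BE_col mulr_suml.
by apply: eq_bigr => a _; rewrite mulrA [E _ _ * _]mulrC.
Qed.

Lemma coframe_frame_contract d (y : 'I_n -> R) :
  \sum_m E d m * (\sum_b B b m * y b) = y d.
Proof.
under eq_bigr do rewrite mulr_sumr.
rewrite exchange_big -[RHS]sum_delta; apply: eq_bigr => b _ /=.
rewrite eq_sym -BE_row mulr_suml; apply: eq_bigr => m _.
by rewrite mulrA [E _ _ * _]mulrC.
Qed.

Lemma coframe_structure a b i :
  \sum_c E c i * t a c b = \sum_l B b l * P a i l - \sum_l B b l * P a l i.
Proof.
under eq_bigr do rewrite mulrBr.
rewrite sumrB; congr (_ - _).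
  rewrite -[RHS](coframe_contract i (fun m => \sum_l B b l * P a m l)).
  apply: eq_bigr => c _; congr (_ * _); apply: eq_bigr => m _.
  by rewrite mulr_sumr; apply: eq_bigr => l _; rewrite mulrA.
rewrite -[RHS](coframe_contract i (fun m => \sum_l B b l * P a l m)).
apply: eq_bigr => c _; congr (_ * _); rewrite /frame_components exchange_big /=.
apply: eq_bigr => m _; rewrite mulr_sumr; apply: eq_bigr => l _.
by rewrite mulrCA mulrA.
Qed.

Lemma coframe2_structure b i j :
  \sum_c E c i * (\sum_d E d j * t b c d) = P b i j - P b j i.
Proof.
rewrite -[RHS](coframe_contract i (fun m => P b m j - P b j m)).
apply: eq_bigr => c _; congr (_ * _).
under eq_bigr do rewrite /t structure_constantC mulrN.
rewrite sumrN coframe_structure -sumrB -sumrN.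
by apply: eq_bigr => l _; ring.
Qed.

(** The coordinate form of the Koszul formula.  With [G = E^T *m E], the array [dG p q l]
    is the derivative of [G q l] in direction [p]; each of its three occurrences is
    expressed by structure constants and derivatives of the coframe. *)
Lemma christoffel_koszul b i j :
  let dG p q l := \sum_a (P a p q * E a l + E a q * P a p l) in
  \sum_l B b l * (dG i j l + dG j i l - dG l i j) = 2 * cov_coframe b i j.
Proof.
move=> dG.
have grad p q : \sum_l B b l * dG p q l =
    P b p q + \sum_a E a q * (\sum_l B b l * P a p l).
  rewrite /dG; under eq_bigr do rewrite big_split mulrDr /=.
  rewrite big_split /=; congr (_ + _).
    rewrite -[RHS](frame_contract b (fun a => P a p q)).
    by apply: eq_bigr => l _; congr (_ * _); apply: eq_bigr => a _; rewrite mulrC.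
  under eq_bigr do rewrite mulr_sumr.
  rewrite exchange_big; apply: eq_bigr => a _ /=; rewrite mulr_sumr.
  by apply: eq_bigr => l _; rewrite mulrCA.
have grad0 : \sum_l B b l * dG l i j =
    \sum_a (E a j * (\sum_l B b l * P a l i) + E a i * (\sum_l B b l * P a l j)).
  rewrite /dG; under eq_bigr do rewrite mulr_sumr.
  rewrite exchange_big; apply: eq_bigr => a _ /=; rewrite !mulr_sumr -big_split /=.
  by apply: eq_bigr => l _; ring.
under eq_bigr do rewrite mulrBr mulrDr.
rewrite sumrB big_split /= !grad grad0.
(* The torsion of the coordinate connection vanishes: swapping [i] and [j] in [P]
   costs the structure constant of [b]. *)
have Pji : P b j i = P b i j - \sum_c E c i * (\sum_d E d j * t b c d).
  by rewrite coframe2_structure; ring.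
have X_Y q i' : \sum_a E a q * (\sum_l B b l * P a i' l) =
    \sum_a E a q * (\sum_c E c i' * t a c b) +
    \sum_a E a q * (\sum_l B b l * P a l i').
  rewrite -big_split /=; apply: eq_bigr => a _.
  by rewrite coframe_structure; ring.
rewrite Pji /cov_coframe /connection_matrix !X_Y big_split /=.
have -> : \sum_d (\sum_c E c i * koszul c b d) * E d j =
    2^-1 * (\sum_d E d j * (\sum_c E c i * t d c b)
     - \sum_c E c i * (\sum_d E d j * t b c d)
     + \sum_c E c i * (\sum_d E d j * t c d b)).
  have flip (F : 'I_n -> 'I_n -> R) : \sum_c E c i * (\sum_d E d j * F c d) =
      \sum_d \sum_c E c i * E d j * F c d.
    rewrite exchange_big; apply: eq_bigr => c _ /=; rewrite mulr_sumr.
    by apply: eq_bigr => d _; rewrite mulrA.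
  rewrite !flip -sumrB -big_split /= mulr_sumr; apply: eq_bigr => d _.
  rewrite mulr_suml mulr_sumr -sumrB -big_split /= mulr_sumr.
  by apply: eq_bigr => c _; rewrite /koszul /t; ring.
by field.
Qed.

(** Gauge covariance of the curvature, before antisymmetrisation in [i] and [j].  The
    Christoffel symbols are [Gamma_i = B^T (P_i + A_i E)]; [dA] and [ddE] stand for the
    derivatives of the connection form [A] and of [P], while the derivative of [B] is
    determined by [P] as for the inverse of a matrix. *)
Lemma curvature_frame (dA : 'I_n -> 'I_n -> 'I_n -> 'I_n -> R)
    (ddE : 'I_n -> 'I_n -> 'I_n -> 'I_n -> R) l i j k :
  \sum_b ((- \sum_a B a l * \sum_m P a i m * B b m) * cov_coframe b j k +
    B b l * (ddE b i j k + \sum_d (dA i j b d * E d k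
                                 + connection_matrix j b d * P d i k))) +
  \sum_m (\sum_a B a l * cov_coframe a i m) * (\sum_b B b m * cov_coframe b j k) =
  \sum_a B a l * (ddE a i j k
    + \sum_d (connection_matrix j a d * P d i k + connection_matrix i a d * P d j k)
    + \sum_d (dA i j a d + \sum_b connection_matrix i a b * connection_matrix j b d)
        * E d k).
Proof.
set A := connection_matrix; set Q := cov_coframe.
pose W m := \sum_b B b m * Q b j k.
have -> : \sum_m (\sum_a B a l * Q a i m) * W m =
    \sum_a B a l * \sum_m Q a i m * W m.
  under eq_bigr do rewrite mulr_suml.
  rewrite exchange_big; apply: eq_bigr => a _ /=; rewrite mulr_sumr.
  by apply: eq_bigr => m _; rewrite mulrA.
rewrite big_split /=.
have -> : \sum_b (- \sum_a B a l * \sum_m P a i m * B b m) * Q b j k =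
    - \sum_a B a l * \sum_m P a i m * W m.
  under eq_bigr do rewrite mulNr mulr_suml.
  rewrite sumrN exchange_big; congr (- _); apply: eq_bigr => a _ /=.
  under eq_bigr do rewrite -mulrA.
  rewrite -mulr_sumr; congr (_ * _).
  under [LHS]eq_bigr do rewrite mulr_suml.
  rewrite exchange_big; apply: eq_bigr => m _ /=; rewrite /W mulr_sumr.
  by apply: eq_bigr => b _; rewrite mulrA.
have comb (x y w : R) : - x + y + w = (w - x) + y by ring.
rewrite comb -sumrB -big_split /=; apply: eq_bigr => a _.
rewrite -mulrBr -mulrDr; congr (_ * _).
have -> : \sum_m Q a i m * W m - \sum_m P a i m * W m = \sum_d A i a d * Q d j k.
  rewrite -sumrB.
  transitivity (\sum_d A i a d * \sum_m E d m * W m); last first.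
    by apply: eq_bigr => d _; rewrite /W coframe_frame_contract.
  under [RHS]eq_bigr do rewrite mulr_sumr.
  rewrite exchange_big; apply: eq_bigr => m _ /=.
  rewrite /Q /cov_coframe -/A -mulrBl addrC addKr mulr_suml.
  by apply: eq_bigr => d _; rewrite mulrA.
have -> : \sum_d A i a d * Q d j k =
    \sum_d A i a d * P d j k + \sum_d (\sum_b A i a b * A j b d) * E d k.
  rewrite /Q /cov_coframe -/A; under eq_bigr do rewrite mulrDr mulr_sumr.
  rewrite big_split /= exchange_big; congr (_ + _); apply: eq_bigr => d _ /=.
  by rewrite mulr_suml; apply: eq_bigr => b _; rewrite mulrA.
have -> : \sum_d (dA i j a d + \sum_b A i a b * A j b d) * E d k =
    \sum_d dA i j a d * E d k + \sum_d (\sum_b A i a b * A j b d) * E d k.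
  by rewrite -big_split; apply: eq_bigr => d _; rewrite mulrDl.
rewrite !big_split /=; ring.
Qed.

(** The inverse metric [B^T B] turns the coordinate trace of the curvature form [Om] into
    a trace over frame indices. *)
Lemma scalar_curvature_frame (Om : 'I_n -> 'I_n -> 'I_n -> 'I_n -> R) :
  \sum_j \sum_k (\sum_c B c j * B c k) *
    (\sum_i \sum_a B a i * \sum_d Om i j a d * E d k) =
  \sum_a \sum_d \sum_i \sum_j B a i * B d j * Om i j a d.
Proof.
transitivity (\sum_j \sum_c \sum_i \sum_a B c j * (B a i *
    \sum_k B c k * \sum_d E d k * Om i j a d)).
  apply: eq_bigr => j _; under eq_bigr do rewrite mulr_suml.
  rewrite exchange_big; apply: eq_bigr => c _ /=.
  under eq_bigr do rewrite mulr_sumr.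
  rewrite exchange_big; apply: eq_bigr => i _ /=.
  under eq_bigr do rewrite mulr_sumr.
  rewrite exchange_big; apply: eq_bigr => a _ /=.
  rewrite !mulr_sumr; apply: eq_bigr => k _.
  rewrite (eq_bigr (fun d => E d k * Om i j a d)) => [|d _]; last exact: mulrC.
  by move: (\sum_d _) => x; ring.
under eq_bigr do under eq_bigr do under eq_bigr do under eq_bigr do
  rewrite frame_contract.
transitivity (\sum_j \sum_d \sum_a \sum_i B a i * B d j * Om i j a d).
  apply: eq_bigr => j _; apply: eq_bigr => d _; rewrite exchange_big.
  by apply: eq_bigr => a _; apply: eq_bigr => i _; ring.
rewrite exchange_big; under eq_bigr do rewrite exchange_big.
rewrite exchange_big; apply: eq_bigr => a _; apply: eq_bigr => d _.
by rewrite exchange_big.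
Qed.

Lemma curvature_contract (dA : 'I_n -> 'I_n -> 'I_n -> 'I_n -> R)
    (A C : 'I_n -> 'I_n -> 'I_n -> R) (K : 'I_n -> 'I_n -> R) a d :
  (forall c p q, \sum_i B c i * A i p q = C c p q) ->
  (forall p q, \sum_i \sum_j B p i * B q j * dA i j a d = K p q) ->
  \sum_i \sum_j B a i * B d j * (dA i j a d - dA j i a d
    + \sum_b (A i a b * A j b d - A j a b * A i b d)) =
  K a d - K d a + \sum_b (C a a b * C d b d - C d a b * C a b d).
Proof.
move=> A_frame dA_frame.
have AA_frame c e p q r s : \sum_i \sum_j B c i * B e j * (A i p q * A j r s) =
    C c p q * C e r s.
  rewrite -!A_frame mulr_suml; apply: eq_bigr => i _; rewrite mulr_sumr.
  by apply: eq_bigr => j _; rewrite mulrACA.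
have flip (F : 'I_n -> 'I_n -> R) : \sum_i \sum_j B a i * B d j * F j i =
    \sum_i \sum_j B d i * B a j * F i j.
  rewrite exchange_big; apply: eq_bigr => i _; apply: eq_bigr => j _.
  by rewrite [B a _ * _]mulrC.
have -> : K d a = \sum_i \sum_j B a i * B d j * dA j i a d.
  by rewrite (flip (fun i j => dA i j a d)) dA_frame.
rewrite -dA_frame.
rewrite (eq_bigr (fun b => \sum_i \sum_j B a i * B d j * (A i a b * A j b d)
  - \sum_i \sum_j B a i * B d j * (A j a b * A i b d)) (F1 := fun b => _ - _))
  => [|b _]; last first.
  by rewrite AA_frame (flip (fun i j => A i a b * A j b d)) AA_frame.
under [X in _ = _ + X]eq_bigr do rewrite -sumrB.
rewrite [X in _ = _ + X]exchange_big /= -sumrB -big_split; apply: eq_bigr => i _ /=.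
rewrite [X in _ = _ + X](_ : _ = \sum_j B a i * B d j *
    \sum_b (A i a b * A j b d - A j a b * A i b d)); last first.
  under eq_bigr do rewrite -sumrB.
  rewrite exchange_big; apply: eq_bigr => j _ /=; rewrite mulr_sumr.
  by apply: eq_bigr => b _; rewrite mulrBr.
rewrite -sumrB -big_split; apply: eq_bigr => j _ /=.
by rewrite -mulrBr -mulrDr.
Qed.

End FrameAlgebra.

(** * Moving frames: structure functions, connection and curvature *)

Section MovingFrame.
Local Open Scope classical_set_scope.
Variables (R : realType) (n : nat) (U : set 'rV[R]_n) (E : 'rV[R]_n -> 'M[R]_n).
Hypothesis oU : open U.
Hypothesis C2E : forall a j, C2_on U (fun z => E z a j).
Hypothesis uE : forall z, U z -> E z \in unitmx.
Implicit Types (z : 'rV[R]_n) (a b c d i j k l m : 'I_n).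

Local Notation e_ i := (delta_mx (0 : 'I_1) (i : 'I_n) : 'rV[R]_n).
Local Notation B z := (dual_frame (E z)).

Definition dE z a i j : R := partial i (fun x => E x a j) z.

Definition frame_dE z a b c : R := frame_components (B z) (dE z) a b c.

(** [structure z a b c] is [d e^a] evaluated on the frame vectors [b] and [c]. *)
Definition structure z a b c : R := structure_constant (B z) (dE z) a b c.

Definition connection z c b d : R := koszul (B z) (dE z) c b d.

Lemma structureE z a b c : structure z a b c = frame_dE z a b c - frame_dE z a c b.
Proof. by []. Qed.

Definition frame_derive b (f : 'rV[R]_n -> R) z : R :=
  \sum_i B z b i * partial i f z.

Lemma frame_row z a b : U z -> \sum_k B z a k * E z b k = (a == b)%:R.
Proof.
move=> Uz; have /matrixP /(_ a b) := mul_frame (uE Uz).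
rewrite [LHS]mxE [RHS]mxE => <-; apply: eq_bigr => k _.
by congr (_ * _); rewrite [RHS]mxE.
Qed.

Lemma frame_col z k l : U z -> \sum_a B z a k * E z a l = (k == l)%:R.
Proof.
move=> Uz; have /matrixP /(_ k l) := mulT_frame (uE Uz).
rewrite [LHS]mxE [RHS]mxE => <-; apply: eq_bigr => a _.
by congr (_ * _); rewrite [RHS]mxE.
Qed.

Lemma is_derive_coframe z a i j : U z ->
  is_derive z (e_ i) (fun x => E x a j) (dE z a i j).
Proof. move=> Uz; exact: (is_partial i (C2_C1 (C2E a j)) Uz). Qed.

Lemma is_derive_dE z a i j k : U z ->
  is_derive z (e_ k) (fun x => dE x a i j) (partial k (fun x => dE x a i j) z).
Proof. move=> Uz; exact: (is_partial k (@C2_partial _ _ _ _ (C2E a j) i) Uz). Qed.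

Lemma partial_dE_sym z a i j k : U z ->
  partial k (fun x => dE x a i j) z = partial i (fun x => dE x a k j) z.
Proof. move=> Uz; exact: (C2_sym (C2E a j) Uz i k). Qed.

Definition dB z i b k : R :=
  - \sum_a B z a k * \sum_m dE z a i m * B z b m.

Lemma is_derive_dual_frame z b k i : U z ->
  is_derive z (e_ i) (fun x => B x b k) (dB z i b k).
Proof.
move=> Uz; under eq_fun do rewrite mxE.
have HM a j : is_derive z (e_ i) (fun x => E x a j)
    ((\matrix_(a, j) dE z a i j) a j).
  by rewrite mxE; apply: is_derive_coframe.
refine (is_derive_eq (is_derive_invmx oU Uz uE HM k b) _).
rewrite /dB -mulmxA mxE; congr (- _).
apply: eq_bigr => a _; congr (_ * _); first by rewrite mxE.
rewrite mxE; apply: eq_bigr => m _; congr (_ * _); first by rewrite mxE.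
by rewrite mxE.
Qed.

(** The derivative of the dual frame along a frame vector, expanded in the frame. *)
Lemma frame_dB z a b k : U z ->
  \sum_i B z a i * dB z i b k = - \sum_c frame_dE z c a b * B z c k.
Proof.
move=> Uz; rewrite /dB; under eq_bigr do rewrite mulrN mulr_sumr.
rewrite sumrN exchange_big /=; congr (- _); apply: eq_bigr => c _.
rewrite mulr_suml; apply: eq_bigr => i _.
rewrite mulrCA mulrC mulr_sumr; congr (_ * _).
by apply: eq_bigr => m _; rewrite mulrCA mulrC mulrAC.
Qed.

Definition d_frame_dE z m a b c : R :=
  \sum_i \sum_j ((dB z m b i * B z c j + B z b i * dB z m c j) * dE z a i j +
    B z b i * B z c j * partial m (fun x => dE x a i j) z).

Lemma is_derive_frame_dE z m a b c : U z ->
  is_derive z (e_ m) (fun x => frame_dE x a b c) (d_frame_dE z m a b c).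
Proof.
move=> Uz; apply: is_derive_bigsum => i _; apply: is_derive_bigsum => j _.
exact: (is_derive_mul (is_derive_mul (is_derive_dual_frame _ _ _ Uz)
  (is_derive_dual_frame _ _ _ Uz)) (is_derive_dE _ _ _ _ Uz)).
Qed.

Lemma is_derive_structure z m a b c : U z ->
  is_derive z (e_ m) (fun x => structure x a b c)
    (d_frame_dE z m a b c - d_frame_dE z m a c b).
Proof.
move=> Uz; exact: (is_derive_add (is_derive_frame_dE _ _ _ _ Uz)
  (is_derive_opp (is_derive_frame_dE _ _ _ _ Uz))).
Qed.

Lemma structure_anti z a b c : structure z a c b = - structure z a b c.
Proof. exact: structure_constantC. Qed.

#[local] Opaque dual_frame partial dE dB.

(** * The Jacobi identity *)

(** The second derivatives of the coframe on frame vectors; the only part of the frame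
    derivative of [frame_dE] that is not quadratic in [frame_dE]. *)
Definition frame_ddE z d a b c : R :=
  \sum_i \sum_j (B z b i * B z c j *
    \sum_m B z a m * partial m (fun x => dE x d i j) z).

Lemma frame_ddE_sym z d a b c : U z -> frame_ddE z d a b c = frame_ddE z d b a c.
Proof.
move=> Uz; rewrite /frame_ddE.
under eq_bigr do under eq_bigr do rewrite mulr_sumr.
under [RHS]eq_bigr do under eq_bigr do rewrite mulr_sumr.
under eq_bigr do rewrite exchange_big /=.
under [RHS]eq_bigr do rewrite exchange_big /=.
rewrite exchange_big /=; apply: eq_bigr => m _; apply: eq_bigr => i _.
apply: eq_bigr => j _; rewrite (partial_dE_sym d i j m Uz).
by move: (partial _ _ _) => x; ring.
Qed.

Lemma sum_frame_dE z d a b c : U z ->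
  \sum_m B z a m * d_frame_dE z m d b c =
  frame_ddE z d a b c - \sum_e (frame_dE z e a b * frame_dE z d e c +
                                frame_dE z e a c * frame_dE z d b e).
Proof.
move=> Uz; rewrite /d_frame_dE.
transitivity (\sum_i \sum_j (((\sum_m B z a m * dB z m b i) * B z c j +
     B z b i * (\sum_m B z a m * dB z m c j)) * dE z d i j +
     B z b i * B z c j * \sum_m B z a m * partial m (fun x => dE x d i j) z)).
  under eq_bigr do rewrite mulr_sumr.
  rewrite exchange_big /=; apply: eq_bigr => i _.
  under eq_bigr do rewrite mulr_sumr.
  rewrite exchange_big /=; apply: eq_bigr => j _.
  rewrite mulr_suml mulr_sumr -big_split /= mulr_suml mulr_sumr -big_split /=.
  apply: eq_bigr => m _; move: (partial m _ z) => x; ring.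
rewrite /frame_ddE -sumrN -[RHS]addrC.
under eq_bigr do rewrite big_split /=.
rewrite big_split /=; congr (_ + _).
under eq_bigr do under eq_bigr do rewrite !frame_dB//.
under [RHS]eq_bigr => e _.
  have -> : - (frame_dE z e a b * frame_dE z d e c + frame_dE z e a c * frame_dE z d b e)
    = \sum_i \sum_j - ((frame_dE z e a b * B z e i * B z c j +
         frame_dE z e a c * B z e j * B z b i) * dE z d i j).
    rewrite {2 4}/frame_dE /frame_components mulr_sumr mulr_sumr -big_split /= -sumrN.
    apply: eq_bigr => i _; rewrite mulr_sumr mulr_sumr -big_split /= -sumrN.
    by apply: eq_bigr => j _; ring.
  over.
rewrite [RHS]exchange_big /=; apply: eq_bigr => i _.
rewrite [RHS]exchange_big /=; apply: eq_bigr => j _.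
rewrite !(mulNr, mulrN, mulr_suml, mulr_sumr) -opprD -big_split /= mulNr mulr_suml.
by rewrite -sumrN; apply: eq_bigr => e _; ring.
Qed.

Lemma frame_derive_structure z d a b c : U z ->
  frame_derive a (fun x => structure x d b c) z =
  frame_ddE z d a b c - frame_ddE z d a c b
  - \sum_e (frame_dE z e a b * structure z d e c
            + frame_dE z e a c * structure z d b e).
Proof.
move=> Uz; rewrite /frame_derive.
under eq_bigr do rewrite (partialE (is_derive_structure _ _ _ _ Uz)) mulrBr.
rewrite sumrB !sum_frame_dE//.
rewrite [X in _ = _ - X](_ : _ =
  \sum_e (frame_dE z e a b * frame_dE z d e c + frame_dE z e a c * frame_dE z d b e)
  - \sum_e (frame_dE z e a c * frame_dE z d e b + frame_dE z e a b * frame_dE z d c e)).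
  move: (frame_ddE _ _ _ _ _) (frame_ddE z d a c b) (\sum_e _) (\sum_e _) => p q r t.
  ring.
rewrite -sumrB; apply: eq_bigr => e _; rewrite !structureE; ring.
Qed.

(** This is [d (d e^d) = 0]: in the cyclic sum the second derivatives of the coframe
    cancel by symmetry, and the derivatives of the dual frame give the quadratic terms. *)
Lemma jacobi z d a b c : U z ->
  frame_derive a (fun x => structure x d b c) z
  + frame_derive b (fun x => structure x d c a) z
  + frame_derive c (fun x => structure x d a b) z
  = - \sum_e (structure z e a b * structure z d e c
             + structure z e b c * structure z d e a
             + structure z e c a * structure z d e b).
Proof.
move=> Uz; rewrite !frame_derive_structure//.
rewrite (frame_ddE_sym d b a c Uz) (frame_ddE_sym d c b a Uz) (frame_ddE_sym d c a b Uz).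
have gen (p q r x y w v : R) : x + y + w = v ->
  p - q - x + (r - p - y) + (q - r - w) = - v by move=> <-; ring.
apply: gen; rewrite -!big_split /=; apply: eq_bigr => e _.
rewrite (structure_anti z d e b) (structure_anti z d e c) (structure_anti z d e a).
rewrite !structureE; ring.
Qed.

(** * The Levi-Civita connection and its curvature *)

Definition frame_gram z : 'M[R]_n := (E z)^T *m E z.

Definition connection_form z i b d : R :=
  connection_matrix (B z) (E z) (dE z) i b d.

Lemma is_derive_gram z i j l : U z -> is_derive z (e_ i)
  (fun x => frame_gram x j l) (\sum_a (dE z a i j * E z a l + E z a j * dE z a i l)).
Proof.
move=> Uz; rewrite /frame_gram; under eq_fun do rewrite mxE.
apply: is_derive_bigsum => a _; under eq_fun do rewrite mxE.
exact: (is_derive_mul (is_derive_coframe _ _ _ Uz) (is_derive_coframe _ _ _ Uz)).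
Qed.

Lemma christoffel_frame z k i j : U z ->
  christoffel frame_gram k i j z =
  \sum_b B z b k * cov_coframe (B z) (E z) (dE z) b i j.
Proof.
move=> Uz; rewrite /christoffel invmx_gram ?uE//.
rewrite (eq_bigr (fun l => \sum_b B z b k * (B z b l *
   (\sum_a (dE z a i j * E z a l + E z a j * dE z a i l)
   + \sum_a (dE z a j i * E z a l + E z a i * dE z a j l)
   - \sum_a (dE z a l i * E z a j + E z a i * dE z a l j))))) => [|l _]; last first.
  rewrite !(partialE (is_derive_gram _ _ _ Uz)) mxE mulr_suml.
  by apply: eq_bigr => b _; rewrite mxE mulrA.
rewrite exchange_big mulr_sumr; apply: eq_bigr => b _ /=.
rewrite -mulr_sumr mulrCA; congr (_ * _).
have bk := @christoffel_koszul R n (B z) (E z) (dE z)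
  (fun a b => frame_row a b Uz) (fun k l => frame_col k l Uz) b i j.
by rewrite bk mulKf// pnatr_eq0.
Qed.

Definition dconnection z m c b d : R := partial m (fun x => connection x c b d) z.

Lemma is_derive_connection z m c b d : U z ->
  is_derive z (e_ m) (fun x => connection x c b d) (dconnection z m c b d).
Proof.
move=> Uz; apply: DeriveDef => //.
suff [] : is_derive z (e_ m) (fun x => connection x c b d) (0 * (structure z d c b
   - structure z b c d + structure z c d b) + 2^-1 *
  (d_frame_dE z m d c b - d_frame_dE z m d b c
   + - (d_frame_dE z m b c d - d_frame_dE z m b d c)
   + (d_frame_dE z m c d b - d_frame_dE z m c b d))) by [].
exact: (is_derive_mul (is_derive_cst (2^-1 : R) z _)
  (is_derive_add (is_derive_add (is_derive_structure _ _ _ _ Uz)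
    (is_derive_opp (is_derive_structure _ _ _ _ Uz)))
    (is_derive_structure _ _ _ _ Uz))).
Qed.

Definition dconnection_form z i j b d : R :=
  \sum_c (dE z c i j * connection z c b d + E z c j * dconnection z i c b d).

Lemma is_derive_connection_form z i j b d : U z ->
  is_derive z (e_ i) (fun x => connection_form x j b d) (dconnection_form z i j b d).
Proof.
move=> Uz; apply: is_derive_bigsum => c _.
exact: (is_derive_mul (is_derive_coframe _ _ _ Uz) (is_derive_connection _ _ _ _ Uz)).
Qed.

Lemma is_derive_cov_coframe z i b j k : U z ->
  is_derive z (e_ i) (fun x => cov_coframe (B x) (E x) (dE x) b j k)
    (partial i (fun x => dE x b j k) z + \sum_d (dconnection_form z i j b d * E z d k
      + connection_form z j b d * dE z d i k)).
Proof.
move=> Uz; apply: is_derive_add; first exact: is_derive_dE.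
apply: is_derive_bigsum => d _.
exact: (is_derive_mul (is_derive_connection_form _ _ _ _ Uz)
  (is_derive_coframe _ _ _ Uz)).
Qed.

Lemma partial_christoffel z i l j k : U z ->
  partial i (christoffel frame_gram l j k) z =
  \sum_b (dB z i b l * cov_coframe (B z) (E z) (dE z) b j k + B z b l *
    (partial i (fun x => dE x b j k) z + \sum_d (dconnection_form z i j b d * E z d k
      + connection_form z j b d * dE z d i k))).
Proof.
move=> Uz.
rewrite (partial_locally _ oU Uz (fun x Ux => christoffel_frame l j k Ux)).
apply: partialE; apply: is_derive_bigsum => b _.
exact: (is_derive_mul (is_derive_dual_frame _ _ _ Uz)
  (is_derive_cov_coframe _ _ _ _ Uz)).
Qed.

Lemma dconnection_formE z i j b d : dconnection_form z i j b d =
  \sum_c (dE z c i j * connection z c b d + E z c j * dconnection z i c b d).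
Proof. by []. Qed.

#[local] Opaque dconnection_form connection_form connection.

Definition curvature_form z i j a d : R :=
  dconnection_form z i j a d - dconnection_form z j i a d
  + \sum_b (connection_form z i a b * connection_form z j b d
            - connection_form z j a b * connection_form z i b d).

(** Second derivatives of the coframe are symmetric, so they disappear from the
    antisymmetrisation and only the curvature [dA + A /\ A] of the connection form is left. *)
Lemma riemann_frame z l i j k : U z ->
  riemann frame_gram l i j k z =
  \sum_a B z a l * \sum_d curvature_form z i j a d * E z d k.
Proof.
move=> Uz; rewrite /riemann.
have half i' j' : partial i' (christoffel frame_gram l j' k) z
    + \sum_m christoffel frame_gram l i' m z * christoffel frame_gram m j' k z =
    \sum_a B z a l * (partial i' (fun x => dE x a j' k) z
    + \sum_d (connection_form z j' a d * dE z d i' k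
              + connection_form z i' a d * dE z d j' k)
    + \sum_d (dconnection_form z i' j' a d
      + \sum_b connection_form z i' a b * connection_form z j' b d) * E z d k).
  rewrite partial_christoffel//.
  under [X in _ + X]eq_bigr do rewrite !christoffel_frame//.
  exact: (@curvature_frame R n (B z) (E z) (dE z) (fun a b => frame_row a b Uz)
    (dconnection_form z) (fun a p q r => partial p (fun x => dE x a q r) z)).
have comb (p q x y : R) : p - q + (x - y) = (p + x) - (q + y) by ring.
rewrite sumrB comb; apply: (etrans (congr2 (fun x y => x - y) (half i j) (half j i))).
rewrite -sumrB; apply: eq_bigr => a _.
rewrite -mulrBr; congr (_ * _).
rewrite (partial_dE_sym a i k j Uz).
rewrite [X in _ - (_ + X + _)](eq_bigr (fun d => connection_form z j a d * dE z d i k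
  + connection_form z i a d * dE z d j k)) => [|d _]; last exact: addrC.
have comb' (p x y w : R) : p + x + y - (p + x + w) = y - w by ring.
rewrite comb' -sumrB; apply: eq_bigr => d _; rewrite -mulrBl; congr (_ * _).
have comb3 (p q x y : R) : p + x - (q + y) = p - q + (x - y) by ring.
rewrite /curvature_form sumrB; exact: comb3.
Qed.

(** The curvature form is evaluated on frame vectors; differentiating the connection form
    [\sum_c connection c * e^c] produces both the frame derivatives of the coefficients and
    the structure functions [d e^c]. *)
Lemma scalar_curvature_connection z : U z ->
  scalar_curvature frame_gram z =
  \sum_a \sum_d
    (frame_derive a (fun x => connection x d a d) z
     - frame_derive d (fun x => connection x a a d) z
     + \sum_c structure z c a d * connection z c a d
     + \sum_b (connection z a a b * connection z d b d
               - connection z d a b * connection z a b d)).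
Proof.
move=> Uz; rewrite /scalar_curvature /ricci invmx_gram ?uE//.
rewrite (eq_bigr (fun j => \sum_k (\sum_c B z c j * B z c k) *
   (\sum_i \sum_a B z a i * \sum_d curvature_form z i j a d * E z d k))) => [|j _];
  last first.
  apply: eq_bigr => k _; congr (_ * _).
    by rewrite mxE; apply: eq_bigr => c _; rewrite mxE.
  by apply: eq_bigr => i _; rewrite riemann_frame.
rewrite (@scalar_curvature_frame R n (B z) (E z) (fun a b => frame_row a b Uz)).
apply: eq_bigr => a _; apply: eq_bigr => d _.
have A_frame c p q : \sum_i B z c i * connection_form z i p q = connection z c p q.
  exact: (@frame_contract R n (B z) (E z) (fun a b => frame_row a b Uz) c
    (fun e => connection z e p q)).
have dA_frame p q : \sum_i \sum_j B z p i * B z q j * dconnection_form z i j a d =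
    \sum_c frame_dE z c p q * connection z c a d
    + frame_derive p (fun x => connection x q a d) z.
  have -> : frame_derive p (fun x => connection x q a d) z =
      \sum_i B z p i * (\sum_j B z q j * \sum_c E z c j * dconnection z i c a d).
    apply: eq_bigr => i _; congr (_ * _); apply/esym.
    exact: (@frame_contract R n (B z) (E z) (fun a b => frame_row a b Uz) q
      (fun c => dconnection z i c a d)).
  under [X in _ = X + _]eq_bigr do rewrite /frame_dE /frame_components mulr_suml.
  rewrite [X in _ = X + _]exchange_big /= -big_split; apply: eq_bigr => i _ /=.
  under [X in _ = X + _]eq_bigr do rewrite mulr_suml.
  rewrite [X in _ = X + _]exchange_big /= mulr_sumr -big_split.
  apply: eq_bigr => j _ /=; rewrite dconnection_formE big_split mulrDr /=.
  congr (_ + _); last by rewrite mulrA.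
  by rewrite mulr_sumr; apply: eq_bigr => c _; rewrite mulrA.
apply: (etrans (@curvature_contract R n (B z) (dconnection_form z) (connection_form z)
  (connection z) _ a d A_frame dA_frame)).
have comb (p q u v w : R) : p + u - (q + v) + w = u - v + (p - q) + w by ring.
rewrite comb; congr (_ + _ + _); rewrite -sumrB; apply: eq_bigr => c _.
by rewrite structureE mulrBl.
Qed.

End MovingFrame.

(** * The codifferential in a moving frame *)

Section Divergence.
Local Open Scope classical_set_scope.
Variables (R : realType) (n : nat) (U : set 'rV[R]_n) (E : 'rV[R]_n -> 'M[R]_n).
Hypothesis oU : open U.
Hypothesis C2E : forall a j, C2_on U (fun z => E z a j).
Hypothesis uE : forall z, U z -> E z \in unitmx.

Local Notation e_ i := (delta_mx (0 : 'I_1) (i : 'I_n) : 'rV[R]_n).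
Local Notation B z := (dual_frame (E z)).

Lemma is_derive_det_coframe z j : U z ->
  is_derive z (e_ j) (fun x => \det (E x))
    (\det (E z) * \sum_b \sum_i dE E z b j i * B z b i).
Proof.
move=> Uz; refine (is_derive_eq (is_derive_det
  (dM := \matrix_(b, i) dE E z b j i) _) _).
  by move=> b i; rewrite mxE; apply: (is_derive_coframe C2E).
rewrite mulr_sumr; apply: eq_bigr => b _; rewrite mulr_sumr.
apply: eq_bigr => i _; rewrite !mxE /invmx uE// !mxE.
rewrite [_ * (_ * (_ * _))]mulrCA; congr (_ * _).
by rewrite mulVKf// -unitfE -unitmxE uE.
Qed.

(** The divergence of the vector field [\sum_a v a * B a] with respect to the density
    [\det E].  The derivative of the density and that of the dual frame combine into the
    traces [structure b a b]. *)
Lemma frame_divergence z (v : 'I_n -> 'rV[R]_n -> R) : U z ->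
  (forall a j, derivable (v a) z (e_ j)) ->
  \sum_j partial j (fun x => \det (E x) * \sum_a v a x * B x a j) z =
  \det (E z) * \sum_a (frame_derive E a (v a) z
                       + v a z * \sum_b structure E z b a b).
Proof.
move=> Uz Dv.
have HD j : is_derive z (e_ j) (fun x => \det (E x) * \sum_a v a x * B x a j)
   (\det (E z) * (\sum_b \sum_i dE E z b j i * B z b i) * (\sum_a v a z * B z a j)
    + \det (E z) * \sum_a (partial j (v a) z * B z a j + v a z * dB E z j a j)).
  apply: is_derive_mul; first exact: is_derive_det_coframe.
  apply: is_derive_bigsum => a _.
  exact: (is_derive_mul (DeriveDef (Dv a j) erefl)
    (is_derive_dual_frame oU C2E uE _ _ _ Uz)).
rewrite (eq_bigr _ (fun j _ => partialE (HD j))).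
rewrite (eq_bigr (fun j => \det (E z) * (\sum_a ((\sum_b \sum_i dE E z b j i * B z b i)
  * (v a z * B z a j) + (partial j (v a) z * B z a j + v a z * dB E z j a j)))))
  => [|j _]; last first.
  by rewrite -mulrA -mulrDr mulr_sumr -big_split.
rewrite -mulr_sumr; congr (_ * _); rewrite exchange_big; apply: eq_bigr => a _ /=.
rewrite [LHS]big_split /= [X in _ + X = _]big_split /= addrCA; congr (_ + _).
  by apply: eq_bigr => j _; rewrite mulrC.
rewrite -mulr_sumr.
rewrite [X in X + _ = _](_ : _ = v a z * \sum_b frame_dE E z b a b); last first.
  rewrite mulr_sumr /frame_dE /frame_components.
  under [LHS]eq_bigr do rewrite mulr_suml.
  rewrite exchange_big; apply: eq_bigr => b _ /=; rewrite mulr_sumr.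
  apply: eq_bigr => j _; rewrite mulr_suml mulr_sumr; apply: eq_bigr => i _.
  by move: (dE _ _ _ _ _) => x; ring.
rewrite -mulrDr; congr (_ * _).
rewrite [X in _ + X](_ : _ = - \sum_b frame_dE E z b b a).
  by rewrite -sumrB.
rewrite /dB sumrN exchange_big; congr (- _); apply: eq_bigr => b _ /=.
apply: eq_bigr => j _; rewrite mulr_sumr; apply: eq_bigr => i _.
by move: (dE _ _ _ _ _) => x; ring.
Qed.

End Divergence.

Section Codifferential.
Local Open Scope classical_set_scope.
Variables (R : realType) (U : set 'rV[R]_5) (E : 'rV[R]_5 -> 'M[R]_5).
Hypothesis oU : open U.
Hypothesis C2E : forall a j, C2_on U (fun z => E z a j).
Hypothesis uE : forall z, U z -> E z \in unitmx.

Local Notation e_ i := (delta_mx (0 : 'I_1) (i : 'I_5) : 'rV[R]_5).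
Local Notation B z := (dual_frame (E z)).

Lemma row_basis_vectors n p (I : {ffun 'I_p -> 'I_n}) k :
  row k (basis_vectors R I) = delta_mx 0 (I k).
Proof. by apply/rowP => j; rewrite !mxE eqxx eq_sym. Qed.

(** The star operator only evaluates [b] on basis vectors.  This matters for an exterior
    derivative: as a sum of directional derivatives, it is multilinear in its arguments
    only once differentiability is known, but on basis vectors it is given by partial
    derivatives. *)
Lemma star_top_basis (E0 : 'M[R]_5) (b b' : pform R 5 5) w :
  E0 \in unitmx -> is_form b' ->
  (forall I, b (basis_vectors R I) = b' (basis_vectors R I)) ->
  @star R 5 5 0 (E0^T *m E0) (fun v => \det E0 * \det v) b w = b' (dual_frame E0).
Proof.
move=> uE0 fb' bb'; rewrite -(star_top w uE0 fb'); congr (_ * _).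
by apply: eq_bigr => I _; apply: eq_bigr => J _; rewrite bb'.
Qed.

(** The deleted row is replaced by [X] placed on top; moving it back costs the sign that
    the exterior derivative carries. *)
Lemma det_col_mx_row' (X : 'rV[R]_5) (v : 'M[R]_5) k :
  \det (col_mx X (row' k v) : 'M[R]_(1 + 4)) =
  \sum_j X 0 j * ((-1) ^+ k * cofactor v k j).
Proof.
rewrite (@expand_det_row _ 5 _ ord0); apply: eq_bigr => j _.
rewrite (@col_mx1E _ _ 4) unlift_none; congr (_ * _).
have sgn : (-1) ^+ k * (-1) ^+ (k + j) = (-1) ^+ j :> R.
  by rewrite exprD mulrA -expr2 sqrr_sign mul1r.
rewrite /cofactor [RHS]mulrA sgn.
congr (_ * \det _); apply/matrixP => i l; rewrite !mxE.
by have := @col_mx1E _ _ 4 X (row' k v) (lift ord0 i) (lift j l);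
  rewrite liftK !mxE.
Qed.

(** The codifferential of a one-form is minus the divergence of the dual vector
    field with respect to the volume [\det E]. *)
Lemma codiff1_frame (G : 'rV[R]_5 -> 'M[R]_5) (vol nu : 'rV[R]_5 -> pform R 5 _) z :
  (forall x, U x -> G x = (E x)^T *m E x) ->
  (forall x, U x -> vol x = (fun v => \det (E x) * \det v)) ->
  (forall x, U x -> is_form (nu x)) -> U z ->
  (forall a j, derivable (fun x => nu x (row a (B x))) z (e_ j)) ->
  codiff1 G vol nu z = - \sum_a (frame_derive E a (fun x => nu x (row a (B x))) z
     + nu z (row a (B z)) * \sum_b structure E z b a b).
Proof.
move=> GE volE fnu Uz Dnu; rewrite /codiff1 GE// volE//; congr (- _).
pose W j x := \det (E x) * \sum_a nu x (row a (B x)) * B x a j.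
pose b' : pform R 5 5 := fun v => (\sum_j partial j (W j) z) * \det v.
have fb' : is_form b' by exact: is_form_det.
rewrite (star_top_basis _ (uE Uz) fb') => [|I].
  rewrite /b' (frame_divergence oU C2E uE Uz Dnu) det_dual_frame mulrAC mulfV ?mul1r//.
  by rewrite -unitfE -unitmxE uE.
have DW j i : derivable (W j) z (e_ i).
  have Dsum : is_derive z (e_ i) (fun x => \sum_a nu x (row a (B x)) * B x a j)
    (\sum_a (partial i (fun x => nu x (row a (B x))) z * B z a j +
             nu z (row a (B z)) * dB E z i a j)).
    apply: is_derive_bigsum => a _; exact: (is_derive_mul (DeriveDef (Dnu a i) erefl)
      (is_derive_dual_frame oU C2E uE _ _ _ Uz)).
  by case: (is_derive_mul (is_derive_det_coframe C2E uE i Uz) Dsum).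
pose v := basis_vectors R I; rewrite -/v /ext_d /b'.
transitivity (\sum_(k < 5) \sum_j partial (I k) (W j) z * cofactor v k j).
  apply: eq_bigr => k _; rewrite row_basis_vectors -/(partial (I k) _ z).
  have -> : partial (I k) (fun x => @star R 5 1 4 (G x) (vol x) (nu x) (row' k v)) z
      = partial (I k) (fun x => \sum_j W j x * ((-1) ^+ k * cofactor v k j)) z.
    apply: (partial_locally _ oU Uz) => x Ux.
    rewrite GE// volE// star_one ?uE//; last exact: fnu.
    rewrite det_col_mx_row' mulr_sumr; apply: eq_bigr => j _.
    rewrite mulrA /W; congr (_ * _ * _); rewrite summxE.
    by apply: eq_bigr => a _; rewrite !mxE.
  rewrite (partialE (is_derive_bigsum (dF := fun j => partial (I k) (W j) z *
    ((-1) ^+ k * cofactor v k j)) _ _)); last first.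
    move=> j _; refine (is_derive_eq (is_derive_mul (DeriveDef (DW j (I k)) erefl)
      (is_derive_cst ((-1) ^+ k * cofactor v k j : R) z _)) _).
    by rewrite mulr0 addr0.
  rewrite mulr_sumr; apply: eq_bigr => j _; rewrite mulrCA; congr (_ * _).
  by rewrite mulrA -expr2 sqrr_sign mul1r.
rewrite mulr_suml exchange_big; apply: eq_bigr => j _ /=.
have vE k i : v k i = (I k == i)%:R by rewrite !mxE.
transitivity (\sum_i partial i (W j) z * \sum_k v k i * cofactor v k j).
  under [RHS]eq_bigr do rewrite mulr_sumr.
  rewrite exchange_big; apply: eq_bigr => k _ /=.
  rewrite (bigD1 (I k))//= vE eqxx mul1r big1 ?addr0// => i /negPf.
  by rewrite vE eq_sym => ->; rewrite mul0r mulr0.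
(* Only the diagonal terms survive, since replacing a column of [v] by another one
   makes the determinant vanish. *)
have adj i : \sum_k v k i * cofactor v k j = (i == j)%:R * \det v.
  have /matrixP /(_ j i) := mul_adj_mx v; rewrite mxE [RHS]mxE => e.
  rewrite eq_sym mulr_natl -e; apply: eq_bigr => k _.
  by rewrite [(\adj v) j k]mxE mulrC.
rewrite (bigD1 j)//= adj eqxx mul1r big1 ?addr0// => i /negPf.
by rewrite adj => ->; rewrite mul0r mulr0.
Qed.

End Codifferential.

(** * Adapted frames and adapted coframes *)

Section TwoForms.
Variables (R : realType) (n : nat).
Implicit Types (X Y Z : 'rV[R]_n) (a : pform R n 2).

Lemma form1_lin (a : pform R n 1) b c X Y : is_form a ->
  a (b *: X + c *: Y) = b * a X + c * a Y.
Proof.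
move=> fa; apply: (form_multilinear fa (i0 := ord0)); last 2 first.
- by apply/matrixP => -[].
- by apply/matrixP => -[].
by apply/rowP => j; rewrite !mxE.
Qed.

Lemma form2_suml a m (c : 'I_m -> R) (x : 'I_m -> 'rV[R]_n) Z : is_form a ->
  a (vecs [:: \sum_j c j *: x j; Z]) = \sum_j c j * a (vecs [:: x j; Z]).
Proof.
move=> fa; apply: (form_row_sum fa (i0 := ord0)).
  apply/rowP => k; rewrite !mxE !summxE; apply: eq_bigr => j _; by rewrite !mxE.
by move=> j; apply/row'_eqP => -[[|[|//]] h] k //; rewrite !mxE.
Qed.

Lemma form2_sumr a m (c : 'I_m -> R) (x : 'I_m -> 'rV[R]_n) Z : is_form a ->
  a (vecs [:: Z; \sum_j c j *: x j]) = \sum_j c j * a (vecs [:: Z; x j]).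
Proof.
move=> fa; rewrite form2_anti// form2_suml// -sumrN.
by apply: eq_bigr => j _; rewrite -mulrN -form2_anti.
Qed.

Lemma form2_linl a b c X Y Z : is_form a ->
  a (vecs [:: b *: X + c *: Y; Z]) = b * a (vecs [:: X; Z]) + c * a (vecs [:: Y; Z]).
Proof.
move=> fa; apply: (form_multilinear fa (i0 := ord0)).
- by apply/rowP => k; rewrite !mxE.
- by apply/row'_eqP => -[[|[|//]] h] k //; rewrite !mxE.
- by apply/row'_eqP => -[[|[|//]] h] k //; rewrite !mxE.
Qed.

Lemma form2_linr a b c X Y Z : is_form a ->
  a (vecs [:: Z; b *: X + c *: Y]) = b * a (vecs [:: Z; X]) + c * a (vecs [:: Z; Y]).
Proof.
move=> fa; rewrite [LHS](form2_anti _ _ fa) (form2_linl _ _ _ _ _ fa) opprD -!mulrN.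
by rewrite -!(form2_anti _ _ fa).
Qed.

Lemma form2_0l a X Z : is_form a -> X = 0 -> a (vecs [:: X; Z]) = 0.
Proof.
by move=> fa ->; apply: (form_row0 fa (i0 := ord0)); apply/rowP => k; rewrite !mxE.
Qed.

Lemma form2_mulmx m a (C : 'M[R]_(2, m)) (W : 'M[R]_(m, n)) : is_form a ->
  a (C *m W) = \sum_c \sum_d C ord0 c * C ord_max d * a (vecs [:: row c W; row d W]).
Proof.
move=> fa; rewrite form_mulmx// big_ffun2.
apply: eq_bigr => c _; apply: eq_bigr => d _; congr (_ * a _).
  rewrite big_ord_recl big_ord1 !ffunE /=; congr (_ * C _ _); exact: val_inj.
by apply/matrixP => -[[|[|//]] h] j; rewrite !mxE ffunE.
Qed.

End TwoForms.

Section Pfaffian.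
Variable R : realType.

(** The hypotheses say that [p /\ x = 0] for a one-form [p] and a two-form [x] in
    dimension 4.  The map [p |-> p /\ x] is inverted, up to the Pfaffian, by a matrix with
    the entries of [x]. *)
Lemma pfaffian_kernel (p1 p2 p3 p4 x12 x13 x14 x23 x24 x34 : R) :
  x12 * x34 - x13 * x24 + x14 * x23 != 0 ->
  p1 * x23 - p2 * x13 + p3 * x12 = 0 -> p1 * x24 - p2 * x14 + p4 * x12 = 0 ->
  p1 * x34 - p3 * x14 + p4 * x13 = 0 -> p2 * x34 - p3 * x24 + p4 * x23 = 0 ->
  [/\ p1 = 0, p2 = 0, p3 = 0 & p4 = 0].
Proof.
move=> Pf e123 e124 e134 e234.
have z p : (x12 * x34 - x13 * x24 + x14 * x23) * p = 0 -> p = 0.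
  by move/eqP; rewrite mulf_eq0 (negPf Pf) => /eqP.
split; apply: z.
- transitivity (x14 * (p1 * x23 - p2 * x13 + p3 * x12)
    - x13 * (p1 * x24 - p2 * x14 + p4 * x12)
    + x12 * (p1 * x34 - p3 * x14 + p4 * x13)); first by ring.
  by rewrite e123 e124 e134; ring.
- transitivity (x24 * (p1 * x23 - p2 * x13 + p3 * x12)
    - x23 * (p1 * x24 - p2 * x14 + p4 * x12)
    + x12 * (p2 * x34 - p3 * x24 + p4 * x23)); first by ring.
  by rewrite e123 e124 e234; ring.
- transitivity (x34 * (p1 * x23 - p2 * x13 + p3 * x12)
    - x23 * (p1 * x34 - p3 * x14 + p4 * x13)
    + x13 * (p2 * x34 - p3 * x24 + p4 * x23)); first by ring.
  by rewrite e123 e134 e234; ring.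
- transitivity (x34 * (p1 * x24 - p2 * x14 + p4 * x12)
    - x24 * (p1 * x34 - p3 * x14 + p4 * x13)
    + x14 * (p2 * x34 - p3 * x24 + p4 * x23)); first by ring.
  by rewrite e124 e134 e234; ring.
Qed.

End Pfaffian.

Section AdaptedFrame.
Variable R : realType.

(** The coefficients of [e^12 + e^34], [e^13 - e^24] and [e^14 + e^23], with indices
    counted from 0. *)
Definition model_form (r i j : nat) : R :=
  match r, i, j with
  | 0, 0, 1 | 0, 2, 3 | 1, 0, 2 | 1, 3, 1 | 2, 0, 3 | 2, 1, 2 => 1
  | 0, 1, 0 | 0, 3, 2 | 1, 2, 0 | 1, 1, 3 | 2, 3, 0 | 2, 2, 1 => -1
  | _, _, _ => 0
  end.

(** The dual notion to an adapted coframe, which only involves values on frame vectors. *)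
Definition adapted_frame (al : pform R 5 1) (om : 'I_3 -> pform R 5 2)
    (F : 'M[R]_5) : Prop :=
  [/\ F \in unitmx,
      forall i, al (row i F) = (i == o5 5)%:R &
      forall r i j, om r (vecs [:: row i F; row j F]) = model_form r i j].

Variables (al : pform R 5 1) (om : 'I_3 -> pform R 5 2).
Hypothesis fal : is_form al.
Hypothesis fom : forall r, is_form (om r).

Lemma sum5 (V : zmodType) (x : 'I_5 -> V) :
  \sum_i x i = x (o5 1) + x (o5 2) + x (o5 3) + x (o5 4) + x (o5 5).
Proof.
rewrite !big_ord_recl big_ord0 addr0 !addrA.
by congr (x _ + x _ + x _ + x _ + x _); apply: val_inj.
Qed.

Lemma forall5 (P : 'I_5 -> Prop) :
  P (o5 1) -> P (o5 2) -> P (o5 3) -> P (o5 4) -> P (o5 5) -> forall i, P i.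
Proof.
have eP (i j : 'I_5) : val i = val j -> P j -> P i by move=> /val_inj ->.
move=> p1 p2 p3 p4 p5 [[|[|[|[|[|//]]]]] h].
- exact: eP p1.
- exact: eP p2.
- exact: eP p3.
- exact: eP p4.
- exact: eP p5.
Qed.

Lemma forall3 (P : 'I_3 -> Prop) :
  P (o3 1) -> P (o3 2) -> P (o3 3) -> forall i, P i.
Proof.
have eP (i j : 'I_3) : val i = val j -> P j -> P i by move=> /val_inj ->.
move=> p1 p2 p3 [[|[|[|//]]] h].
- exact: eP p1.
- exact: eP p2.
- exact: eP p3.
Qed.

Definition coframe_of (F : 'M[R]_5) (i : 'I_5) : pform R 5 1 :=
  fun X => (X *m invmx F) 0 i.

Lemma is_form_coframe_of F i : is_form (coframe_of F i).
Proof.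
split=> [A B C i0 b c eA _ _|A i1 i2]; last by rewrite !ord1 eqxx.
have {}eA : A = b *: B + c *: C.
  by apply/rowP => j; move/rowP: eA => /(_ j); rewrite !mxE ord1.
by rewrite /coframe_of eA mulmxDl -!scalemxAl !mxE.
Qed.

Lemma adapted_frame_coframe F : adapted_frame al om F ->
  adapted_coframe al om (coframe_of F).
Proof.
move=> [uF alF omF]; split.
- exact: is_form_coframe_of.
- suff -> : \matrix_(i, j) coframe_of F i (delta_mx 0 j) = (invmx F)^T.
    by rewrite unitmx_tr unitmx_inv.
  by apply/matrixP => i j; rewrite !mxE /coframe_of -rowE mxE.
- move=> v; rewrite -{1}[v](mulmxKV uF) mulmx_sum_row form1_sum// sum5 !alF /=.
  by rewrite !mulr0 !add0r mulr1.
move=> v.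
have vE : v = vecs [:: row ord0 v; row ord_max v].
  apply/matrixP => -[[|[|//]] h] j; rewrite !mxE /=; congr (v _ _); exact: val_inj.
have omE r : om r v = \sum_c \sum_d coframe_of F c (row ord0 v) *
    coframe_of F d (row ord_max v) * model_form r c d.
  rewrite -{1}[v](mulmxKV uF) form2_mulmx//.
  apply: eq_bigr => c _; apply: eq_bigr => d _; rewrite omF /coframe_of -!row_mul.
  by rewrite !mxE.
move: (row ord0 v) (row ord_max v) vE omE => X Y -> omE.
rewrite !omE !sum5 /=.
rewrite !wedge11; try exact: is_form_coframe_of.
by move: (coframe_of F) => e; split; ring.
Qed.

End AdaptedFrame.

(** * Existence of adapted frames *)

Section AdaptedFrameExistence.
Variable R : realType.
Variables (al : pform R 5 1) (om : 'I_3 -> pform R 5 2) (v : pform R 5 4).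
Hypothesis fal : is_form al.
Hypothesis fom : forall r, is_form (om r).
Hypothesis fv : is_form v.
Hypothesis om_wedge : forall i j w, wedge (om i) (om j) w = (i == j)%:R * v w.
Hypothesis v_al : exists w, wedge v al w != 0.
Hypothesis om_sign : forall X Y : 'rV[R]_5,
  (forall Z, Defs.interior X (om (o3 1)) Z = Defs.interior Y (om (o3 2)) Z) ->
  0 <= om (o3 3) (col_mx X Y).
Implicit Types (X Y Z : 'rV[R]_5).

Local Notation omv r X Y := (om r (vecs [:: X; Y])).

Lemma top_neq0 (w : 'M[R]_5) : w \in unitmx -> wedge al v w != 0.
Proof.
have fN : is_form (wedge al v) by exact: wedge_is_form.
have [w0] := v_al; rewrite wedge41C (form_top w0 fN) mulf_eq0 negb_or => /andP[_ N1].
by rewrite unitmxE unitfE => w_neq0; rewrite (form_top w fN) mulf_neq0.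
Qed.

(** Every [omega_r] has the same Pfaffian, up to the factor 2 in [omega_r^2]. *)
Lemma v_om r X Y Z W : v (vecs [:: X; Y; Z; W]) =
  2 * (omv r X Y * omv r Z W - omv r X Z * omv r Y W
       + omv r X W * omv r Y Z).
Proof.
have := om_wedge r r (vecs [:: X; Y; Z; W]).
by rewrite eqxx mul1r wedge22// => <-; ring.
Qed.

Lemma kernel_ext r X (w : 'M[R]_5) : w \in unitmx ->
  (forall k, omv r X (row k w) = 0) -> forall Y, omv r X Y = 0.
Proof.
move=> uw Xw Y; rewrite -[Y](mulmxKV uw) mulmx_sum_row form2_sumr//.
by rewrite big1// => k _; rewrite Xw mulr0.
Qed.

(** In odd dimension the alternating matrix of [omega_1] is singular.  A vector in its
    kernel is contracted to 0 with [v], hence lies in the kernel of every [omega_r] because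
    the [omega_r] have nonzero Pfaffian on a complement; [alpha] does not vanish on it since
    [v /\ alpha] is a volume form. *)
Lemma reeb_basis : exists (T : 'rV[R]_5) (h1 h2 h3 h4 : 'rV[R]_5),
  [/\ al T = 1, forall r X, omv r T X = 0,
      [/\ al h1 = 0, al h2 = 0, al h3 = 0 & al h4 = 0] &
      v (vecs [:: h1; h2; h3; h4]) != 0].
Proof.
pose W : 'M[R]_5 := \matrix_(i, j) omv (o3 1) (delta_mx 0 i) (delta_mx 0 j).
have WT : W^T = - W by apply/matrixP => i j; rewrite !mxE form2_anti.
have : \det W == 0.
  have : \det W = - \det W.
    by rewrite -{1}det_tr WT -scaleN1r detZ -signr_odd expr1 mulN1r.
  by move=> /eqP; rewrite -subr_eq0 opprK -mulr2n mulrn_eq0.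
case/det0P => t t_neq0 tW.
have [w uw [c ct]] : exists2 w : 'M[R]_5, w \in unitmx & exists c, c *: row (o5 1) w = t.
  exists (row_ebase t); first exact: row_ebase_unit.
  exists (col_ebase t 0 0); rewrite -[RHS]mulmx_ebase rank_rV t_neq0.
  apply/rowP => j; rewrite !mxE (bigD1 (o5 1))//= big1 ?addr0 => [|k k0].
    by rewrite !mxE big_ord1 !mxE mulr1.
  have k0' : (0%N == k :> nat) = false by case: k k0 => [[|k]].
  by rewrite !mxE big_ord1 !mxE k0' mulr0 mul0r.
have c0 : c != 0 by apply: contra t_neq0 => /eqP c0; rewrite -ct c0 scale0r.
pose u1 := row (o5 1) w; pose u2 := row (o5 2) w; pose u3 := row (o5 3) w.
pose u4 := row (o5 4) w; pose u5 := row (o5 5) w.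
have ker1 X : omv (o3 1) u1 X = 0.
  have tX : omv (o3 1) t X = 0.
    apply: (@kernel_ext _ _ 1%:M); first exact: unitmx1.
    move=> k; rewrite rowE mulmx1 [t]row_sum_delta form2_suml//.
    by move/rowP: tW => /(_ k); rewrite !mxE => tWk; apply: etrans tWk;
      apply: eq_bigr => i _; rewrite mxE.
  have := form2_linl c 0 u1 0 X (fom (o3 1)).
  rewrite scaler0 addr0 mul0r addr0 ct tX => /esym/eqP.
  by rewrite mulf_eq0 (negPf c0) => /eqP.
have v0 X Y Z : v (vecs [:: u1; X; Y; Z]) = 0.
  by rewrite (v_om (o3 1)) !ker1; ring.
have wE : w = vecs [:: u1; u2; u3; u4; u5].
  by apply/row_matrixP; apply: forall5; apply/rowP => j; rewrite !mxE.
have := top_neq0 uw; rewrite wE wedge14// !v0 !mulr0 !subr0 !addr0.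
rewrite mulf_eq0 negb_or => /andP[al1 v1].
have ker r X : omv r u1 X = 0.
  have two0 (p : R) : 2 * p = 0 -> p = 0.
    by move/eqP; rewrite mulf_eq0 pnatr_eq0 => /eqP.
  move: (v_om r u2 u3 u4 u5) v1 => -> v1.
  have [||||| p2 p3 p4 p5] := @pfaffian_kernel R (omv r u1 u2) (omv r u1 u3)
    (omv r u1 u4) (omv r u1 u5) (omv r u2 u3) (omv r u2 u4) (omv r u2 u5)
    (omv r u3 u4) (omv r u3 u5) (omv r u4 u5).
  - by apply: contra v1 => /eqP ->; rewrite mulr0.
  - by apply: two0; rewrite -(v0 u2 u3 u4) (v_om r); ring.
  - by apply: two0; rewrite -(v0 u2 u3 u5) (v_om r); ring.
  - by apply: two0; rewrite -(v0 u2 u4 u5) (v_om r); ring.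
  - by apply: two0; rewrite -(v0 u3 u4 u5) (v_om r); ring.
  apply: (kernel_ext uw); apply: forall5 => //.
  exact: form2_diag.
pose T := (al u1)^-1 *: u1.
have kerT r X : omv r T X = 0.
  have := form2_linl (al u1)^-1 0 u1 0 X (fom r).
  by rewrite scaler0 addr0 ker mulr0 mul0r addr0.
have alT : al T = 1.
  have := form1_lin (al u1)^-1 0 u1 0 fal.
  by rewrite scaler0 addr0 mul0r addr0 mulVf.
pose h u := 1 *: u + (- al u) *: T.
have alh u : al (h u) = 0 by rewrite form1_lin// alT; ring.
have omh r X Y : omv r (h X) (h Y) = omv r X Y.
  have kerT' Z : omv r Z T = 0 by rewrite form2_anti// kerT oppr0.
  by rewrite form2_linl// !form2_linr// !kerT !kerT'; ring.
exists T, (h u2), (h u3), (h u4), (h u5); split=> //.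
by rewrite (v_om (o3 1)) !omh -(v_om (o3 1)).
Qed.

Lemma model_form_anti r i j : model_form R r i j = - model_form R r j i.
Proof.
by case: r => [|[|[|r]]]; case: i => [|[|[|[|i]]]]; case: j => [|[|[|[|j]]]] /=;
  rewrite ?opprK ?oppr0.
Qed.

Lemma adapted_frame_intro (F : 'M[R]_5) :
  (forall i, al (row i F) = (i == o5 5)%:R) ->
  (forall r (i j : 'I_5), (i < j)%N ->
    omv r (row i F) (row j F) = model_form R r i j) -> adapted_frame al om F.
Proof.
move=> alF omF.
have omF' r i j : omv r (row i F) (row j F) = model_form R r i j.
  have [ij|ji|/val_inj ->] := ltngtP i j; first exact: omF.
    by rewrite form2_anti// omF// -model_form_anti.
  rewrite form2_diag//; have /eqP := model_form_anti r j j.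
  by rewrite -addr_eq0 -mulr2n mulrn_eq0 /= => /eqP ->.
split=> //; rewrite unitmxE unitfE; apply/det0P => -[c c_neq0 cF].
have om0 (i : 'I_5) : \sum_k c 0 k * model_form R 0 i k = 0.
  have e := form2_0l (row i F) (fom (o3 1)) cF.
  rewrite mulmx_sum_row form2_suml// in e.
  apply/eqP; rewrite -oppr_eq0 -sumrN; apply/eqP; apply: etrans e.
  apply: eq_bigr => k _.
  by rewrite omF' -mulrN -model_form_anti.
have al0 : \sum_k c 0 k * (k == o5 5)%:R = 0.
  have e : al (c *m F) = 0.
    by rewrite cF; apply: (form_row0 fal (i0 := ord0)); apply/rowP => j; rewrite !mxE.
  rewrite mulmx_sum_row form1_sum// in e; apply: etrans e.
  by apply: eq_bigr => k _; rewrite alF.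
have := (om0 (o5 1), om0 (o5 2), om0 (o5 3), om0 (o5 4), al0).
rewrite !sum5 /= !mulr0 !mulr1 !mulrN1 !add0r !addr0.
move=> [[[[c2 /eqP]]]]; rewrite oppr_eq0 => /eqP c1 c4 /eqP; rewrite oppr_eq0 => /eqP c3 c5.
by move/eqP: c_neq0; apply; apply/rowP; apply: forall5; rewrite mxE.
Qed.

(** The vectors [h2], [h3], [h4] are replaced by the basis dual to the one-forms
    [omega_r (h1, -)], which are independent because [omega_i /\ omega_j = delta_ij v].  The
    same relations determine the remaining values of the [omega_r] up to one parameter
    [la] and multiples of [h1] that can be subtracted.  The sign condition makes [la]
    positive, and rescaling by its square root gives an adapted frame. *)
Lemma adapted_frame_exists : exists F, adapted_frame al om F.
Proof.
have [T [h1 [h2 [h3 [h4 [alT kerT [al1 al2 al3 al4] vh]]]]]] := reeb_basis.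
have kerT' r X : omv r X T = 0 by rewrite form2_anti// kerT oppr0.
pose h : 'I_3 -> 'rV[R]_5 := fun s => [:: h2; h3; h4]`_s.
pose Th : 'M[R]_3 := \matrix_(r, s) omv r h1 (h s).
have uTh : Th \in unitmx.
  rewrite unitmxE unitfE; apply/det0P => -[a a0 aTh].
  have ker0 s : \sum_r a 0 r * omv r h1 (h s) = 0.
    move/rowP: aTh => /(_ s); rewrite !mxE => aTh; apply: etrans aTh.
    by apply: eq_bigr => r _; rewrite mxE.
  have k2 := ker0 (o3 1); have k3 := ker0 (o3 2); have k4 := ker0 (o3 3).
  rewrite /h /= in k2 k3 k4.
  have : (\sum_r a 0 r ^+ 2) * v (vecs [:: h1; h2; h3; h4]) = 0.
    transitivity (\sum_r \sum_s a 0 r * a 0 s *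
        wedge (om r) (om s) (vecs [:: h1; h2; h3; h4])).
      rewrite mulr_suml; apply: eq_bigr => r _.
      rewrite (bigD1 r)//= om_wedge eqxx mul1r expr2 big1 ?addr0// => s /negPf.
      by rewrite om_wedge eq_sym => ->; rewrite mul0r mulr0.
    transitivity (2 * ((\sum_r a 0 r * omv r h1 h2) * (\sum_s a 0 s * omv s h3 h4)
      - (\sum_r a 0 r * omv r h1 h3) * (\sum_s a 0 s * omv s h2 h4)
      + (\sum_r a 0 r * omv r h1 h4) * (\sum_s a 0 s * omv s h2 h3))).
      under eq_bigr do under eq_bigr do rewrite wedge22//.
      by rewrite !big_ord_recl !big_ord0; ring.
    by rewrite k2 k3 k4; ring.
  move/eqP; rewrite mulf_eq0 (negPf vh) orbF psumr_eq0; last first.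
    by move=> r _; exact: sqr_ge0.
  move=> /allP a2; move/negP: a0; apply; apply/eqP/rowP => r; rewrite mxE.
  by apply/eqP; rewrite -sqrf_eq0; apply: (implyP (a2 r _)); rewrite ?mem_index_enum.
pose b (s : 'I_3) := \sum_t invmx Th t s *: h t.
have omb r s : omv r h1 (b s) = (r == s)%:R.
  rewrite form2_sumr//; have /matrixP /(_ r s) := mulmxV uTh.
  rewrite [LHS]mxE [RHS]mxE => <-; apply: eq_bigr => t _.
  by rewrite mulrC; congr (_ * _); rewrite mxE.
have alb s : al (b s) = 0.
  by rewrite form1_sum// big1// => t _; rewrite /h; move: t; apply: forall3;
    rewrite /= ?al2 ?al3 ?al4 mulr0.
pose b2 := b (o3 1); pose b3 := b (o3 2); pose b4 := b (o3 3).
have h1b2 r : omv r h1 b2 = (r == o3 1)%:R by exact: omb.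
have h1b3 r : omv r h1 b3 = (r == o3 2)%:R by exact: omb.
have h1b4 r : omv r h1 b4 = (r == o3 3)%:R by exact: omb.
have h1h1 r : omv r h1 h1 = 0 by exact: form2_diag.
pose B : 'M[R]_5 := vecs [:: h1; b2; b3; b4; T].
have rowB : [/\ row (o5 1) B = h1, row (o5 2) B = b2, row (o5 3) B = b3,
    row (o5 4) B = b4 & row (o5 5) B = T].
  by split; apply/rowP => j; rewrite !mxE.
have combB (c : 'rV[R]_5) : c *m B = c 0 (o5 1) *: h1 + c 0 (o5 2) *: b2 +
    c 0 (o5 3) *: b3 + c 0 (o5 4) *: b4 + c 0 (o5 5) *: T.
  by have [r1 r2 r3 r4 r5] := rowB; rewrite mulmx_sum_row sum5 r1 r2 r3 r4 r5.
have om_combB r X (c : 'rV[R]_5) : omv r X (c *m B) =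
    c 0 (o5 1) * omv r X h1 + c 0 (o5 2) * omv r X b2 +
    c 0 (o5 3) * omv r X b3 + c 0 (o5 4) * omv r X b4.
  have [r1 r2 r3 r4 r5] := rowB.
  rewrite mulmx_sum_row form2_sumr// sum5 r1 r2 r3 r4 r5.
  by rewrite kerT' mulr0 addr0.
have uB : B \in unitmx.
  rewrite unitmxE unitfE; apply/det0P => -[c c_neq0 cB].
  have h1_neq0 : h1 != 0.
    apply/eqP => h10; have := h1b2 (o3 1); rewrite form2_0l// eqxx => /eqP.
    by rewrite eq_sym oner_eq0.
  have c_r r : omv r h1 (c *m B) = 0.
    by rewrite cB form2_anti// form2_0l// oppr0.
  have := (c_r (o3 1), c_r (o3 2), c_r (o3 3)).
  rewrite !om_combB !h1h1 !h1b2 !h1b3 !h1b4 /= !mulr0 !mulr1 !add0r !addr0.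
  move=> [[c2 c3] c4].
  have c5 : c 0 (o5 5) = 0.
    have [r1 r2 r3 r4 r5] := rowB.
    transitivity (al (c *m B)).
      rewrite mulmx_sum_row form1_sum// sum5 r1 r2 r3 r4 r5 al1 !alb alT.
      by rewrite !mulr0 !add0r mulr1.
    by rewrite cB; apply: (form_row0 fal (i0 := ord0)); apply/rowP => j; rewrite !mxE.
  move: cB; rewrite combB c2 c3 c4 c5 !scale0r !addr0 => /eqP.
  rewrite scaler_eq0 (negPf h1_neq0) orbF => /eqP c1.
  by move/eqP: c_neq0; apply; apply/rowP; apply: forall5; rewrite mxE.
have V0 : v (vecs [:: h1; b2; b3; b4]) != 0.
  have := top_neq0 uB; rewrite /B wedge14// al1 !alb alT.
  by rewrite !mul0r mul1r !(subr0, add0r).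
have rel r s := om_wedge r s (vecs [:: h1; b2; b3; b4]).
(* The six relations on the unknown values of the three forms on the last vectors. *)
have := (rel (o3 1) (o3 1), rel (o3 2) (o3 2), rel (o3 3) (o3 3),
         rel (o3 1) (o3 2), rel (o3 1) (o3 3), rel (o3 2) (o3 3)).
rewrite !wedge22// !h1b2 !h1b3 !h1b4 /=; move: (v _) V0 {rel} => V V0.
set x1 := omv (o3 1) b2 b3; set y1 := omv (o3 1) b2 b4; set la := omv (o3 1) b3 b4.
set x2 := omv (o3 2) b2 b3; set y2 := omv (o3 2) b2 b4; set z2 := omv (o3 2) b3 b4.
set x3 := omv (o3 3) b2 b3; set y3 := omv (o3 3) b2 b4; set z3 := omv (o3 3) b3 b4.
move=> [[[[[e11 e22] e33] e12] e13] e23].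
have eV : V = 2 * la by lra.
have ey2 : y2 = - la by lra.
have ex3 : x3 = la by lra.
have ey1 : y1 = z2 by lra.
have ez3 : z3 = - x1 by lra.
have ey3 : y3 = x2 by lra.
pose c2 := 1 *: b2 + (- x2) *: h1.
pose c3 := 1 *: b3 + x1 *: h1.
pose c4 := 1 *: b4 + z2 *: h1.
have b_h1 r X : omv r X h1 = - omv r h1 X by rewrite form2_anti.
have h1c2 r : omv r h1 c2 = (r == o3 1)%:R by rewrite form2_linr// h1b2 h1h1; ring.
have h1c3 r : omv r h1 c3 = (r == o3 2)%:R by rewrite form2_linr// h1b3 h1h1; ring.
have h1c4 r : omv r h1 c4 = (r == o3 3)%:R by rewrite form2_linr// h1b4 h1h1; ring.
have c2c3 r : omv r c2 c3 = la * (r == o3 3)%:R.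
  rewrite form2_linr// b_h1 h1c2 form2_linl// h1b3; move: r; apply: forall3;
  rewrite /= -/x1 -/x2 -/x3 ?ex3; ring.
have c2c4 r : omv r c2 c4 = - la * (r == o3 2)%:R.
  rewrite form2_linr// b_h1 h1c2 form2_linl// h1b4; move: r; apply: forall3;
  rewrite /= -/y1 -/y2 -/y3 ?ey1 ?ey2 ?ey3; ring.
have c3c4 r : omv r c3 c4 = la * (r == o3 1)%:R.
  rewrite form2_linr// b_h1 h1c3 form2_linl// h1b4; move: r; apply: forall3;
  rewrite /= -/la -/z2 -/z3 ?ez3; ring.
have la0 : la != 0 by apply: contra V0; rewrite eV => /eqP ->; rewrite mulr0.
(* The sign condition is applied to [h1] and [la^-1 c4], for which the two interior
   products agree. *)
have la_gt0 : 0 < la.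
  rewrite lt_neqAle eq_sym la0 /= -invr_ge0.
  have := om_sign (X := h1) (Y := la^-1 *: c4 + 0 *: 0).
  rewrite col_mx_vecs form2_linr// h1c4 mul0r addr0 mulr1; apply => Z.
  rewrite /Defs.interior !col_mx_vecs -[Z](mulmxKV uB) form2_linl// mul0r addr0.
  rewrite !om_combB !h1h1 !h1b2 !h1b3 !h1b4 b_h1 h1c4 !form2_linl//.
  rewrite !h1b2 !h1b3 !h1b4 form2_diag// (form2_anti b4 b2)// (form2_anti b4 b3)//.
  rewrite -/y2 -/z2 ey2 /=; move: (Z *m invmx B) => c; field.
  exact: la0.
pose s := Num.sqrt la.
have s2 : s * s = la by rewrite -expr2 sqr_sqrtr// ltW.
have s0 : s != 0 by rewrite gt_eqF// sqrtr_gt0.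
pose sc (x : R) X := x *: X + 0 *: 0.
have om_sc r x y X Y : omv r (sc x X) (sc y Y) = x * y * omv r X Y.
  by rewrite form2_linl// form2_linr// !mul0r !addr0 mulrA.
have al_sc x X : al (sc x X) = x * al X by rewrite form1_lin// mul0r addr0.
have alc : [/\ al c2 = 0, al c3 = 0 & al c4 = 0].
  by split; rewrite form1_lin// alb al1; ring.
pose F : 'M[R]_5 := vecs [:: sc s h1; sc s^-1 c2; sc s^-1 c3; sc s^-1 c4; T].
have [F1 F2 F3 F4 F5] : [/\ row (o5 1) F = sc s h1, row (o5 2) F = sc s^-1 c2,
    row (o5 3) F = sc s^-1 c3, row (o5 4) F = sc s^-1 c4 & row (o5 5) F = T].
  by split; apply/rowP => j; rewrite [LHS]mxE [LHS]mxE.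
have [a2 a3 a4] := alc.
exists F; apply: adapted_frame_intro.
  apply: forall5; rewrite ?F1 ?F2 ?F3 ?F4 ?F5 ?al_sc ?al1 ?a2 ?a3 ?a4 ?mulr0//.
move=> r i j; move: i; apply: forall5; move: j; apply: forall5 => // _;
  rewrite ?F1 ?F2 ?F3 ?F4 ?F5 ?om_sc ?kerT' ?h1c2 ?h1c3 ?h1c4 ?c2c3 ?c2c4 ?c3c4;
  move: r; apply: forall3 => /=; rewrite ?mulr0 ?mulr1 -?s2 //; by field.
Qed.

End AdaptedFrameExistence.

(** * A smooth adapted coframe *)

Section LocalCoframe.
Local Open Scope classical_set_scope.
Variable R : realType.

Lemma mulmx_delta_tr n (A : 'rV[R]_n) j :
  (A *m (delta_mx 0 j : 'rV[R]_n)^T) 0 0 = A 0 j.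
Proof.
rewrite mxE (bigD1 j)//= !mxE !eqxx mulr1 big1 ?addr0// => k kj.
by rewrite !mxE (negPf kj) andbF mulr0.
Qed.

(** Right multiplication by the quaternion with coordinates [x1, x2, x3, x4], fixing the
    last vector: the rows are its products with the units 1, i, j, k.  For quaternions of
    norm 1 these are the elements of SU(2). *)
Definition quaternion_rotation (x1 x2 x3 x4 : R) : 'M[R]_5 :=
  \matrix_(a, b) match (a : nat), (b : nat) with
  | 0, 0 => x1 | 0, 1 => x2 | 0, 2 => x3 | 0, 3 => x4
  | 1, 0 => - x2 | 1, 1 => x1 | 1, 2 => - x4 | 1, 3 => x3
  | 2, 0 => - x3 | 2, 1 => x4 | 2, 2 => x1 | 2, 3 => - x2
  | 3, 0 => - x4 | 3, 1 => - x3 | 3, 2 => x2 | 3, 3 => x1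
  | 4, 4 => 1 | _, _ => 0
  end.

Lemma quaternion_rotation_orthogonal (x1 x2 x3 x4 : R) :
  x1 * x1 + x2 * x2 + x3 * x3 + x4 * x4 = 1 ->
  quaternion_rotation x1 x2 x3 x4 *m (quaternion_rotation x1 x2 x3 x4)^T = 1%:M.
Proof.
move=> x_1; apply/matrixP; apply: forall5; apply: forall5;
  rewrite mxE sum5 !mxE /=; first [by ring | by rewrite -x_1; ring].
Qed.

(** The stabiliser of the three two-forms contains SU(2): right multiplications commute
    with the left multiplications by i, j, k defining the forms. *)
Lemma adapted_frame_rotate (al : pform R 5 1) (om : 'I_3 -> pform R 5 2) F
    (x1 x2 x3 x4 : R) : is_form al -> (forall r, is_form (om r)) ->
  x1 * x1 + x2 * x2 + x3 * x3 + x4 * x4 = 1 -> adapted_frame al om F ->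
  adapted_frame al om (quaternion_rotation x1 x2 x3 x4 *m F).
Proof.
move=> fal fom x_1 [uF alF omF].
have := quaternion_rotation_orthogonal x_1.
set M := quaternion_rotation _ _ _ _ => MM.
have uM : M \in unitmx by case/mulmx1_unit: MM.
split; first by rewrite unitmx_mul uM.
  move=> i; rewrite row_mul mulmx_sum_row form1_sum// sum5 !alF /=.
  by move: i; apply: forall5; rewrite !mxE /=; ring.
move=> r i j.
have -> : om r (vecs [:: row i (M *m F); row j (M *m F)]) =
    \sum_c \sum_d M i c * M j d * model_form R r c d.
  rewrite !row_mul !mulmx_sum_row form2_suml//; apply: eq_bigr => c _.
  rewrite form2_sumr// mulr_sumr; apply: eq_bigr => d _.
  by rewrite omF !mxE mulrA.
rewrite !sum5; move: r; apply: forall3; move: i; apply: forall5;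
  move: j; apply: forall5; rewrite !mxE /=;
  first [by ring | by rewrite -x_1; ring | by rewrite -[in RHS]x_1; ring].
Qed.

Lemma adapted_om_expand (al : pform R 5 1) (om : 'I_3 -> pform R 5 2) F r X Y :
  is_form al -> (forall r, is_form (om r)) -> adapted_frame al om F ->
  om r (vecs [:: X; Y]) =
  \sum_(c < 5) \sum_(d < 5) model_form R r c d * coframe_of F c X * coframe_of F d Y.
Proof.
move=> fal fom [uF _ omF].
rewrite -{1}[X](mulmxKV uF) -{1}[Y](mulmxKV uF).
rewrite (mulmx_sum_row (X *m _)) (mulmx_sum_row (Y *m _)) form2_suml//.
apply: eq_bigr => c _; rewrite form2_sumr// mulr_sumr; apply: eq_bigr => d _.
by rewrite omF /coframe_of; ring.
Qed.

Lemma adapted_al_expand (al : pform R 5 1) (om : 'I_3 -> pform R 5 2) F X :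
  is_form al -> adapted_frame al om F -> al X = coframe_of F (o5 5) X.
Proof.
move=> fal [uF alF _]; rewrite -{1}[X](mulmxKV uF) mulmx_sum_row form1_sum// sum5 !alF /=.
by rewrite !mulr0 !add0r mulr1.
Qed.

(** [alpha /\ omega_1^2] is 2 on an adapted frame, hence [2 * \det E] on the standard
    basis; its sign turns the density [|\det E|] of the metric into [\det E]. *)
Lemma volume_adapted (al : pform R 5 1) (om : 'I_3 -> pform R 5 2) (E : 'M[R]_5) :
  is_form al -> (forall r, is_form (om r)) -> E \in unitmx ->
  adapted_frame al om (dual_frame E) ->
  volume_form (E^T *m E) (wedge al (wedge (om (o3 1)) (om (o3 1)))) =
  (fun v => \det E * \det v).
Proof.
move=> fal fom uE [_ alF omF]; apply/funext => v; congr (_ * _).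
set B := dual_frame E in alF omF; set o := wedge al _.
have fo : is_form o := wedge_is_form fal (wedge_is_form (fom (o3 1)) (fom (o3 1))).
have oB : o B = 2.
  have BE : B = vecs [:: row (o5 1) B; row (o5 2) B; row (o5 3) B; row (o5 4) B;
      row (o5 5) B].
    by apply/row_matrixP; apply: forall5; apply/rowP => j; rewrite !mxE.
  rewrite BE /o wedge14; last exact: (wedge_is_form (fom _) (fom _)).
  by rewrite !wedge22// !alF !omF /=; ring.
have dE0 : \det E != 0 by rewrite -unitfE -unitmxE.
have o1 : o 1%:M = 2 * \det E.
  by move: oB; rewrite (form_top B fo) det_dual_frame => <-; rewrite mulrAC mulVf ?mul1r.
rewrite o1 det_mulmx det_tr -expr2 sqrtr_sqr sgrM gtr0_sg// mul1r.
by rewrite -numEsg.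
Qed.

Section SmoothFrame.
Variables (U0 : set 'rV[R]_5) (al : 'rV[R]_5 -> pform R 5 1)
  (om : 'I_3 -> 'rV[R]_5 -> pform R 5 2) (G : 'rV[R]_5 -> 'M[R]_5).
Hypothesis oU0 : open U0.
Hypothesis fal : forall z, U0 z -> is_form (al z).
Hypothesis fom : forall r z, U0 z -> is_form (om r z).
Hypothesis sal : forall v, smooth_on U0 (fun z => al z v).
Hypothesis som : forall r v, smooth_on U0 (fun z => om r z v).
Hypothesis sG : forall i j, smooth_on U0 (fun z => G z i j).
Hypothesis adapted : forall z, U0 z -> exists F, adapted_frame (al z) (om^~ z) F.
Hypothesis GE : forall z F, U0 z -> adapted_frame (al z) (om^~ z) F ->
  forall X Y : 'rV[R]_5, (X *m G z *m Y^T) 0 0 =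
    \sum_i coframe_of F i X * coframe_of F i Y.

(** Fix a vector [X0] that is horizontal at [y].  Rotating an adapted coframe so that the
    horizontal part of [X0] becomes a multiple of the first frame vector determines it:
    its members are the metric dual of that vector and its contractions with the
    [omega_r], divided by its length.  These formulas depend smoothly on the point, whatever
    adapted frames one starts from. *)
Lemma smooth_adapted_coframe y : U0 y -> exists (U : set 'rV[R]_5) (E : 'rV[R]_5 -> 'M[R]_5),
  [/\ open U, U y, U `<=` U0, (forall a j, C2_on U (fun z => E z a j)) &
    forall z, U z -> [/\ E z \in unitmx, G z = (E z)^T *m E z &
      adapted_frame (al z) (om^~ z) (dual_frame (E z))]].
Proof.
move=> U0y; have [F0 aF0] := adapted U0y.
pose X0 := row (o5 1) F0.
(* The squared length of the horizontal part of [X0]. *)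
pose q z := \sum_i \sum_j X0 0 i * X0 0 j * G z i j - al z X0 * al z X0.
have qE z F : U0 z -> adapted_frame (al z) (om^~ z) F ->
    q z = coframe_of F (o5 1) X0 * coframe_of F (o5 1) X0
      + coframe_of F (o5 2) X0 * coframe_of F (o5 2) X0
      + coframe_of F (o5 3) X0 * coframe_of F (o5 3) X0
      + coframe_of F (o5 4) X0 * coframe_of F (o5 4) X0.
  move=> Uz aF; have := GE Uz aF X0 X0; rewrite sum5.
  rewrite -(adapted_al_expand X0 (fal Uz) aF).
  have -> : (X0 *m G z *m X0^T) 0 0 = \sum_i \sum_j X0 0 i * X0 0 j * G z i j.
    rewrite mxE exchange_big; apply: eq_bigr => j _ /=; rewrite !mxE mulr_suml.
    by apply: eq_bigr => i _; rewrite mxE mulrAC.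
  by rewrite /q => ->; ring.
pose U := U0 `&` [set z | 0 < q z].
have U0C2al v : C2_on U0 (fun z => al z v) by apply: smooth_C2.
have U0C2om r v : C2_on U0 (fun z => om r z v) by apply: smooth_C2.
have U0C2G i j : C2_on U0 (fun z => G z i j) by apply: smooth_C2.
have cq z : U0 z -> {for z, continuous q}.
  move=> Uz.
  have cG i j : {for z, continuous (fun x => G x i j)} by case: (sG i j [::] Uz).
  have cal : {for z, continuous (fun x => al x X0)} by case: (sal X0 [::] Uz).
  have csum : {for z, continuous (fun x => \sum_i \sum_j X0 0 i * X0 0 j * G x i j)}.
    apply: (cvg_big add_continuous (nbhs_filter z)) => i _.
    apply: (cvg_big add_continuous (nbhs_filter z)) => j _.
    exact: (cvgM (cvg_cst (X0 0 i * X0 0 j)) (cG i j)).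
  exact: (cvgB csum (cvgM cal cal)).
have oU : open U.
  rewrite openE => z [Uz qz]; apply: filterI; first exact: open_nbhs_nbhs.
  have := cq z Uz; move/cvgrPdist_lt => /(_ _ qz); apply: filterS => x /=.
  by rewrite ltr_norml => /andP[_]; rewrite ltrBlDr ltrDl.
have q1 : q y = 1.
  rewrite (qE y F0)//; have [uF _ _] := aF0.
  have X0E i : coframe_of F0 i X0 = (o5 1 == i)%:R.
    by rewrite /coframe_of /X0 -row_mul mulmxV// !mxE.
  by rewrite !X0E /=; ring.
pose r z := (Num.sqrt (q z))^-1.
pose E z : 'M[R]_5 := \matrix_(a, j) match (a : nat) with
  | 0 => r z * (\sum_i X0 0 i * G z i j - al z X0 * al z (delta_mx 0 j))
  | 1 => r z * om (o3 1) z (vecs [:: X0; delta_mx 0 j])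
  | 2 => r z * om (o3 2) z (vecs [:: X0; delta_mx 0 j])
  | 3 => r z * om (o3 3) z (vecs [:: X0; delta_mx 0 j])
  | _ => al z (delta_mx 0 j)
  end.
have C2U f : C2_on U0 f -> C2_on U f.
  by case=> f1 f2 f3; split=> [z [Uz _]|i z [Uz _]|z [Uz _]]; [exact: f1|exact: f2|exact: f3].
have C2al v : C2_on U (fun z => al z v) := C2U _ (U0C2al v).
have C2om s v : C2_on U (fun z => om s z v) := C2U _ (U0C2om s v).
have C2G i j : C2_on U (fun z => G z i j) := C2U _ (U0C2G i j).
have C2N f : C2_on U f -> C2_on U (fun z => - f z).
  by move=> Cf; under eq_fun do rewrite -mulN1r; exact: (C2_mul oU (C2_cst (-1) oU) Cf).
have C2q : C2_on U q.
  exact: (C2_add oU (C2_sum _ _ oU (fun i => C2_sum _ _ oU (fun j =>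
    C2_mul oU (C2_cst (X0 0 i * X0 0 j) oU) (C2G i j))))
    (C2N _ (C2_mul oU (C2al X0) (C2al X0)))).
have C2r : C2_on U r by apply: (C2_rsqrt oU _ C2q) => z [].
exists U, E; split.
- exact: oU.
- by split=> //=; rewrite q1.
- by move=> z [].
- apply: forall5 => j; under eq_fun do rewrite mxE /=.
  + exact: (C2_mul oU C2r (C2_add oU (C2_sum _ _ oU (fun i =>
      C2_mul oU (C2_cst (X0 0 i) oU) (C2G i j)))
      (C2N _ (C2_mul oU (C2al X0) (C2al (delta_mx 0 j)))))).
  + exact: (C2_mul oU C2r (C2om _ _)).
  + exact: (C2_mul oU C2r (C2om _ _)).
  + exact: (C2_mul oU C2r (C2om _ _)).
  + exact: C2al.
move=> z [Uz qz]; have [F aF] := adapted Uz; have [uF _ _] := aF.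
pose x i := coframe_of F i X0.
have qx := qE z F Uz aF; rewrite -!/(x _) in qx.
have rq : r z * x (o5 1) * (r z * x (o5 1)) + r z * x (o5 2) * (r z * x (o5 2))
    + r z * x (o5 3) * (r z * x (o5 3)) + r z * x (o5 4) * (r z * x (o5 4)) = 1.
  transitivity (r z * r z * q z); first by rewrite qx; ring.
  by rewrite /r -invfM -expr2 sqr_sqrtr ?ltW// mulVf// gt_eqF.
have aN := adapted_frame_rotate (fal Uz) (fun s => fom s Uz) rq aF.
have := quaternion_rotation_orthogonal rq.
set M := quaternion_rotation _ _ _ _ in aN *; set N := M *m F in aN => MM.
have [uN _ _] := aN.
have coN a X : coframe_of N a X = \sum_b M a b * coframe_of F b X.
  have invN : invmx N = invmx F *m M^T.
    have MF : N *m (invmx F *m M^T) = 1%:M by rewrite /N mulmxA mulmxK.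
    by rewrite -[LHS]mulmx1 -MF mulKmx.
  rewrite /coframe_of invN mulmxA mxE; apply: eq_bigr => b _.
  by rewrite mulrC; congr (_ * _); rewrite mxE.
have EN : E z = dual_frame N.
  apply/matrixP => a j; rewrite /dual_frame [RHS]mxE.
  have -> : invmx N j a = coframe_of N a (delta_mx 0 j) by rewrite /coframe_of -rowE mxE.
  rewrite coN sum5.
  have := GE Uz aF X0 (delta_mx 0 j); rewrite sum5.
  have -> : (X0 *m G z *m (delta_mx 0 j : 'rV[R]_5)^T) 0 0 = \sum_i X0 0 i * G z i j.
    by rewrite mulmx_delta_tr mxE.
  have := adapted_al_expand X0 (fal Uz) aF.
  have := adapted_al_expand (delta_mx 0 j) (fal Uz) aF.
  have := fun s => adapted_om_expand s X0 (delta_mx 0 j) (fal Uz) (fun s => fom s Uz) aF.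
  move=> /= omE alE alX GX; rewrite /M /E; move: a; apply: forall5;
    rewrite !mxE /= ?GX ?alX ?alE ?omE ?sum5 /= /x; ring.
have uE : E z \in unitmx by rewrite EN /dual_frame unitmx_tr unitmx_inv.
have EE : dual_frame (E z) = N.
  by rewrite EN /dual_frame -trmx_inv trmxK invmxK.
split=> //; last by rewrite EE.
apply/matrixP => i j; have e := GE Uz aN (delta_mx 0 i) (delta_mx 0 j).
rewrite mulmx_delta_tr -rowE mxE in e; rewrite e mxE; apply: eq_bigr => k _.
by rewrite EN /coframe_of /dual_frame -!rowE !mxE.
Qed.

End SmoothFrame.

End LocalCoframe.

(** * The curvature identity in structure constants *)

Section TorsionAlgebra.
Variable R : realType.
Implicit Types (t : nat -> nat -> nat -> R) (F : nat -> R) (a b c d e p i r : nat).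

(** Indices are natural numbers here, so that arrays applied to numerals compute and a
    component identity becomes an identity between polynomials. *)
Definition five F : R := F 0%N + F 1%N + F 2%N + F 3%N + F 4%N.

(** [d omega_r] for [omega_r = 1/2 \sum_pq M p q e^p /\ e^q] with constant coefficients
    [M] and [d e^p] given by [t p]. *)
Definition d_omega t r a b c : R :=
  five (fun p => model_form R r p c * t p a b - model_form R r p b * t p a c
                 + model_form R r p a * t p b c).

Definition koszul_of t c b d : R := 2^-1 * (t d c b - t b c d + t c d b).

(** Each entry is the value of [d omega_r] on the triple of horizontal vectors in which the
    product [nu_r /\ omega_r] involves one component of [nu_r] only;
    [nu_4] is read off from [d alpha] on the Reeb vector. *)
Definition nu_of t i a : R :=
  match i, a with
  | 0, 0 => d_omega t 0 0 2 3 | 0, 1 => d_omega t 0 1 2 3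
  | 0, 2 => d_omega t 0 0 1 2 | 0, 3 => d_omega t 0 0 1 3
  | 1, 0 => - d_omega t 1 0 1 3 | 1, 1 => - d_omega t 1 0 1 2
  | 1, 2 => d_omega t 1 1 2 3 | 1, 3 => d_omega t 1 0 2 3
  | 2, 0 => d_omega t 2 0 1 2 | 2, 1 => - d_omega t 2 0 1 3
  | 2, 2 => - d_omega t 2 0 2 3 | 2, 3 => d_omega t 2 1 2 3
  | 3, 4 => 0 | 3, _ => t 4%N 4%N a
  | _, _ => 0
  end.

(** The components of a two-form [x] along the model forms. *)
Definition model_part (x : nat -> nat -> R) j : R :=
  match j with
  | 0 => 2^-1 * (x 0%N 1%N + x 2%N 3%N)
  | 1 => 2^-1 * (x 0%N 2%N - x 1%N 3%N)
  | _ => 2^-1 * (x 0%N 3%N + x 1%N 2%N)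
  end.

(** The squared norm of the part of [x] orthogonal to the model forms, on horizontal
    vectors. *)
Definition primitive_norm (x : nat -> nat -> R) : R :=
  2^-1 * ((x 0%N 1%N - x 2%N 3%N) ^+ 2 + (x 0%N 2%N + x 1%N 3%N) ^+ 2 + (x 0%N 3%N - x 1%N 2%N) ^+ 2).

Definition f_of t r j : R := model_part (d_omega t r 4) j.

Definition phi_of t j : R := model_part (t 4%N) j.

Definition sigma_norm t i : R :=
  if i is 3 then primitive_norm (t 4%N) else primitive_norm (d_omega t i 4).

(** [dt e] stands for the derivative of the array [t] along the frame vector [e], here and
    below. *)
Definition d_star_nu (t : nat -> nat -> nat -> R) (dt : nat -> nat -> nat -> nat -> R) i : R :=
  - five (fun a => nu_of (dt a) i a + nu_of t i a * five (fun b => t b a b)).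

Definition dot_nu t i j : R := five (fun a => nu_of t i a * nu_of t j a).

Definition curvature_expr t (dt : nat -> nat -> nat -> nat -> R) : R :=
  five (fun a => five (fun d =>
    koszul_of (dt a) d a d - koszul_of (dt d) a a d
    + five (fun c => t c a d * koszul_of t c a d)
    + five (fun b => koszul_of t a a b * koszul_of t d b d
                     - koszul_of t d a b * koszul_of t a b d))).

Definition torsion_expr t (dt : nat -> nat -> nat -> nat -> R) : R :=
  - 5 * f_of t 0 0 ^+ 2
  - (phi_of t 0 ^+ 2 + phi_of t 1 ^+ 2 + phi_of t 2 ^+ 2)
  - 4 * phi_of t 0 * f_of t 1 2 + 4 * phi_of t 1 * f_of t 0 2
  - 4 * phi_of t 2 * f_of t 0 1
  + (d_star_nu t dt 0 + d_star_nu t dt 1 + d_star_nu t dt 2)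
  - 2 * d_star_nu t dt 3
  - 2^-1 * (dot_nu t 0 0 + dot_nu t 1 1 + dot_nu t 2 2)
  + dot_nu t 0 1 + dot_nu t 0 2 - dot_nu t 0 3
  + dot_nu t 1 2 - dot_nu t 1 3 - dot_nu t 2 3
  - 4 * f_of (dt 4%N) 0 0
  - 2^-1 * (sigma_norm t 0 + sigma_norm t 1 + sigma_norm t 2 + sigma_norm t 3).

(** Up to the sign, the component of [d (d e^d)] on the frame vectors [a], [b], [c]. *)
Definition jacobi_expr t (dt : nat -> nat -> nat -> nat -> R) d a b c : R :=
  dt a d b c + dt b d c a + dt c d a b
  + five (fun e => t e a b * t d e c + t e b c * t d e a + t e c a * t d e b).

Definition alternating t := forall a b c, t a c b = - t a b c.

(** The alternating array with given entries above the diagonal, in a form that computes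
    on numerals: rewriting with the alternating property in an identity with thousands of
    terms is avoided. *)
Definition alternate t a b c : R :=
  if Nat.ltb b c then t a b c else if Nat.ltb c b then - t a c b else 0.

Lemma alternateE t : alternating t -> alternate t = t.
Proof.
move=> ta; apply/funext => a; apply/funext => b; apply/funext => c.
rewrite /alternate; case: (PeanoNat.Nat.ltb_spec b c) => // cb.
case: (PeanoNat.Nat.ltb_spec c b) => [_|bc]; first by rewrite ta opprK.
have -> : b = c by apply: PeanoNat.Nat.le_antisymm.
by have /eqP := ta a c c; rewrite -addr_eq0 -mulr2n mulrn_eq0 /= => /eqP.
Qed.

Ltac expand_components :=
  cbv beta iota zeta delta [torsion_expr curvature_expr jacobi_expr d_star_nu dot_nu
    sigma_norm primitive_norm phi_of f_of model_part nu_of koszul_of d_omega five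
    model_form alternate Nat.ltb Nat.leb].

(** The correction is the coefficient of [e^1234] in the sum of [e^i /\ d (d e^i)] over
    the four horizontal indices. *)
Lemma torsion_curvature_alternate (u : nat -> nat -> nat -> R)
    (du : nat -> nat -> nat -> nat -> R) :
  let t := alternate u in let dt := fun e => alternate (du e) in
  curvature_expr t dt = torsion_expr t dt
    + jacobi_expr t dt 0 1 2 3 - jacobi_expr t dt 1 0 2 3
    + jacobi_expr t dt 2 0 1 3 - jacobi_expr t dt 3 0 1 2.
Proof.
by expand_components; field.
Qed.

Lemma torsion_curvature t (dt : nat -> nat -> nat -> nat -> R) :
  alternating t -> (forall e, alternating (dt e)) ->
  (forall d a b c, (d < 5)%N -> (a < 5)%N -> (b < 5)%N -> (c < 5)%N ->
    jacobi_expr t dt d a b c = 0) ->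
  curvature_expr t dt = torsion_expr t dt.
Proof.
move=> ta dta jac; have := torsion_curvature_alternate t dt.
have -> : (fun e => alternate (dt e)) = dt by apply/funext => e; exact: alternateE.
rewrite alternateE// => ->.
by rewrite !jac// !subr0 !addr0.
Qed.

End TorsionAlgebra.

(** * Structure functions from the structure equations *)

Section FrameTorsion.
Local Open Scope classical_set_scope.
Variables (R : realType).

Lemma is_formD n p (a b : pform R n p) : is_form a -> is_form b ->
  is_form (fun v => a v + b v).
Proof.
move=> fa fb; split=> [A B C i0 x y eA eB eC|A i1 i2 i12 e12].
  rewrite (form_multilinear fa eA eB eC) (form_multilinear fb eA eB eC).
  by move: (a B) (a C) (b B) (b C) => ? ? ? ?; ring.
by rewrite (form_alternating fa i12 e12) (form_alternating fb i12 e12) addr0.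
Qed.

Lemma is_formZ n p (c : R) (a : pform R n p) : is_form a ->
  is_form (fun v => c * a v).
Proof.
move=> fa; split=> [A B C i0 x y eA eB eC|A i1 i2 i12 e12].
  rewrite (form_multilinear fa eA eB eC).
  by move: (a B) (a C) => ? ?; ring.
by rewrite (form_alternating fa i12 e12) mulr0.
Qed.

Lemma is_form_sum n p m (c : 'I_m -> R) (a : 'I_m -> pform R n p) :
  (forall j, is_form (a j)) -> is_form (fun v => \sum_j c j * a j v).
Proof.
move=> fa; elim: m c a fa => [|m IH] c a fa.
  split=> [A B C i0 x y _ _ _|A i1 i2 _ _]; by rewrite !big_ord0 ?mulr0 ?addr0.
under eq_fun do rewrite big_ord_recl.
exact: (is_formD (is_formZ _ (fa ord0)) (IH _ _ (fun j => fa (lift ord0 j)))).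
Qed.

Local Notation e_ i := (delta_mx (0 : 'I_1) (i : 'I_5) : 'rV[R]_5).

Lemma derive_partial (f g : 'rV[R]_5 -> R) (v : 'rV[R]_5) z i :
  v = e_ i -> (forall x, f x = g x) -> 'D_v f z = partial i g z.
Proof. by move=> -> /funext ->. Qed.

Lemma form2_coord (a : pform R 5 2) (X Y : 'rV[R]_5) : is_form a ->
  a (vecs [:: X; Y]) = \sum_i \sum_j X 0 i * Y 0 j * a (vecs [:: e_ i; e_ j]).
Proof.
move=> fa; rewrite {1}[X]row_sum_delta {1}[Y]row_sum_delta form2_suml//.
apply: eq_bigr => i _; rewrite form2_sumr// mulr_sumr.
by apply: eq_bigr => j _; rewrite mulrA.
Qed.

Lemma form3_coord (a : pform R 5 3) (X Y Z : 'rV[R]_5) : is_form a ->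
  a (vecs [:: X; Y; Z]) = \sum_i \sum_j \sum_k X 0 i * Y 0 j * Z 0 k *
    a (vecs [:: e_ i; e_ j; e_ k]).
Proof.
move=> fa.
have c1 (X1 Y1 Z1 : 'rV[R]_5) : a (vecs [:: X1; Y1; Z1]) =
    \sum_i X1 0 i * a (vecs [:: e_ i; Y1; Z1]).
  apply: (form_row_sum fa (i0 := @Ordinal 3 0 isT)) => [|j].
    rewrite {1}[X1]row_sum_delta; apply/rowP => k; rewrite !mxE !summxE.
    by apply: eq_bigr => j _; rewrite !mxE.
  by apply/row'_eqP => -[[|[|[|//]]] h] k //; rewrite !mxE.
have c2 (X1 Y1 Z1 : 'rV[R]_5) : a (vecs [:: X1; Y1; Z1]) =
    \sum_i Y1 0 i * a (vecs [:: X1; e_ i; Z1]).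
  apply: (form_row_sum fa (i0 := @Ordinal 3 1 isT)) => [|j].
    rewrite {1}[Y1]row_sum_delta; apply/rowP => k; rewrite !mxE !summxE.
    by apply: eq_bigr => j _; rewrite !mxE.
  by apply/row'_eqP => -[[|[|[|//]]] h] k //; rewrite !mxE.
have c3 (X1 Y1 Z1 : 'rV[R]_5) : a (vecs [:: X1; Y1; Z1]) =
    \sum_i Z1 0 i * a (vecs [:: X1; Y1; e_ i]).
  apply: (form_row_sum fa (i0 := @Ordinal 3 2 isT)) => [|j].
    rewrite {1}[Z1]row_sum_delta; apply/rowP => k; rewrite !mxE !summxE.
    by apply: eq_bigr => j _; rewrite !mxE.
  by apply/row'_eqP => -[[|[|[|//]]] h] k //; rewrite !mxE.
rewrite c1; apply: eq_bigr => i _; rewrite c2 mulr_sumr; apply: eq_bigr => j _.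
rewrite c3 !mulr_sumr; apply: eq_bigr => k _; by rewrite !mulrA.
Qed.

Lemma exchange_big3 n (F : 'I_n -> 'I_n -> 'I_n -> 'I_n -> R) :
  \sum_i \sum_j \sum_k \sum_p F i j k p = \sum_p \sum_i \sum_j \sum_k F i j k p.
Proof.
under eq_bigr => i _ do under eq_bigr => j _ do rewrite exchange_big.
by under eq_bigr => i _ do rewrite exchange_big; rewrite exchange_big.
Qed.

(** The Leibniz rule for [omega_r = \sum_pq m p q C^p (x) C^q], on frame vectors: [P] stands
    for the derivative of [C]. *)
Lemma contract_bilinear n (m : 'I_n -> 'I_n -> R) (D C : 'I_n -> 'I_n -> R)
    (P : 'I_n -> 'I_n -> 'I_n -> R) a b c :
  \sum_i \sum_j \sum_k D a i * D b j * D c k *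
    (\sum_p \sum_q m p q * (P p i j * C q k + C p j * P q i k)) =
  \sum_p \sum_q m p q *
   ((\sum_i \sum_j D a i * D b j * P p i j) * (\sum_k D c k * C q k)
  + (\sum_i \sum_k D a i * D c k * P q i k) * (\sum_j D b j * C p j)).
Proof.
transitivity (\sum_i \sum_j \sum_k \sum_p \sum_q (D a i * D b j * D c k *
    (m p q * (P p i j * C q k + C p j * P q i k)))).
  apply: eq_bigr => i _; apply: eq_bigr => j _; apply: eq_bigr => k _.
  by rewrite mulr_sumr; apply: eq_bigr => p _; rewrite mulr_sumr.
rewrite exchange_big3; apply: eq_bigr => p _.
rewrite exchange_big3; apply: eq_bigr => q _.
rewrite mulrDr !mulr_suml !mulr_sumr -big_split; apply: eq_bigr => i _ /=.
transitivity (\sum_j (\sum_k m p q * (D a i * D b j * P p i j * (D c k * C q k))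
    + \sum_k m p q * (D a i * D c k * P q i k * (D b j * C p j)))).
  apply: eq_bigr => j _; rewrite -big_split; apply: eq_bigr => k _ /=; ring.
rewrite big_split; congr (_ + _).
  rewrite mulr_suml mulr_sumr; apply: eq_bigr => j _ /=.
  by rewrite !mulr_sumr.
rewrite exchange_big mulr_suml mulr_sumr; apply: eq_bigr => k _ /=.
by rewrite !mulr_sumr.
Qed.

Variables (U : set 'rV[R]_5) (E : 'rV[R]_5 -> 'M[R]_5).
Variables (al : 'rV[R]_5 -> pform R 5 1) (om : 'I_3 -> 'rV[R]_5 -> pform R 5 2).
Hypothesis oU : open U.
Hypothesis C2E : forall a j, C2_on U (fun z => E z a j).
Hypothesis uE : forall z, U z -> E z \in unitmx.
Hypothesis fal : forall z, U z -> is_form (al z).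
Hypothesis fom : forall r z, U z -> is_form (om r z).
Hypothesis aE : forall z, U z -> adapted_frame (al z) (om^~ z) (dual_frame (E z)).

Local Notation B z := (dual_frame (E z)).

Lemma coframe_of_dual_frame z c j : U z ->
  coframe_of (B z) c (e_ j) = E z c j.
Proof.
by move=> Uz; rewrite /coframe_of /dual_frame -trmx_inv invmxK -rowE !mxE.
Qed.

Lemma partial_alpha z i j : U z ->
  partial i (fun x => al x (e_ j)) z = dE E z (o5 5) i j.
Proof.
move=> Uz; apply: (partial_locally _ oU Uz) => x Ux.
by rewrite (adapted_al_expand _ (fal Ux) (aE Ux)) coframe_of_dual_frame.
Qed.

Lemma partial_omega r z i j k : U z ->
  partial i (fun x => om r x (vecs [:: e_ j; e_ k])) z =
  \sum_(p < 5) \sum_(q < 5) model_form R r p q *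
     (dE E z p i j * E z q k + E z p j * dE E z q i k).
Proof.
move=> Uz.
have -> : partial i (fun x => om r x (vecs [:: e_ j; e_ k])) z = partial i (fun x =>
    \sum_(p < 5) \sum_(q < 5) model_form R r p q * (E x p j * E x q k)) z.
  apply: (partial_locally _ oU Uz) => x Ux.
  rewrite (adapted_om_expand r _ _ (fal Ux) (fun s => fom s Ux) (aE Ux)).
  apply: eq_bigr => p _; apply: eq_bigr => q _.
  by rewrite !coframe_of_dual_frame// mulrA.
apply: partialE; apply: is_derive_bigsum => p _; apply: is_derive_bigsum => q _.
refine (is_derive_eq (is_derive_mul (is_derive_cst (model_form R r p q) z _)
  (is_derive_mul (is_derive_coframe C2E _ _ _ Uz) (is_derive_coframe C2E _ _ _ Uz))) _).
by rewrite mul0r add0r.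
Qed.

Lemma ext_d_alpha z i j : U z ->
  ext_d al z (vecs [:: e_ i; e_ j]) = dE E z (o5 5) i j - dE E z (o5 5) j i.
Proof.
move=> Uz; rewrite -!partial_alpha// /ext_d !big_ord_recl big_ord0 addr0 expr0 mul1r.
rewrite expr1 mulN1r; congr (_ - _); apply: derive_partial => [|x].
- by vecs_eq.
- by congr (al x _); vecs_eq.
- by vecs_eq.
- by congr (al x _); vecs_eq.
Qed.

Lemma ext_d_omega r z i j k : U z ->
  ext_d (om r) z (vecs [:: e_ i; e_ j; e_ k]) =
  partial i (fun x => om r x (vecs [:: e_ j; e_ k])) z
  - partial j (fun x => om r x (vecs [:: e_ i; e_ k])) z
  + partial k (fun x => om r x (vecs [:: e_ i; e_ j])) z.
Proof.
move=> Uz; rewrite /ext_d !big_ord_recl big_ord0 addr0 expr0 mul1r.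
rewrite expr1 mulN1r -signr_odd expr0 mul1r addrA.
congr (_ - _ + _); apply: derive_partial => [|x].
- by vecs_eq.
- by congr (om r x _); vecs_eq.
- by vecs_eq.
- by congr (om r x _); vecs_eq.
- by vecs_eq.
- by congr (om r x _); vecs_eq.
Qed.

Lemma structure_alpha z (A : pform R 5 2) a b : U z -> is_form A ->
  (forall v, ext_d al z v = A v) ->
  structure E z (o5 5) a b = A (vecs [:: row a (B z); row b (B z)]).
Proof.
move=> Uz fA dal; rewrite form2_coord// structureE /frame_dE /frame_components.
rewrite [X in _ - X]exchange_big -sumrB; apply: eq_bigr => i _ /=.
rewrite -sumrB; apply: eq_bigr => j _.
rewrite -dal ext_d_alpha// ![row _ _ 0 _]mxE.
by move: (dE _ _ _ _ _) (dE _ _ _ _ _) => x y; ring.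
Qed.

Lemma frame_partial_omega r z a b c : U z ->
  \sum_i \sum_j \sum_k B z a i * B z b j * B z c k *
    partial i (fun x => om r x (vecs [:: e_ j; e_ k])) z =
  \sum_(p < 5) (model_form R r p c * frame_dE E z p a b
              + model_form R r b p * frame_dE E z p a c).
Proof.
move=> Uz.
have rowE a' q : \sum_k B z a' k * E z q k = (a' == q)%:R := frame_row uE a' q Uz.
under eq_bigr do under eq_bigr do under eq_bigr do rewrite partial_omega//.
rewrite (contract_bilinear (fun p q : 'I_5 => model_form R r p q) (B z)
  (fun p k => E z p k) (dE E z)).
transitivity (\sum_(p < 5) \sum_(q < 5) (c == q)%:R * (model_form R r p q * frame_dE E z p a b)
  + \sum_(q < 5) \sum_(p < 5) (b == p)%:R * (model_form R r p q * frame_dE E z q a c)).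
  rewrite [X in _ + X]exchange_big -big_split; apply: eq_bigr => p _ /=.
  rewrite -big_split; apply: eq_bigr => q _ /=; rewrite !rowE.
  rewrite -/(frame_components (B z) (dE E z) p a b) -/(frame_components (B z) (dE E z) q a c).
  rewrite -/(frame_dE E z p a b) -/(frame_dE E z q a c).
  by move: (frame_dE _ _ _ _ _) (frame_dE _ _ _ _ _) => x y; ring.
rewrite -big_split; apply: eq_bigr => p _ /=; rewrite !sum_delta.
by [].
Qed.

Definition frame_structure z (a b c : nat) : R :=
  structure E z (inord a) (inord b) (inord c).

Lemma sum_five (F : 'I_5 -> R) : \sum_i F i = five (fun k => F (inord k)).
Proof. by rewrite sum5 /five; congr (F _ + F _ + F _ + F _ + F _); apply: val_inj;
  rewrite /= inordK. Qed.

Lemma five_sum (F : nat -> R) : five F = \sum_(p < 5) F p.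
Proof. by rewrite sum5. Qed.

(** The exterior derivative of the constant coefficient combination of [e^p /\ e^q]
    involves derivatives of the coframe only through the [d e^p]. *)
Lemma d_omega_structure r z (W : pform R 5 3) (a b c : 'I_5) : U z -> is_form W ->
  (forall v, ext_d (om r) z v = W v) ->
  d_omega (frame_structure z) r a b c =
  W (vecs [:: row a (B z); row b (B z); row c (B z)]).
Proof.
move=> Uz fW domr.
pose D i j k := partial i (fun x => om r x (vecs [:: e_ j; e_ k])) z.
have -> : W (vecs [:: row a (B z); row b (B z); row c (B z)]) =
   \sum_i \sum_j \sum_k B z a i * B z b j * B z c k * D i j k
   - \sum_i \sum_j \sum_k B z b i * B z a j * B z c k * D i j k
   + \sum_i \sum_j \sum_k B z c i * B z a j * B z b k * D i j k.
  have split3 (F1 F2 F3 : 'I_5 -> 'I_5 -> 'I_5 -> R) :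
      \sum_i \sum_j \sum_k (F1 i j k - F2 i j k + F3 i j k) =
      \sum_i \sum_j \sum_k F1 i j k - \sum_i \sum_j \sum_k F2 i j k
      + \sum_i \sum_j \sum_k F3 i j k.
    rewrite -sumrB -big_split; apply: eq_bigr => i _.
    rewrite -sumrB -big_split; apply: eq_bigr => j _.
    by rewrite -sumrB -big_split.
  transitivity (\sum_i \sum_j \sum_k (B z a i * B z b j * B z c k * D i j k
      - B z a i * B z b j * B z c k * D j i k + B z a i * B z b j * B z c k * D k i j)).
    rewrite form3_coord//; apply: eq_bigr => i _; apply: eq_bigr => j _.
    apply: eq_bigr => k _; rewrite -domr ext_d_omega// ![row _ _ 0 _]mxE.
    by rewrite -!/(D _ _ _) mulrDr mulrBr.
  rewrite split3; congr (_ - _ + _).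
    rewrite exchange_big; apply: eq_bigr => i _; apply: eq_bigr => j _.
    by apply: eq_bigr => k _; rewrite [B z a _ * _]mulrC.
  under eq_bigr => i _ do rewrite exchange_big.
  rewrite exchange_big; apply: eq_bigr => k _; apply: eq_bigr => i _.
  by apply: eq_bigr => j _; congr (_ * _); rewrite mulrC mulrA.
rewrite /D !frame_partial_omega// -sumrB -big_split /d_omega five_sum.
apply: eq_bigr => p _ /=.
have mC (i j : 'I_5) : model_form R r i j = - model_form R r j i.
  exact: model_form_anti.
rewrite /frame_structure !inord_val !structureE.
move: (frame_dE E z) => h; rewrite (mC b p) (mC a p); ring.
Qed.

Lemma adapted_reeb z : U z -> is_reeb (al z) (om^~ z) (row (o5 5) (B z)).
Proof.
move=> Uz; have [uB alB omB] := aE Uz; split; first by rewrite alB eqxx.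
move=> Y; rewrite /Defs.interior col_mx_vecs -[Y](mulmxKV uB) mulmx_sum_row.
rewrite form2_sumr; last exact: fom.
by rewrite big1// => k _; rewrite omB mulr0.
Qed.

Lemma horizontal1 z (a : pform R 5 1) : U z ->
  in_Lambda0 (al z) (om^~ z) a -> a (row (o5 5) (B z)) = 0.
Proof.
move=> Uz /(_ _ (adapted_reeb Uz) (0 : 'M[R]_(0, 5))); rewrite /Defs.interior.
move=> e; apply: etrans e; congr a; apply/matrixP => i j; rewrite (@col_mx1E _ _ 0).
by case: unliftP => [[]//|] ->.
Qed.

Lemma horizontal2 z (a : pform R 5 2) X : U z ->
  in_Lambda0 (al z) (om^~ z) a -> a (vecs [:: row (o5 5) (B z); X]) = 0.
Proof.
by move=> Uz /(_ _ (adapted_reeb Uz) X); rewrite /Defs.interior col_mx_vecs.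
Qed.

End FrameTorsion.

(** * Reading off the torsion from its components *)

Section TorsionComponents.
Variable R : realType.

Definition reeb_part (a : nat) : R := if a is 4%N then 1 else 0.

(** The components of [nu /\ omega_r + \sum_j f_j alpha /\ omega_j + alpha /\ sigma] in an
    adapted frame, where [reeb_part] gives those of [alpha]. *)
Definition torsion_part (r : nat) (N f : nat -> R) (S : nat -> nat -> R) a b c : R :=
  (N a * model_form R r b c - N b * model_form R r a c + N c * model_form R r a b)
  + (f 0%N * (reeb_part a * model_form R 0 b c - reeb_part b * model_form R 0 a c
         + reeb_part c * model_form R 0 a b)
   + f 1%N * (reeb_part a * model_form R 1 b c - reeb_part b * model_form R 1 a c
         + reeb_part c * model_form R 1 a b)
   + f 2%N * (reeb_part a * model_form R 2 b c - reeb_part b * model_form R 2 a c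
         + reeb_part c * model_form R 2 a b))
  + (reeb_part a * S b c - reeb_part b * S a c + reeb_part c * S a b).

(** The conditions that [S] is horizontal and orthogonal to the three model forms; in
    dimension 4 such two-forms are the anti-self-dual ones. *)
Record primitive_components (S : nat -> nat -> R) : Prop := PrimitiveComponents {
  primitive_anti : forall a b, S b a = - S a b;
  primitive_reeb : forall b, S 4%N b = 0;
  primitive1 : S 0%N 1%N + S 2%N 3%N = 0;
  primitive2 : S 0%N 2%N - S 1%N 3%N = 0;
  primitive3 : S 0%N 3%N + S 1%N 2%N = 0 }.

Definition component_norm (S : nat -> nat -> R) : R :=
  2^-1 * five (fun a => five (fun b => S a b * S a b)).

Lemma primitive_component_norm S : primitive_components S ->
  component_norm S = 2 * (S 0%N 1%N ^+ 2 + S 0%N 2%N ^+ 2 + S 0%N 3%N ^+ 2).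
Proof.
move=> [an s4 p1 p2 p3]; rewrite /component_norm /five.
have d a : S a a = 0 by have := an a a; lra.
have e23 : S 2%N 3%N = - S 0%N 1%N by lra.
have e13 : S 1%N 3%N = S 0%N 2%N by lra.
have e12 : S 1%N 2%N = - S 0%N 3%N by lra.
have s5 b : S b 4%N = 0 by rewrite an s4 oppr0.
rewrite !s4 !s5 !d (an 0%N 1%N) (an 0%N 2%N) (an 0%N 3%N) (an 1%N 2%N) (an 1%N 3%N).
by rewrite (an 2%N 3%N) e23 e13 e12; field.
Qed.

(** On horizontal triples only the [nu] term is present; on triples containing the Reeb
    vector it drops out because [nu] is horizontal, and what is left is the decomposition
    of a horizontal two-form into its components along the model forms and its
    anti-self-dual part. *)
Lemma omega_components t r N f S : (r < 3)%N -> N 4%N = 0 -> primitive_components S ->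
  (forall a b c, (a < 5)%N -> (b < 5)%N -> (c < 5)%N ->
    d_omega t r a b c = torsion_part r N f S a b c) ->
  [/\ forall a, (a < 5)%N -> N a = nu_of t r a,
      forall j, (j < 3)%N -> f j = f_of t r j &
      component_norm S = sigma_norm t r].
Proof.
move=> r3 N4 pS dom; rewrite primitive_component_norm//; case: pS => an s4 p1 p2 p3.
have e23 : S 2%N 3%N = - S 0%N 1%N by lra.
have e13 : S 1%N 3%N = S 0%N 2%N by lra.
have e12 : S 1%N 2%N = - S 0%N 3%N by lra.
split.
- move=> a a5.
  by case: r r3 dom => [|[|[|//]]] _ dom;
  case: a a5 => [|[|[|[|[|//]]]]] _; rewrite /= ?N4 ?dom// /torsion_part /=; ring.
- move=> j j3; rewrite /f_of /model_part.
  by case: r r3 dom => [|[|[|//]]] _ dom;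
  case: j j3 => [|[|[|//]]] _; rewrite !dom// /torsion_part /= !N4 ?e23 ?e13 ?e12; field.
- rewrite /sigma_norm /primitive_norm.
  by case: r r3 dom => [|[|[|//]]] _ dom;
  rewrite !dom// /torsion_part /= !N4 ?e23 ?e13 ?e12; field.
Qed.

Lemma alpha_components t N f S : N 4%N = 0 -> primitive_components S ->
  (forall a b, (a < 5)%N -> (b < 5)%N -> t 4%N a b =
     (reeb_part a * N b - reeb_part b * N a)
     + (f 0%N * model_form R 0 a b + f 1%N * model_form R 1 a b + f 2%N * model_form R 2 a b)
     + S a b) ->
  [/\ forall a, (a < 5)%N -> N a = nu_of t 3 a,
      forall j, (j < 3)%N -> f j = phi_of t j &
      component_norm S = sigma_norm t 3].
Proof.
move=> N4 pS dal; rewrite primitive_component_norm//; case: pS => an s4 p1 p2 p3.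
have e23 : S 2%N 3%N = - S 0%N 1%N by lra.
have e13 : S 1%N 3%N = S 0%N 2%N by lra.
have e12 : S 1%N 2%N = - S 0%N 3%N by lra.
split.
- by move=> a a5; case: a a5 => [|[|[|[|[|//]]]]] _; rewrite /= ?N4// dal//= s4; ring.
- move=> j j3; rewrite /phi_of /model_part.
  by case: j j3 => [|[|[|//]]] _; rewrite !dal//= ?e23 ?e13 ?e12; field.
- by rewrite /sigma_norm /primitive_norm !dal//= ?e23 ?e13 ?e12; field.
Qed.

End TorsionComponents.

(** * Torsion forms in an adapted frame *)

Section TorsionInFrame.
Local Open Scope classical_set_scope.
Variables (R : realType) (U : set 'rV[R]_5) (E : 'rV[R]_5 -> 'M[R]_5).
Variables (al : 'rV[R]_5 -> pform R 5 1) (om : 'I_3 -> 'rV[R]_5 -> pform R 5 2).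
Variables (f : 'I_3 -> 'I_3 -> 'rV[R]_5 -> R) (phi : 'I_3 -> 'rV[R]_5 -> R).
Variables (nu : 'I_4 -> 'rV[R]_5 -> pform R 5 1) (sg : 'I_4 -> 'rV[R]_5 -> pform R 5 2).
Hypothesis oU : open U.
Hypothesis C2E : forall a j, C2_on U (fun z => E z a j).
Hypothesis uE : forall z, U z -> E z \in unitmx.
Hypothesis fal : forall z, U z -> is_form (al z).
Hypothesis fom : forall r z, U z -> is_form (om r z).
Hypothesis aE : forall z, U z -> adapted_frame (al z) (om^~ z) (dual_frame (E z)).
Hypothesis fnu : forall i z, U z -> is_form (nu i z).
Hypothesis fsg : forall i z, U z -> is_form (sg i z).
Hypothesis nu0 : forall i z, U z -> in_Lambda0 (al z) (om^~ z) (nu i z).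
Hypothesis sg3 : forall i z, U z -> in_Lambda23 (al z) (om^~ z) (sg i z).
Hypothesis dom : forall r z, U z -> forall v, ext_d (om r) z v =
  wedge (nu (w34 r) z) (om r z) v
  + \sum_(j < 3) f r j z * wedge (al z) (om j z) v
  + wedge (al z) (sg (w34 r) z) v.
Hypothesis dal : forall z, U z -> forall v, ext_d al z v =
  wedge (al z) (nu (o4 4) z) v + \sum_(i < 3) phi i z * om i z v + sg (o4 4) z v.

Local Notation B z := (dual_frame (E z)).

Lemma forall4 (P : 'I_4 -> Prop) : (forall r, P (w34 r)) -> P (o4 4) -> forall i, P i.
Proof.
move=> P3 P4 i; case: (ltnP i 3) => [i3|i3].
  by have -> : i = w34 (Ordinal i3) by exact: val_inj.
have -> // : i = o4 4; apply: val_inj => /=.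
by apply/eqP; rewrite eqn_leq -ltnS ltn_ord.
Qed.

Definition nu_row i z (k : nat) : R := nu i z (row (inord k) (B z)).

Definition sg_rows i z (k l : nat) : R :=
  sg i z (vecs [:: row (inord k) (B z); row (inord l) (B z)]).

Lemma inord5 (k : 'I_5) : inord k = k :> 'I_5. Proof. exact: inord_val. Qed.

Lemma al_row z a : U z -> (a < 5)%N -> al z (row (inord a) (B z)) = reeb_part R a.
Proof.
move=> Uz a5; have [_ alB _] := aE Uz; rewrite alB -val_eqE /= inordK//.
by case: a a5 => [|[|[|[|[|//]]]]].
Qed.

Lemma om_rows z (r : 'I_3) a b : U z -> (a < 5)%N -> (b < 5)%N ->
  om r z (vecs [:: row (inord a) (B z); row (inord b) (B z)]) = model_form R r a b.
Proof. by move=> Uz a5 b5; have [_ _ omB] := aE Uz; rewrite omB !inordK. Qed.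

Lemma nu_reeb i z : U z -> nu_row i z 4 = 0.
Proof.
move=> Uz; rewrite /nu_row -[4%N]/(val (o5 5)) inord5.
exact: (horizontal1 fom aE Uz (nu0 i Uz)).
Qed.

(** The three orthogonality relations are the values of [sigma /\ omega_r] on the
    horizontal vectors. *)
Lemma sg_primitive i z : U z -> primitive_components (sg_rows i z).
Proof.
move=> Uz; have fs := fsg i Uz; have [s0 sw] := sg3 i Uz; split.
- by move=> a b; exact: form2_anti.
- move=> b; rewrite /sg_rows -[4%N]/(val (o5 5)) inord5.
  exact: (horizontal2 fom aE _ Uz s0).
all: pose w r := sw r (vecs [:: row (inord 0) (B z); row (inord 1) (B z);
       row (inord 2) (B z); row (inord 3) (B z)]).
- have := w (o3 1); rewrite wedge22//; last exact: fom.
  by rewrite !om_rows//= /sg_rows; lra.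
- have := w (o3 2); rewrite wedge22//; last exact: fom.
  by rewrite !om_rows//= /sg_rows; lra.
- have := w (o3 3); rewrite wedge22//; last exact: fom.
  by rewrite !om_rows//= /sg_rows; lra.
Qed.

Lemma sum3 (F : 'I_3 -> R) : \sum_(j < 3) F j = F (o3 1) + F (o3 2) + F (o3 3).
Proof.
rewrite !big_ord_recl big_ord0 addr0 !addrA.
by congr (F _ + F _ + F _); apply: val_inj.
Qed.

Lemma torsion_rows z (r : 'I_3) : U z ->
  [/\ forall a, (a < 5)%N -> nu_row (w34 r) z a = nu_of (frame_structure E z) r a,
      forall j, (j < 3)%N -> f r (inord j) z = f_of (frame_structure E z) r j &
      component_norm (sg_rows (w34 r) z) = sigma_norm (frame_structure E z) r].
Proof.
move=> Uz; apply: (@omega_components R _ r (nu_row (w34 r) z) (fun j => f r (inord j) z)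
  (sg_rows (w34 r) z)) => //.
- exact: nu_reeb.
- exact: sg_primitive.
move=> a b c a5 b5 c5.
have fW : is_form (fun v : 'M[R]_(3, 5) => wedge (nu (w34 r) z) (om r z) v
  + \sum_(j < 3) f r j z * wedge (al z) (om j z) v + wedge (al z) (sg (w34 r) z) v).
  exact: (is_formD (is_formD (wedge_is_form (fnu _ Uz) (fom r Uz))
    (is_form_sum (f r ^~ z) (fun j => wedge_is_form (fal Uz) (fom j Uz))))
    (wedge_is_form (fal Uz) (fsg _ Uz))).
have := d_omega_structure oU C2E uE fal fom aE (inord a) (inord b) (inord c) Uz fW (dom r Uz).
rewrite !inordK// => ->.
rewrite sum3 !wedge12; try exact: fsg; try exact: fom.
rewrite !om_rows// !al_row// /torsion_part /nu_row /sg_rows.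
have e1 : inord 0 = o3 1 by apply: val_inj; rewrite /= inordK.
have e2 : inord 1 = o3 2 by apply: val_inj; rewrite /= inordK.
have e3 : inord 2 = o3 3 by apply: val_inj; rewrite /= inordK.
by rewrite e1 e2 e3.
Qed.

Lemma torsion_rows4 z : U z ->
  [/\ forall a, (a < 5)%N -> nu_row (o4 4) z a = nu_of (frame_structure E z) 3 a,
      forall j, (j < 3)%N -> phi (inord j) z = phi_of (frame_structure E z) j &
      component_norm (sg_rows (o4 4) z) = sigma_norm (frame_structure E z) 3].
Proof.
move=> Uz; apply: (@alpha_components R _ (nu_row (o4 4) z) (fun j => phi (inord j) z)
  (sg_rows (o4 4) z)) => //.
- exact: nu_reeb.
- exact: sg_primitive.
move=> a b a5 b5.
have fA : is_form (fun v : 'M[R]_(2, 5) => wedge (al z) (nu (o4 4) z) v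
    + \sum_(i < 3) phi i z * om i z v + sg (o4 4) z v).
  exact: (is_formD (is_formD (wedge_is_form (fal Uz) (fnu _ Uz))
    (is_form_sum (phi^~ z) (fun j => fom j Uz))) (fsg _ Uz)).
have := structure_alpha oU fal aE (inord a) (inord b) Uz fA (dal Uz).
have e5 : inord 4 = o5 5 by apply: val_inj; rewrite /= inordK.
rewrite /frame_structure e5 => ->.
rewrite sum3 !wedge11; try exact: fnu.
rewrite !om_rows// !al_row// /nu_row /sg_rows.
have e1 : inord 0 = o3 1 by apply: val_inj; rewrite /= inordK.
have e2 : inord 1 = o3 2 by apply: val_inj; rewrite /= inordK.
have e3 : inord 2 = o3 3 by apply: val_inj; rewrite /= inordK.
by rewrite e1 e2 e3.
Qed.

Lemma nu_components i z (a : 'I_5) : U z ->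
  nu i z (row a (B z)) = nu_of (frame_structure E z) i a.
Proof.
move=> Uz; rewrite -[in LHS](inord5 a) -/(nu_row i z a).
move: i; apply: forall4 => [r|].
- by have [H _ _] := torsion_rows r Uz; exact: H.
- by have [H _ _] := torsion_rows4 Uz; exact: H.
Qed.

Lemma f_components z (r j : 'I_3) : U z -> f r j z = f_of (frame_structure E z) r j.
Proof.
by move=> Uz; have [_ H _] := torsion_rows r Uz; rewrite -H// inord_val.
Qed.

Lemma phi_components z (j : 'I_3) : U z -> phi j z = phi_of (frame_structure E z) j.
Proof.
by move=> Uz; have [_ H _] := torsion_rows4 Uz; rewrite -H// inord_val.
Qed.

Lemma sigma_components i z : U z ->
  form_dot (frame_gram E z) (sg i z) (sg i z) = sigma_norm (frame_structure E z) i.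
Proof.
move=> Uz; rewrite form_dot2; [|exact: uE|exact: fsg|exact: fsg].
rewrite sum_five; under eq_fun do rewrite sum_five.
rewrite -/(component_norm (sg_rows i z)).
move: i; apply: forall4 => [r|].
- by have [_ _ H] := torsion_rows r Uz.
- by have [_ _ H] := torsion_rows4 Uz.
Qed.

Lemma nu_dot_components i j z : U z ->
  form_dot (frame_gram E z) (nu i z) (nu j z) = dot_nu (frame_structure E z) i j.
Proof.
move=> Uz; rewrite form_dot1; [|exact: uE|exact: fnu|exact: fnu].
by rewrite /dot_nu five_sum; apply: eq_bigr => a _; rewrite !nu_components.
Qed.

End TorsionInFrame.

(** * Derivatives of quantities linear in the structure functions *)

Section FrameDerivatives.
Local Open Scope classical_set_scope.
Variable R : realType.

(** A fixed linear combination of the entries of an array.  The torsion forms and the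
    connection have this shape in the structure functions, so that their derivatives
    are the same combinations of the derivatives of the structure functions. *)
Definition linear_in (L : (nat -> nat -> nat -> R) -> R) : Prop :=
  exists s : seq (R * (nat * nat * nat)),
    forall t, L t = \sum_(q <- s) q.1 * t q.2.1.1 q.2.1.2 q.2.2.

Lemma linear_in_entry p b c : linear_in (fun t => t p b c).
Proof. by exists [:: (1, (p, b, c))] => t; rewrite big_seq1 mul1r. Qed.

Lemma linear_in0 : linear_in (fun=> 0).
Proof. by exists [::] => t; rewrite big_nil. Qed.

Lemma linear_inD L1 L2 : linear_in L1 -> linear_in L2 ->
  linear_in (fun t => L1 t + L2 t).
Proof. by move=> [s1 e1] [s2 e2]; exists (s1 ++ s2) => t; rewrite big_cat -e1 -e2. Qed.

Lemma linear_inZ k L : linear_in L -> linear_in (fun t => k * L t).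
Proof.
move=> [s e]; exists [seq (k * q.1, q.2) | q <- s] => t; rewrite big_map e mulr_sumr.
by apply: eq_bigr => q _; rewrite mulrA.
Qed.

Lemma linear_inN L : linear_in L -> linear_in (fun t => - L t).
Proof. by move=> /(linear_inZ (-1)); under eq_fun do rewrite mulN1r. Qed.

Lemma linear_in_d_omega r a b c : linear_in (fun t => d_omega t r a b c).
Proof.
have e p x y : linear_in (fun t => t p x y) := linear_in_entry p x y.
have h p : linear_in (fun t => model_form R r p c * t p a b - model_form R r p b * t p a c
                 + model_form R r p a * t p b c).
  exact: (linear_inD (linear_inD (linear_inZ _ (e _ _ _))
    (linear_inN (linear_inZ _ (e _ _ _)))) (linear_inZ _ (e _ _ _))).
exact: (linear_inD (linear_inD (linear_inD (linear_inD (h _) (h _)) (h _)) (h _)) (h _)).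
Qed.

Lemma linear_in_koszul c b d : linear_in (fun t => koszul_of t c b d).
Proof.
exact: (linear_inZ _ (linear_inD (linear_inD (linear_in_entry _ _ _)
  (linear_inN (linear_in_entry _ _ _))) (linear_in_entry _ _ _))).
Qed.

Lemma linear_in_f r j : linear_in (fun t => f_of t r j).
Proof.
have e a b c := linear_in_d_omega r a b c.
rewrite /f_of /model_part; case: j => [|[|j]].
- exact: (linear_inZ _ (linear_inD (e _ _ _) (e _ _ _))).
- exact: (linear_inZ _ (linear_inD (e _ _ _) (linear_inN (e _ _ _)))).
- exact: (linear_inZ _ (linear_inD (e _ _ _) (e _ _ _))).
Qed.

Lemma linear_in_nu i a : linear_in (fun t => nu_of t i a).
Proof.
have e r x b c := linear_in_d_omega r x b c.
have n r x b c := linear_inN (e r x b c).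
case: i => [|[|[|[|i]]]]; case: a => [|[|[|[|[|a]]]]]; rewrite /nu_of;
  solve [exact: e | exact: n | exact: linear_in0 | exact: linear_in_entry].
Qed.

Variables (U : set 'rV[R]_5) (E : 'rV[R]_5 -> 'M[R]_5).
Hypothesis oU : open U.
Hypothesis C2E : forall a j, C2_on U (fun z => E z a j).
Hypothesis uE : forall z, U z -> E z \in unitmx.

Local Notation e_ i := (delta_mx (0 : 'I_1) (i : 'I_5) : 'rV[R]_5).
Local Notation B z := (dual_frame (E z)).

Definition d_frame_structure z (e p b c : nat) : R :=
  frame_derive E (inord e) (fun x => frame_structure E x p b c) z.

Lemma is_derive_linear L z j : linear_in L -> U z ->
  is_derive z (e_ j) (fun x => L (frame_structure E x))
    (L (fun p b c => partial j (fun x => frame_structure E x p b c) z)).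
Proof.
move=> [s e] Uz; under eq_fun do rewrite e; rewrite e.
have h p b c : is_derive z (e_ j) (fun x => frame_structure E x p b c)
    (partial j (fun x => frame_structure E x p b c) z).
  have [D _] := is_derive_structure oU C2E uE j (inord p) (inord b) (inord c) Uz.
  exact: (DeriveDef D erefl).
exact: is_derive_bigsum.
Qed.

Lemma derivable_linear L z j : linear_in L -> U z ->
  derivable (fun x => L (frame_structure E x)) z (e_ j).
Proof. by move=> lL Uz; have [D _] := is_derive_linear j lL Uz; exact: D. Qed.

Lemma frame_derive_linear L z e : linear_in L -> U z ->
  frame_derive E (inord e) (fun x => L (frame_structure E x)) z = L (d_frame_structure z e).
Proof.
move=> lL Uz; have [s eL] := lL.
rewrite /frame_derive eL.
transitivity (\sum_i B z (inord e) i *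
    L (fun p b c => partial i (fun x => frame_structure E x p b c) z)).
  by apply: eq_bigr => i _; congr (_ * _); apply: partialE; exact: is_derive_linear.
under eq_bigr do rewrite eL mulr_sumr.
rewrite exchange_big; apply: eq_bigr => q _; rewrite /d_frame_structure /frame_derive mulr_sumr.
by apply: eq_bigr => i _; rewrite mulrCA.
Qed.

Lemma frame_derive_locally a (f g : 'rV[R]_5 -> R) z : U z ->
  (forall x, U x -> f x = g x) -> frame_derive E a f z = frame_derive E a g z.
Proof.
move=> Uz fg; apply: eq_bigr => i _; congr (_ * _); exact: (partial_locally _ oU Uz fg).
Qed.

Lemma derivable_locally (f g : 'rV[R]_5 -> R) z v : U z ->
  (forall x, U x -> f x = g x) -> derivable f z v -> derivable g z v.
Proof.
move=> Uz fg Df.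
by have [] := is_derive_locally oU Uz fg (DeriveDef Df erefl).
Qed.

Lemma frame_structure_alternating z : alternating (frame_structure E z).
Proof. by move=> a b c; exact: structure_anti. Qed.

Lemma frame_deriveN a (f : 'rV[R]_5 -> R) z : (forall j, derivable f z (e_ j)) ->
  frame_derive E a (fun x => - f x) z = - frame_derive E a f z.
Proof.
move=> Df; rewrite /frame_derive -sumrN; apply: eq_bigr => i _; rewrite -mulrN.
congr (_ * _); exact: (partialE (is_derive_opp (DeriveDef (Df i) erefl))).
Qed.

Lemma d_frame_structure_alternating z e : U z -> alternating (d_frame_structure z e).
Proof.
move=> Uz a b c; rewrite /d_frame_structure -frame_deriveN.
  by congr frame_derive; apply/funext => x; exact: structure_anti.
move=> j; exact: (derivable_linear (linear_in_entry a b c) Uz).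
Qed.

Lemma frame_jacobi z d a b c : U z ->
  jacobi_expr (frame_structure E z) (d_frame_structure z) d a b c = 0.
Proof.
move=> Uz; have J := jacobi oU C2E uE (inord d) (inord a) (inord b) (inord c) Uz.
rewrite sum_five in J.
rewrite /jacobi_expr; apply/eqP; rewrite addr_eq0; apply/eqP; exact: J.
Qed.

Lemma connection_koszul z c b d :
  connection E z c b d = koszul_of (frame_structure E z) c b d.
Proof. by rewrite /koszul_of /frame_structure !inord_val. Qed.

Lemma frame_derive_connection z (e c b d : 'I_5) : U z ->
  frame_derive E e (fun x => connection E x c b d) z
  = koszul_of (d_frame_structure z e) c b d.
Proof.
move=> Uz; rewrite -(frame_derive_linear _ (linear_in_koszul c b d) Uz) inord_val.
exact: (frame_derive_locally e Uz (fun x _ => connection_koszul x c b d)).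
Qed.

Lemma scalar_curvature_frame_structure z : U z ->
  scalar_curvature (frame_gram E) z =
  curvature_expr (frame_structure E z) (d_frame_structure z).
Proof.
move=> Uz; rewrite (scalar_curvature_connection oU C2E uE Uz) /curvature_expr.
rewrite five_sum; apply: eq_bigr => a _; rewrite five_sum; apply: eq_bigr => d _.
rewrite !frame_derive_connection// !five_sum; congr (_ - _ + _ + _).
  by apply: eq_bigr => c _; rewrite connection_koszul /frame_structure !inord_val.
by apply: eq_bigr => b _; rewrite !connection_koszul.
Qed.

Lemma scalar_curvature_locally (G1 G2 : 'rV[R]_5 -> 'M[R]_5) z : U z ->
  (forall x, U x -> G1 x = G2 x) -> scalar_curvature G1 z = scalar_curvature G2 z.
Proof.
move=> Uz G12.
have chr k i j x : U x -> christoffel G1 k i j x = christoffel G2 k i j x.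
  move=> Ux; rewrite /christoffel G12//; congr (_ * _); apply: eq_bigr => l _.
  have pG m p q : partial m (fun y => G1 y p q) x = partial m (fun y => G2 y p q) x.
    by apply: (partial_locally _ oU Ux) => y Uy; rewrite G12.
  by rewrite !pG.
rewrite /scalar_curvature G12//; apply: eq_bigr => j _; apply: eq_bigr => k _.
congr (_ * _); apply: eq_bigr => i _; rewrite /riemann.
have pc m p q r : partial m (christoffel G1 p q r) z = partial m (christoffel G2 p q r) z.
  by apply: (partial_locally _ oU Uz) => y Uy; exact: chr.
rewrite !pc; congr (_ + _); apply: eq_bigr => m _.
by rewrite !chr.
Qed.

End FrameDerivatives.

(** * The scalar curvature of an adapted coframe *)

Section CurvatureInFrame.
Local Open Scope classical_set_scope.
Variables (R : realType) (U : set 'rV[R]_5) (E : 'rV[R]_5 -> 'M[R]_5).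
Variables (al : 'rV[R]_5 -> pform R 5 1) (om : 'I_3 -> 'rV[R]_5 -> pform R 5 2).
Variables (f : 'I_3 -> 'I_3 -> 'rV[R]_5 -> R) (phi : 'I_3 -> 'rV[R]_5 -> R).
Variables (nu : 'I_4 -> 'rV[R]_5 -> pform R 5 1) (sg : 'I_4 -> 'rV[R]_5 -> pform R 5 2).
Hypothesis oU : open U.
Hypothesis C2E : forall a j, C2_on U (fun z => E z a j).
Hypothesis uE : forall z, U z -> E z \in unitmx.
Hypothesis fal : forall z, U z -> is_form (al z).
Hypothesis fom : forall r z, U z -> is_form (om r z).
Hypothesis aE : forall z, U z -> adapted_frame (al z) (om^~ z) (dual_frame (E z)).
Hypothesis fnu : forall i z, U z -> is_form (nu i z).
Hypothesis fsg : forall i z, U z -> is_form (sg i z).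
Hypothesis nu0 : forall i z, U z -> in_Lambda0 (al z) (om^~ z) (nu i z).
Hypothesis sg3 : forall i z, U z -> in_Lambda23 (al z) (om^~ z) (sg i z).
Hypothesis dom : forall r z, U z -> forall v, ext_d (om r) z v =
  wedge (nu (w34 r) z) (om r z) v
  + \sum_(j < 3) f r j z * wedge (al z) (om j z) v
  + wedge (al z) (sg (w34 r) z) v.
Hypothesis dal : forall z, U z -> forall v, ext_d al z v =
  wedge (al z) (nu (o4 4) z) v + \sum_(i < 3) phi i z * om i z v + sg (o4 4) z v.

Local Notation B z := (dual_frame (E z)).

Variables (G : 'rV[R]_5 -> 'M[R]_5) (vol : 'rV[R]_5 -> pform R 5 5).
Hypothesis GE : forall z, U z -> G z = frame_gram E z.
Hypothesis volE : forall z, U z -> vol z = (fun v => \det (E z) * \det v).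

Lemma nu_codiff i z : U z ->
  codiff1 G vol (nu i) z = d_star_nu (frame_structure E z) (d_frame_structure E z) i.
Proof.
move=> Uz.
have nuE (a : 'I_5) x : U x -> nu_of (frame_structure E x) i a = nu i x (row a (B x)) :=
  fun Ux => esym (nu_components oU C2E uE fal fom aE fnu fsg nu0 sg3 dom dal i a Ux).
have D (a j : 'I_5) : derivable (fun x => nu i x (row a (B x))) z (delta_mx 0 j).
  refine (@derivable_locally R U oU _ _ z _ Uz (nuE a) _).
  refine (@derivable_linear R U E oU C2E uE (fun t => nu_of t i a) z j _ Uz).
  exact: linear_in_nu.
rewrite (codiff1_frame oU C2E uE GE volE (fnu i) Uz D) /d_star_nu; congr (- _).
rewrite five_sum; apply: eq_bigr => a _; congr (_ + _ * _).
- rewrite -(frame_derive_locally E oU a Uz (nuE a)).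
  by have := frame_derive_linear oU C2E uE a (linear_in_nu R i a) Uz; rewrite inord_val.
- by rewrite nuE.
- by rewrite five_sum; apply: eq_bigr => b _; rewrite /frame_structure !inord_val.
Qed.

(** Agrees with the exterior derivative of [h] on basis vectors, but is linear by
    construction. *)
Definition differential (h : 'rV[R]_5 -> R) z : pform R 5 1 :=
  fun v => \sum_i v 0 i * partial i h z.

Lemma is_form_differential h z : is_form (differential h z).
Proof.
split=> [A B' C i0 b c eA _ _|A i1 i2]; last by rewrite !ord1 eqxx.
have {}eA : A = b *: B' + c *: C.
  by apply/rowP => j; move/rowP: eA => /(_ j); rewrite !mxE ord1.
rewrite /differential eA !mulr_sumr -big_split; apply: eq_bigr => i _ /=.
by rewrite !mxE mulrDl !mulrA.
Qed.

Lemma ext_d_fun_basis h z k :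
  ext_d (form_of_fun h) z (delta_mx 0 k) = differential h z (delta_mx 0 k).
Proof.
rewrite /ext_d big_ord1 expr0 mul1r /differential (bigD1 k)//= big1 => [|i ik].
  rewrite addr0 mxE !eqxx mul1r /partial; congr ('D_ _ _ _).
  by apply/rowP => j; rewrite !mxE ord1.
by rewrite mxE (negbTE ik) andbF mul0r.
Qed.

(** [omega_1^2] vanishes on the Reeb vector and is 2 on the horizontal vectors of the
    frame, so only the Reeb derivative of [h] contributes. *)
Lemma star_differential_volume h z w : U z ->
  @star R 5 5 0 (G z) (vol z) (wedge (ext_d (form_of_fun h) z)
    (wedge (om (o3 1) z) (om (o3 1) z))) w = 2 * frame_derive E (o5 5) h z.
Proof.
move=> Uz; rewrite GE// volE//; set W := wedge (om _ z) _.
have fW : is_form W := wedge_is_form (fom (o3 1) Uz) (fom (o3 1) Uz).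
have fd := is_form_differential h z.
rewrite (star_top_basis (b' := wedge (differential h z) W) w (uE Uz) (wedge_is_form fd fW)).
  have -> : B z = vecs [:: row (o5 1) (B z); row (o5 2) (B z); row (o5 3) (B z);
      row (o5 4) (B z); row (o5 5) (B z)].
    by apply/row_matrixP; apply: forall5; apply/rowP => j; rewrite !mxE.
  have [_ _ omB] := aE Uz.
  have -> : frame_derive E (o5 5) h z = differential h z (row (o5 5) (B z)).
    by apply: eq_bigr => i _; rewrite [row _ _ 0 i]mxE.
  move: (differential h z) fd => dh fd.
  rewrite wedge14// /W !wedge22; try exact: fom.
  rewrite !omB /=; ring.
move=> I; rewrite !wedge1l//; apply: eq_bigr => k _; congr (_ * _ * _).
by rewrite row_basis_vectors ext_d_fun_basis.
Qed.

Lemma sum4 (F : 'I_4 -> R) :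
  \sum_(i < 4) F i = F (o4 1) + F (o4 2) + F (o4 3) + F (o4 4).
Proof.
rewrite !big_ord_recl big_ord0 addr0 !addrA.
by congr (F _ + F _ + F _ + F _); apply: val_inj.
Qed.

(** The formula for the forms in one coordinate domain, given an adapted coframe there. *)
Lemma scalar_curvature_torsion z : U z ->
  let dot1 i j := form_dot (G z) (nu i z) (nu j z) in
  let dstar_nu i := codiff1 G vol (nu i) z in
  scalar_curvature G z =
    - 5 * f (o3 1) (o3 1) z ^+ 2
    - \sum_(i < 3) phi i z ^+ 2
    - 4 * phi (o3 1) z * f (o3 2) (o3 3) z
    + 4 * phi (o3 2) z * f (o3 1) (o3 3) z
    - 4 * phi (o3 3) z * f (o3 1) (o3 2) z
    + \sum_(i < 3) dstar_nu (w34 i)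
    - 2 * dstar_nu (o4 4)
    - 2^-1 * \sum_(i < 3) dot1 (w34 i) (w34 i)
    + dot1 (o4 1) (o4 2) + dot1 (o4 1) (o4 3) - dot1 (o4 1) (o4 4)
    + dot1 (o4 2) (o4 3) - dot1 (o4 2) (o4 4) - dot1 (o4 3) (o4 4)
    - 2 * @star R 5 5 0 (G z) (vol z)
            (wedge (ext_d (form_of_fun (f (o3 1) (o3 1))) z)
                   (wedge (om (o3 1) z) (om (o3 1) z))) 0
    - 2^-1 * \sum_(i < 4) form_dot (G z) (sg i z) (sg i z).
Proof.
move=> Uz dot1 dstar_nu; rewrite (scalar_curvature_locally oU Uz GE).
rewrite (scalar_curvature_frame_structure oU C2E uE Uz).
rewrite (torsion_curvature (frame_structure_alternating E z)
  (fun e => d_frame_structure_alternating oU C2E uE e Uz)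
  (fun d a b c _ _ _ _ => frame_jacobi oU C2E uE d a b c Uz)).
have fE r j x : U x -> f r j x = f_of (frame_structure E x) r j.
  by move=> Ux; rewrite -(f_components oU C2E uE fal fom aE fnu fsg nu0 sg3 dom r j Ux).
have phiE j : phi j z = phi_of (frame_structure E z) j.
  exact: (phi_components oU fal fom aE fnu fsg nu0 sg3 dal j Uz).
have dotE i j : dot1 i j = dot_nu (frame_structure E z) i j.
  rewrite /dot1 GE//.
  exact: (nu_dot_components oU C2E uE fal fom aE fnu fsg nu0 sg3 dom dal).
have sgE i : form_dot (G z) (sg i z) (sg i z) = sigma_norm (frame_structure E z) i.
  rewrite GE//.
  exact: (sigma_components oU C2E uE fal fom aE fnu fsg nu0 sg3 dom dal).
have df : frame_derive E (o5 5) (f (o3 1) (o3 1)) z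
    = f_of (d_frame_structure E z 4) 0 0.
  rewrite (frame_derive_locally E oU _ Uz (fE (o3 1) (o3 1))).
  by have := frame_derive_linear oU C2E uE (o5 5) (linear_in_f R 0 0) Uz; rewrite inord_val.
rewrite (star_differential_volume _ _ Uz) df !sum3 sum4 !fE// !phiE !dotE !sgE.
rewrite /dstar_nu !(nu_codiff _ Uz) /torsion_expr.
move: (d_star_nu _ _) (dot_nu _) (sigma_norm _) (phi_of _) => dn dt sn ph.
move: (f_of (frame_structure E z)) (f_of (d_frame_structure E z 4)) => fc dfc /=; ring.
Qed.

End CurvatureInFrame.

(** * The theorem on a manifold *)

Theorem theorem3p4 (R : realType) (M : manifold R 5)
    (alpha : field_of_forms M 1) (omega : 'I_3 -> field_of_forms M 2)
    (f : 'I_3 -> 'I_3 -> M -> R) (phi : 'I_3 -> M -> R)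
    (nu : 'I_4 -> field_of_forms M 1) (sigma : 'I_4 -> field_of_forms M 2)
    (g : chart M -> 'rV[R]_5 -> 'M[R]_5) :
  su2_structure alpha omega ->
  torsion_forms alpha omega f phi nu sigma ->
  induced_metric alpha omega g ->
  forall (c : chart M) (y : 'rV[R]_5), cim c y ->
  let x : M := cinv c y in
  let vol := su2_volume alpha omega g c in
  let dot1 (i j : 'I_4) := form_dot (g c y) (nu i c y) (nu j c y) in
  let dstar_nu (i : 'I_4) := codiff1 (g c) vol (nu i c) y in
  scalar_curvature (g c) y =
    - 5 * f (o3 1) (o3 1) x ^+ 2
    - \sum_(i < 3) phi i x ^+ 2
    - 4 * phi (o3 1) x * f (o3 2) (o3 3) x
    + 4 * phi (o3 2) x * f (o3 1) (o3 3) x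
    - 4 * phi (o3 3) x * f (o3 1) (o3 2) x
    + \sum_(i < 3) dstar_nu (w34 i)
    - 2 * dstar_nu (o4 4)
    - 2^-1 * \sum_(i < 3) dot1 (w34 i) (w34 i)
    + dot1 (o4 1) (o4 2) + dot1 (o4 1) (o4 3) - dot1 (o4 1) (o4 4)
    + dot1 (o4 2) (o4 3) - dot1 (o4 2) (o4 4) - dot1 (o4 3) (o4 4)
    - 2 * @star R 5 5 0 (g c y) (vol y)
            (wedge (ext_d (form_of_fun (f (o3 1) (o3 1) \o cinv c)) y)
                   (wedge (omega (o3 1) c y) (omega (o3 1) c y))) 0
    - 2^-1 * \sum_(i < 4) form_dot (g c y) (sigma i c y) (sigma i c y).
Proof.
move=> [da dw _ [v [dv wedgeE v_al]] sgn] [_ _ dnu dsg nu0 sg3 dom dal] [mg gE] c y cy.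
move=> x vol dot1 dstar_nu.
have fal z : cim c z -> is_form (alpha c z) by exact: dform_form.
have fom r z : cim c z -> is_form (omega r c z) by exact: dform_form.
have adapted z : cim c z -> exists F, adapted_frame (alpha c z) (omega^~ c ^~ z) F.
  move=> cz; apply: (@adapted_frame_exists R (alpha c z) (omega^~ c ^~ z) (v c z)).
  - exact: fal.
  - by move=> r; exact: fom.
  - exact: (dform_form dv).
  - by move=> i j w; exact: wedgeE.
  - exact: v_al.
  - by move=> X Y; exact: sgn.
have gF z F : cim c z -> adapted_frame (alpha c z) (omega^~ c ^~ z) F ->
    forall X Y : 'rV[R]_5, (X *m g c z *m Y^T) 0 0 = \sum_i coframe_of F i X * coframe_of F i Y.
  move=> cz aF; apply: (gE c z cz).
  exact: (adapted_frame_coframe (fal z cz) (fun r => fom r z cz) aF).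
have [U [E [oU Uy Uc C2E aE]]] := smooth_adapted_coframe (@cim_open R 5 M c) fal fom
  (@dform_smooth R 5 M 1 alpha da c) (fun r => @dform_smooth R 5 M 2 (omega r) (dw r) c)
  (@metric_smooth R 5 M g mg c) adapted gF cy.
have uE z : U z -> E z \in unitmx by move=> /aE [].
have GE z : U z -> g c z = frame_gram E z by move=> /aE [].
have aF z : U z -> adapted_frame (alpha c z) (omega^~ c ^~ z) (dual_frame (E z)).
  by move=> /aE [].
have volE z : U z -> vol z = (fun v => \det (E z) * \det v).
  move=> Uz; rewrite /vol /su2_volume (GE z Uz).
  exact: (volume_adapted (fal z (Uc z Uz)) (fun r => fom r z (Uc z Uz)) (uE z Uz) (aF z Uz)).
have falU z (Uz : U z) := fal z (Uc z Uz).
have fomU r z (Uz : U z) := fom r z (Uc z Uz).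
have fnuU i z (Uz : U z) := dform_form (dnu i) (Uc z Uz).
have fsgU i z (Uz : U z) := dform_form (dsg i) (Uc z Uz).
have nu0U i z (Uz : U z) := nu0 i c z (Uc z Uz).
have sg3U i z (Uz : U z) := sg3 i c z (Uc z Uz).
have domU r z (Uz : U z) := dom r c z (Uc z Uz).
have dalU z (Uz : U z) := dal c z (Uc z Uz).
exact: (@scalar_curvature_torsion R U E (alpha c) (omega^~ c) (fun i j => f i j \o cinv c)
  (fun i => phi i \o cinv c) (nu^~ c) (sigma^~ c) oU C2E uE falU fomU aF fnuU fsgU nu0U
  sg3U domU dalU (g c) vol GE volE y Uy).
Qed.
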